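(* Let the spatial domain be either $\mathbb{R}$ or $\mathbb{T}=\mathbb{R}/2\pi\mathbb{Z}$ and let $s<3/2$. For every $\varepsilon>0$ there exist $T>0$ and a 2-peakon solution $u\in C([0,T);H^s)$ of the Novikov equation $$u_t+u^2u_x+\partial_xD^{-2}\Big[u^3+\tfrac32uu_x^2\Big]+D^{-2}\Big[\tfrac12u_x^3\Big]=0,\qquad u(x,0)=u_0(x),$$ with lifespan $T$, such that $$T<\varepsilon\qquad\text{and}\qquad \|u_0\|_{H^s}<\varepsilon,$$ and such that, as $t\to T^-$: (i) if $5/4<s<3/2$, then $\lim_{t\to T^-}\|u(t)\|_{H^s}=\infty$; (ii) if $s<5/4$, then $\lim_{t\to T^-}\|u(t)\|_{H^s}=C_s$ for some $C_s>0$. Moreover, in this case $u(t)$ converges in $H^s$ as $t\to T^-$ to an antipeakon $u(T)$ with $\|u(T)\|_{H^s}=C_s$, so that $u\in C([0,T];H^s)$. Here, for some $c_T>0$ and $q_T>0$, on the line $$u(T)=-\sqrt{c_T}\,e^{-|x-q_T|},$$ and on the circle $$u(T)=-\frac{\sqrt{c_T}}{\cosh\pi}\cosh([x-q_T]_p-\pi).$$ (For $s=5/4$ nothing is asserted about $\lim_{t\to T^-}\|u(t)\|_{H^s}$.)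
   Context: $D^{-2}=(1-\partial_x^2)^{-1}$. On the circle, $[x]_p=x-2\pi\lfloor x/(2\pi)\rfloor$. A 2-peakon is a function of the form $u(x,t)=p_1(t)e^{-|x-q_1(t)|}+p_2(t)e^{-|x-q_2(t)|}$ on the line, and $u(x,t)=p_1(t)\cosh([x-q_1(t)]_p-\pi)+p_2(t)\cosh([x-q_2(t)]_p-\pi)$ on the circle, where $q_1,q_2$ (positions) and $p_1,p_2$ (momenta) are smooth real functions on $[0,T)$ with $q=q_2-q_1>0$. It is a 2-peakon solution if it satisfies the Novikov equation in the sense of distributions for $0<t<T$. Its lifespan $T$ is the collision time: $q(t)>0$ on $[0,T)$ and $q(t)\to0$ as $t\to T^-$. The norm is $\|f\|_{H^s}^2=\int_{\mathbb{R}}(1+\xi^2)^s|\widehat f(\xi)|^2d\xi$ on the line and $\sum_{n\in\mathbb{Z}}(1+n^2)^s|\widehat f(n)|^2$ on the circle. *)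

(* Defs.v *)
From HB Require Import structures.
From mathcomp Require Import all_boot all_order all_algebra.
From mathcomp Require Import all_classical all_reals all_analysis.
Set Implicit Arguments.
Unset Strict Implicit.
Unset Printing Implicit Defensive.
Import Order.TTheory GRing.Theory Num.Theory.
Import numFieldNormedType.Exports.
Local Open Scope classical_set_scope.
Local Open Scope ring_scope.

(* A function on the circle is a 2 pi-periodic function on the real line,
   integrated over [0, 2 pi]. *)
Inductive spatial_domain := Line | Circle.

Section Domain.
Context {R : realType}.
Implicit Types (X : spatial_domain) (f : R -> R) (s T : R).

Local Notation mu := (@lebesgue_measure R).

Definition dom X : set R :=
  match X with Line => [set: R] | Circle => `[0, 2 * pi] end.

Definition periodic f := forall x : R, f (x + 2 * pi) = f x.

Definition on_domain X f :=
  match X with Line => True | Circle => periodic f end.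

(* |f^(k)|^2 with the convention f^(k) = \int f(x) e^{- i k x} dx on both
   domains. Another normalization multiplies every H^s norm by a constant. *)
Definition fourier_sq X f (k : R) : R :=
  (\int[mu]_(x in dom X) (f x * cos (k * x))) ^+ 2 +
  (\int[mu]_(x in dom X) (f x * sin (k * x))) ^+ 2.

Definition Hs_sq X s f : \bar R :=
  match X with
  | Line => (\int[mu]_k (((1 + k ^+ 2) `^ s * fourier_sq X f k)%:E))%E
  | Circle =>
      (\esum_(n in [set: int])
         ((1 + n%:~R ^+ 2) `^ s * fourier_sq X f n%:~R)%:E)%E
  end.

(* Only integrable functions are considered: for them the Fourier transform in
   the sense of distributions is the classical integral, for every real s. *)
Definition in_Hs X s f :=
  [/\ on_domain X f, mu.-integrable (dom X) (EFin \o f) &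
      (Hs_sq X s f < +oo)%E].

Definition Hs_norm X s f : R := Num.sqrt (fine (Hs_sq X s f)).

(* u \in C(I; H^s); the function u(t) is u ^~ t, that is, x |-> u x t. *)
Definition C_Hs X s (I : set R) (u : R -> R -> R) :=
  (forall t, I t -> in_Hs X s (u ^~ t)) /\
  (forall t0, I t0 ->
     Hs_norm X s (fun x => u x t - u x t0) @[t --> within I (nbhs t0)] --> 0).

End Domain.

Section Smooth.
Context {R : realType}.

Definition iterated_derivative (V : normedModType R) (phi : V -> R)
    (vs : seq V) : V -> R :=
  foldr (fun v g => 'D_v g) phi vs.

Definition smooth (V : normedModType R) (phi : V -> R) :=
  forall vs : seq V,
    continuous (iterated_derivative phi vs) /\
    forall v z, derivable (iterated_derivative phi vs) z v.

(* Smoothness on a set A that need not be open: f agrees on A with a function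
   that is C^oo on an open set containing A. *)
Definition smooth_on (A : set R) (f : R -> R) :=
  exists (U : set R) (g : R -> R),
    [/\ open U, A `<=` U, forall t, A t -> g t = f t &
        forall (n : nat) t, U t -> derivable (derive1n n g) t 1].

End Smooth.

Section Distributions.
Context {R : realType}.
Implicit Types (X : spatial_domain) (T : R) (f u v w : R -> R -> R).

Local Notation mu := (@lebesgue_measure R).
Local Notation mu2 := (mu \x mu)%E.

Definition dx (phi : R^o * R^o -> R) : R^o * R^o -> R := 'D_(1, 0) phi.
Definition dt (phi : R^o * R^o -> R) : R^o * R^o -> R := 'D_(0, 1) phi.

(* C_c^oo of (spatial domain) x (0, T). *)
Definition test_function X T (phi : R^o * R^o -> R) :=
  smooth phi /\
  exists c d : R, [/\ 0 < c, d < T,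
    forall x t, phi (x, t) != 0 -> c <= t <= d &
    match X with
    | Line => exists a b : R, forall x t, phi (x, t) != 0 -> a <= x <= b
    | Circle => forall t, periodic (fun x => phi (x, t))
    end].

Definition L1loc X T f :=
  forall a b c d : R, 0 < c -> d < T ->
    mu2.-integrable ((dom X `&` `[a, b]) `*` `[c, d])
      (fun z => (f z.1 z.2)%:E).

Definition pairing X T f (phi : R^o * R^o -> R) : R :=
  \int[mu2]_(z in dom X `*` `]0, T[) (f z.1 z.2 * phi z).

(* v = u_x in the sense of distributions. *)
Definition weak_dx X T u v :=
  [/\ L1loc X T u, L1loc X T v &
    forall phi, test_function X T phi ->
      pairing X T u (dx phi) = - pairing X T v phi].

(* w = D^{-2} f, i.e. (1 - \partial_x^2) w = f in the sense of distributions.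
   Boundedness in x excludes the solutions e^x, e^{-x} of the homogeneous
   equation on the line, so that w is determined almost everywhere by f. *)
Definition is_Dm2 X T f w :=
  [/\ L1loc X T f, L1loc X T w,
    forall c d : R, 0 < c -> d < T ->
      exists M : R, forall x t, dom X x -> c <= t <= d -> `|w x t| <= M &
    forall phi, test_function X T phi ->
      pairing X T w (fun z => phi z - dx (dx phi) z) = pairing X T f phi].

(* u_t + u^2 u_x + \partial_x D^{-2}[u^3 + 3/2 u u_x^2] + D^{-2}[1/2 u_x^3] = 0
   in the sense of distributions for 0 < t < T, where v = u_x, and w1, w2 are
   the two nonlocal functions. *)
Definition Novikov X T u :=
  exists v w1 w2 : R -> R -> R,
  [/\ weak_dx X T u v,
      L1loc X T (fun x t => u x t ^+ 2 * v x t),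
      is_Dm2 X T (fun x t => u x t ^+ 3 + 3 / 2 * u x t * v x t ^+ 2) w1,
      is_Dm2 X T (fun x t => 1 / 2 * v x t ^+ 3) w2 &
      forall phi, test_function X T phi ->
        - pairing X T u (dt phi)
        + pairing X T (fun x t => u x t ^+ 2 * v x t) phi
        - pairing X T w1 (dx phi)
        + pairing X T w2 phi = 0].

End Distributions.

Section Peakons.
Context {R : realType}.
Implicit Types (X : spatial_domain) (x t T : R) (p q : R -> R).

Definition cosh (x : R) : R := (expR x + expR (- x)) / 2.

Definition mod2pi (x : R) : R :=
  x - 2 * pi * (Num.floor (x / (2 * pi)))%:~R.

Definition profile X x : R :=
  match X with
  | Line => expR (- `|x|)
  | Circle => cosh (mod2pi x - pi)
  end.

Definition two_peakon X p1 p2 q1 q2 : R -> R -> R :=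
  fun x t => p1 t * profile X (x - q1 t) + p2 t * profile X (x - q2 t).

Definition two_peakon_solution X T p1 p2 q1 q2 :=
  [/\ [/\ smooth_on `[0, T[ p1, smooth_on `[0, T[ p2,
          smooth_on `[0, T[ q1 & smooth_on `[0, T[ q2],
      forall t, 0 <= t < T -> 0 < q2 t - q1 t &
      Novikov X T (two_peakon X p1 p2 q1 q2)].

(* T is the collision time; positivity of q2 - q1 on [0, T) is already part of
   two_peakon_solution. *)
Definition lifespan T q1 q2 := q2 t - q1 t @[t --> T^'-] --> (0 : R).

Definition antipeakon X (c q : R) : R -> R :=
  match X with
  | Line => fun x => - Num.sqrt c * expR (- `|x - q|)
  | Circle => fun x => - (Num.sqrt c / cosh pi) * cosh (mod2pi (x - q) - pi)
  end.

Definition extend_at T (u : R -> R -> R) (U : R -> R) : R -> R -> R :=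
  fun x t => if t < T then u x t else U x.

End Peakons.

(* Main.v *)
(* With g the peakon profile, G = g on (0, 2 pi) and C = g(0), a 2-peakon solves
   the equation weakly as soon as q_j' = u(q_j)^2 and the momenta obey
   p1' = p1 p2 (p1 C + p2 G(q)) G'(q), p2' = - p1 p2 (p2 C + p1 G(q)) G'(q),
   q = q2 - q1: testing against psi with psi - psi'' = phi turns the nonlocal
   terms into an exact x-derivative between the peaks.
   In the variable y with y^4 = (C - G(q)) / (C + G(q)) this system integrates
   explicitly; y decreases to 0 in a short time, so the peaks collide with
   q ~ y^4, while p1 + p2 stays bounded and p2 - p1 ~ 1 / y.
   Writing u = (p1 + p2) g(. - q1) + p2 (g(. - q2) - g(. - q1)), the H^s norm is
   governed by |p2| ||g(. - q2) - g(. - q1)||, of order y^(-1) q^(3/2 - s),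
   that is y^(5 - 4 s): it blows up for s > 5/4 and tends to 0 for s < 5/4. *)
Require Import Defs.
From HB Require Import structures.
From mathcomp Require Import all_boot all_order all_algebra.
From mathcomp Require Import all_classical all_reals all_analysis.
From mathcomp Require Import measurable_realfun ring lra zify.
Import Order.TTheory GRing.Theory Num.Theory.
Import numFieldNormedType.Exports.
Local Open Scope classical_set_scope.
Local Open Scope ring_scope.
Set Implicit Arguments.
Unset Strict Implicit.
Unset Printing Implicit Defensive.

(** * Translations of Lebesgue measure and Borel sets of the plane *)

Section MeasureTools.
Context {R : realType}.
Local Notation mu := (@lebesgue_measure R).

(** The peakon equations are singular at the collision, where the momenta become infinite. As
    functions of y all unknowns are explicit, and y itself solves a scalar autonomous equation whose
    right-hand side is continuous and nonzero at y = 0 and on both sides of it. Inverting a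
    primitive of its reciprocal yields the solution, the collision time and the limits at T, with no
    existence theory for the system. The free constants are fixed in this order: delta, the initial
    size of |p1 + p2|, is small; P, the size of the momenta, is so large that the lifespan, at most
    a constant over delta P, is short whatever y0 is; y0 comes last and makes the pair of opposite
    peaks, whose distance is of order y0^4, negligible in H^s. Both domains are treated at once: G''
    = G with G^2 - G'^2 constant, and the Fourier transform of the profile is 2 A / (1 + k^2) in
    either case. Norms are taken only of finite combinations of translated profiles, so they reduce
    to weighted sums or integrals of squared exponential sums. *)

Lemma lebesgue_measure_shift (c : R) (A : set R) : measurable A ->
  pushforward mu (fun x : measurableTypeR R => x + c : measurableTypeR R) A = mu A.
Proof.
have ms : measurable_fun setT
    (fun x : measurableTypeR R => x + c : measurableTypeR R).
  by apply: continuous_measurable_fun => x; apply: cvgD; [exact: cvg_id|exact: cvg_cst].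
move=> mA; apply/esym.
apply: (@lebesgue_measure_unique R (measure_function.pushforward mu _)) => //= _ [[a b]] _ <-.
rewrite /pushforward.
rewrite (_ : _ @^-1` _ = `]a - c, b - c]%classic); last first.
  by apply/seteqP; split => x /=; rewrite !in_itv/= ltrBlDr lerBrDr.
rewrite !lebesgue_measure_itv/= !lte_fin ltrD2r.
by case: ifP => // _; congr EFin; ring.
Qed.

(** Measurability on [R * R] refers to the product sigma-algebra, continuity to the topology. They
    meet because an open set of the plane is a countable union of squares with rational centres and
    radii 1 / (n + 1), each a product of measurable sets. *)
Lemma continuous_measurable2 (f : R * R -> R) :
  continuous (f : R^o * R^o -> R) -> measurable_fun [set: R * R] f.
Proof.
move=> cf.
apply: (measurability _ (RGenOInfty.measurableE R)) => //.
move=> /= _ [_ [r ->] <-]; rewrite setTI.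
set U := f @^-1` _.
have oU : open (U : set (R^o * R^o)).
  rewrite /U; have -> : [set` `]r, +oo[%R] = [set x : R | r < x] by apply/seteqP; split => x /=; rewrite in_itv/= andbT.
  by apply: (@open_comp _ _ (f : R^o * R^o -> R)); [move=> x _; exact: cf|exact: open_gt].
pose Bq (q : rat * rat * nat) : set (R * R) :=
  ball (ratr q.1.1 : R) (q.2.+1%:R^-1 : R) `*` ball (ratr q.1.2 : R) (q.2.+1%:R^-1 : R).
rewrite (_ : U = \bigcup_(q in [set q | Bq q `<=` U]) Bq q); last first.
  apply/seteqP; split => [[x y] Uxy|z [q /= qU]]; last exact: qU.
  have /nbhs_ballP [e /= e0 eU] : nbhs ((x, y) : R^o * R^o) U by exact: oU.
  (* This n gives 2 / (n + 1) < e: a square of radius 1 / (n + 1) whose centre is within 1 / (n + 1)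
     of (x, y) stays in the ball of radius e. *)
  pose n := Num.truncn (2 / e).
  have n0 : 0 < n.+1%:R^-1 :> R by rewrite invr_gt0 ltr0n.
  have ne : n.+1%:R^-1 + n.+1%:R^-1 < e :> R.
    have n1 : n.+1%:R != 0 :> R by rewrite pnatr_eq0.
    have : 2 / e < n.+1%:R by rewrite /n truncnS_gt.
    rewrite ltr_pdivrMr// => h.
    by rewrite -(ltr_pM2l (x := n.+1%:R)) ?ltr0n// mulrDr mulfV.
  have rr (w : R) : exists q : rat, ball w n.+1%:R^-1 (ratr q : R).
    have b0 : ball w n.+1%:R^-1 !=set0 by exists w; exact: ballxx.
    have bo : open (ball w n.+1%:R^-1) by exact: ball_open.
    have [z [bz [q _ qz]]] := @dense_rat R _ b0 bo.
    by exists q; rewrite qz.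
  have [q1 hq1] := rr x; have [q2 hq2] := rr y.
  exists (q1, q2, n) => /=.
    move=> [a b] [/= ha hb]; apply: eU; split => /=.
      by apply: le_ball (ltW ne) _ _; exact: ball_triangle hq1 ha.
    by apply: le_ball (ltW ne) _ _; exact: ball_triangle hq2 hb.
  by split => /=; apply: ball_sym.
rewrite bigcup_mkcond; apply: countable_bigcupT_measurable => // q.
by case: ifP => // _; apply: measurableX; exact: measurable_ball.
Qed.

End MeasureTools.

(** * Changes of variables and the fundamental theorem of calculus on half-lines *)

Section Substitution.
Context {R : realType}.
Local Notation mu := (@lebesgue_measure R).

(** The positive and the negative part are pushed forward separately, so the identity holds for
    every measurable f. *)
Lemma Rintegral_preserving (phi : measurableTypeR R -> measurableTypeR R)
    (D : set R) (f : R -> R) :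
  measurable_fun setT phi ->
  (forall A : set R, measurable A -> pushforward mu phi A = mu A) ->
  measurable D -> measurable_fun setT f ->
  \int[mu]_(x in D) f x = \int[mu]_(x in phi @^-1` D) f (phi x).
Proof.
move=> mphi pphi mD mf; rewrite /Rintegral; congr fine.
have mEf : measurable_fun D (EFin \o f).
  by apply/measurable_EFinP; exact: measurable_funTS.
rewrite integralE [RHS]integralE.
have tr (h : R -> \bar R) : measurable_fun D h -> (forall x, 0 <= h x)%E ->
    (\int[mu]_(x in D) h x = \int[mu]_(x in phi @^-1` D) (h \o phi) x)%E.
  move=> mh h0.
  have := @ge0_integral_pushforward _ _ (measurableTypeR R) (measurableTypeR R) R phi
    mphi mu D h mD mh (fun y _ => h0 y).
  move=> /= <-.
  unshelve eapply eq_measure_integral; first exact: mphi.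
  by move=> A mA _; rewrite /= pphi.
rewrite (tr (EFin \o f)^\+%E)//; last exact: measurable_funepos.
rewrite (tr (EFin \o f)^\-%E)//; last exact: measurable_funeneg.
by congr (_ - _)%E; apply: eq_integral => x _; rewrite /= ?funeposE ?funenegE.
Qed.

Lemma Rintegral_shift (D : set R) (f : R -> R) (c : R) :
  measurable D -> measurable_fun setT f ->
  \int[mu]_(x in D) f x = \int[mu]_(x in [set x | D (x + c)]) f (x + c).
Proof.
move=> mD mf.
have ms : measurable_fun setT
    (fun x : measurableTypeR R => x + c : measurableTypeR R).
  by apply: continuous_measurable_fun => x; apply: cvgD; [exact: cvg_id|exact: cvg_cst].
apply: (@Rintegral_preserving (fun x => x + c)) => //.
by move=> A mA; exact: lebesgue_measure_shift.
Qed.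

Lemma Rintegral_opp (D : set R) (f : R -> R) :
  measurable D -> measurable_fun setT f ->
  \int[mu]_(x in D) f x = \int[mu]_(x in [set x | D (- x)]) f (- x).
Proof.
move=> mD mf.
have ms : measurable_fun setT
    (fun x : measurableTypeR R => - x : measurableTypeR R).
  by apply: continuous_measurable_fun => x; exact: opp_continuous.
apply: (@Rintegral_preserving (fun x => - x)) => //.
by move=> A mA; exact: lebesgue_measureN.
Qed.

Lemma is_derive1_continuous (f : R -> R) (x df : R) :
  is_derive x 1 f df -> {for x, continuous f}.
Proof. by case=> + _ => /derivable1_diffP/differentiable_continuous. Qed.

Lemma Rintegral_FTC (F f : R -> R) (a b : R) : a <= b ->
  (forall x : R, is_derive x 1 F (f x)) -> continuous f ->
  \int[mu]_(x in `[a, b]) f x = F b - F a.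
Proof.
rewrite le_eqVlt => /predU1P[->|ab] dF cf.
  by rewrite set_itv1 Rintegral_set1 subrr.
have cF : continuous F by move=> x; exact: is_derive1_continuous (dF x).
rewrite /Rintegral (@continuous_FTC2 _ f F)//.
- exact: continuous_subspaceT.
- split; [by move=> x _; have [] := dF x| |].
  + by apply: cvg_at_right_filter; exact: cF.
  + by apply: cvg_at_left_filter; exact: cF.
- by move=> x _; rewrite derive1E; have [_ ->] := dF x.
Qed.

Lemma ge0_integral_FTCy (F f : R -> R) (a : R) :
  (forall x : R, is_derive x 1 F (f x)) -> continuous f ->
  (forall x, a <= x -> 0 <= f x) -> F x @[x --> +oo] --> (0 : R) ->
  (\int[mu]_(x in `[a, +oo[) (f x)%:E = (- F a)%:E)%E.
Proof.
move=> dF cf f0 F0.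
have cF : continuous F by move=> x; exact: is_derive1_continuous (dF x).
rewrite (@ge0_continuous_FTC2y R f F a 0)//.
- by rewrite -EFinB sub0r.
- exact: continuous_subspaceT.
- by apply: cvg_at_right_filter; exact: cF.
- by move=> x _; rewrite derive1E; have [_ ->] := dF x.
Qed.

Lemma is_derive_expNx (M x : R) :
  is_derive x 1 (fun x => - (M * expR (- x))) (M * expR (- x)).
Proof. by apply: is_derive_eq; rewrite /GRing.scale/=; ring. Qed.

Lemma cvg_expNx (M : R) : M * expR (- x) @[x --> +oo] --> (0 : R).
Proof. by rewrite -(mulr0 M); apply: cvgM; [exact: cvg_cst|exact: cvgr_expR]. Qed.

Lemma integrable_expNx (M a : R) : mu.-integrable `[a, +oo[ (EFin \o (fun x => M * expR (- x))).
Proof.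
have c1 N : continuous (fun x : R => N * expR (- x)).
  move=> x; apply: cvgM; first exact: cvg_cst.
  by apply: continuous_comp; [exact: opp_continuous|exact: continuous_expR].
apply/integrableP; split.
  by apply/measurable_EFinP; apply: measurable_funTS; exact: continuous_measurable_fun.
under eq_integral do rewrite /= normrM (ger0_norm (expR_ge0 _)).
rewrite (ge0_integral_FTCy (is_derive_expNx `|M|)) ?ltry//.
by rewrite -oppr0; apply: cvgN; exact: cvg_expNx.
Qed.

(** Adding M e^{-x} makes the integrand nonnegative, so that [ge0_integral_FTCy] applies to the sum;
    the added exponential is integrated by the same lemma and subtracted. *)
Lemma Rintegral_FTCy (F f : R -> R) (a M : R) :
  (forall x : R, is_derive x 1 F (f x)) -> continuous f ->
  (forall x, a <= x -> `|f x| <= M * expR (- x)) ->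
  (forall x, a <= x -> `|F x| <= M * expR (- x)) ->
  \int[mu]_(x in `[a, +oo[) f x = - F a.
Proof.
move=> dF cf bf bF.
have c1 N : continuous (fun x : R => N * expR (- x)).
  move=> x; apply: cvgM; first exact: cvg_cst.
  by apply: continuous_comp; [exact: opp_continuous|exact: continuous_expR].
have F0 : F x @[x --> +oo] --> (0 : R).
  apply: norm_cvg0; apply: (squeeze_cvgr _ (cvg_cst (0 : R)) (cvg_expNx M)).
  by near=> x; rewrite normr_ge0/= bF.
have intf : mu.-integrable `[a, +oo[ (EFin \o f).
  apply: le_integrable (integrable_expNx M a) => //.
    by apply/measurable_EFinP; apply: measurable_funTS; exact: continuous_measurable_fun.
  move=> x /=; rewrite in_itv/= andbT => ax.
  by rewrite lee_fin (le_trans (bf _ ax))// ler_norm.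
have -> : \int[mu]_(x in `[a, +oo[) f x =
    \int[mu]_(x in `[a, +oo[) (f x + M * expR (- x)) -
    \int[mu]_(x in `[a, +oo[) (M * expR (- x)).
  by rewrite RintegralD ?addrK//; exact: integrable_expNx.
have dFM (x : R) : is_derive x 1 (fun x => F x - M * expR (- x)) (f x + M * expR (- x)).
  by apply: is_deriveD; exact: is_derive_expNx.
rewrite {1}/Rintegral (ge0_integral_FTCy dFM).
- rewrite /Rintegral (ge0_integral_FTCy (is_derive_expNx M)).
  + by rewrite /=; ring.
  + exact: c1.
  + by move=> x ax; rewrite (le_trans _ (bf _ ax)).
  + by rewrite -oppr0; apply: cvgN; exact: cvg_expNx.
- by move=> x; apply: cvgD; [exact: cf|exact: c1].
- by move=> x ax; have := bf _ ax; rewrite ler_norml => /andP[]; lra.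
- by rewrite -(subr0 0); apply: cvgB => //; exact: cvg_expNx.
Unshelve. all: by end_near. Qed.

End Substitution.

(** * The peakon profile and its Green identity *)

Section Profile.
Context {R : realType}.
Implicit Types (X : spatial_domain) (x z c : R).

Definition sinh x : R := (expR x - expR (- x)) / 2.

(* On the fundamental domain the profile is x |-> peakG |x|, with
   peakG' = peakS and peakS' = peakG; peakA is half the jump of the derivative
   of the profile at 0. *)
Definition peakG X z : R :=
  match X with Line => expR (- z) | Circle => cosh (z - pi) end.

Definition peakS X z : R :=
  match X with Line => - expR (- z) | Circle => sinh (z - pi) end.

Definition peakA X : R := match X with Line => 1 | Circle => sinh pi end.

(** The constant value of the first integral G^2 - G'^2 of G'' = G. *)
Definition peak_kappa X : R := match X with Line => 0 | Circle => 1 end.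

(** At the kink the value is the right derivative, on both domains. *)
Definition dprofile X x : R :=
  match X with
  | Line => if 0 <= x then - expR (- x) else expR x
  | Circle => sinh (mod2pi x - pi)
  end.

Lemma pi2_gt0 : 0 < 2 * pi :> R.
Proof. by rewrite mulr_gt0// pi_gt0. Qed.

Lemma coshN x : cosh (- x) = cosh x.
Proof. by rewrite /cosh opprK addrC. Qed.

Lemma sinhN x : sinh (- x) = - sinh x.
Proof. by rewrite /sinh opprK; ring. Qed.

Lemma cosh2_sinh2 x : cosh x ^+ 2 - sinh x ^+ 2 = 1.
Proof.
rewrite /cosh /sinh; have := expRxMexpNx_1 x.
set a := expR x; set b := expR (- x) => ab.
by apply: etrans ab; field.
Qed.

Lemma cosh_gt0 x : 0 < cosh x.
Proof. by rewrite /cosh divr_gt0// addr_gt0// expR_gt0. Qed.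

Lemma cosh_ge1 x : 1 <= cosh x.
Proof.
have := cosh2_sinh2 x; have := cosh_gt0 x; have := sqr_ge0 (sinh x).
set a := cosh x; set b := sinh x => h1 h2 h3; nra.
Qed.

Lemma le_cosh x y : `|x| <= y -> cosh x <= cosh y.
Proof.
rewrite ler_norml => /andP[h1 h2].
rewrite /cosh ler_pM2r ?invr_gt0//.
have h3 : expR x <= expR y by rewrite ler_expR.
have h4 : expR (- x) <= expR y by rewrite ler_expR; lra.
have := expRxMexpNx_1 x; have := expRxMexpNx_1 y.
have := expR_gt0 y; have := expR_gt0 (- y); have := expR_gt0 x; have := expR_gt0 (- x).
move: h3 h4; set a := expR x; set b := expR (- x); set c := expR y; set d := expR (- y).
move=> h3 h4 b0 a0 d0 c0 cd ab.
(* Multiplying the difference of the two hyperbolic cosines by e^y makes it factor as (e^y -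
   e^x)(e^y - e^{-x}). *)
suff : 0 <= c * (c + d - (a + b)) by rewrite pmulr_rge0//; lra.
have -> : c * (c + d - (a + b)) = (c - a) * (c - b).
  by rewrite mulrBr mulrDr cd -ab; ring.
by apply: mulr_ge0; lra.
Qed.

Lemma normr_sinh_le x : `|sinh x| <= cosh x.
Proof.
rewrite ler_norml /sinh /cosh; have := expR_gt0 x; have := expR_gt0 (- x).
by move=> *; apply/andP; split; lra.
Qed.

Lemma sinhpi_gt0 : 0 < sinh (pi : R).
Proof. by rewrite /sinh divr_gt0// subr_gt0 ltr_expR; have := pi_gt0 R; lra. Qed.

Lemma is_derive_cosh x : is_derive x 1 cosh (sinh x).
Proof. by rewrite /cosh /sinh; apply: is_derive_eq; rewrite /GRing.scale/=; ring. Qed.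

Lemma is_derive_sinh x : is_derive x 1 sinh (cosh x).
Proof. by rewrite /cosh /sinh; apply: is_derive_eq; rewrite /GRing.scale/=; ring. Qed.

Lemma is_derive_peakG X x : is_derive x 1 (peakG X) (peakS X x).
Proof.
case: X => /=.
  by apply: is_derive_eq; rewrite /GRing.scale/=; ring.
by rewrite /cosh /sinh; apply: is_derive_eq; rewrite /GRing.scale/=; ring.
Qed.

Lemma is_derive_peakS X x : is_derive x 1 (peakS X) (peakG X x).
Proof.
case: X => /=.
  by apply: is_derive_eq; rewrite /GRing.scale/=; ring.
by rewrite /cosh /sinh; apply: is_derive_eq; rewrite /GRing.scale/=; ring.
Qed.

Lemma peakGS X x : peakG X x ^+ 2 - peakS X x ^+ 2 = peak_kappa X.
Proof. by case: X => /=; [ring|exact: cosh2_sinh2]. Qed.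

Lemma peakS0 X : peakS X 0 = - peakA X.
Proof. by case: X => /=; rewrite ?oppr0 ?expR0// sub0r sinhN. Qed.

Lemma peakA_gt0 X : 0 < peakA X.
Proof. by case: X => //=; exact: sinhpi_gt0. Qed.

Lemma peakG_gt0 X x : 0 < peakG X x.
Proof. by case: X => /=; [exact: expR_gt0|exact: cosh_gt0]. Qed.

Lemma peakG2pi x : peakG Circle (2 * pi - x) = peakG Circle x.
Proof. by rewrite /= -coshN; congr cosh; ring. Qed.

Lemma peakS2pi x : peakS Circle (2 * pi - x) = - peakS Circle x.
Proof. by rewrite /= -sinhN; congr sinh; ring. Qed.

Lemma mod2pi_bounds x : 0 <= mod2pi x < 2 * pi.
Proof.
rewrite /mod2pi; have /andP[] := Num.Theory.floor_itv (x / (2 * pi)).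
rewrite intrD ler_pdivlMr ?pi2_gt0// ltr_pdivrMr ?pi2_gt0//.
by set n := (Num.floor _)%:~R; rewrite mulrDl mul1r => h1 h2; apply/andP; split; lra.
Qed.

Lemma mod2pi_unique x (n : int) : 0 <= x - 2 * pi * n%:~R < 2 * pi ->
  mod2pi x = x - 2 * pi * n%:~R.
Proof.
move=> /andP[h1 h2]; rewrite /mod2pi; suff -> : Num.floor (x / (2 * pi)) = n by [].
apply: Num.Theory.floor_def.
rewrite intrD ler_pdivlMr ?pi2_gt0// ltr_pdivrMr ?pi2_gt0//.
by rewrite mulrDl mul1r; apply/andP; split; lra.
Qed.

Lemma mod2pi_id x : 0 <= x < 2 * pi -> mod2pi x = x.
Proof. by move=> h; rewrite (@mod2pi_unique _ 0) mulr0 subr0. Qed.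

Lemma mod2piD x : mod2pi (x + 2 * pi) = mod2pi x.
Proof.
rewrite (@mod2pi_unique _ (Num.floor (x / (2 * pi)) + 1)) intrD.
  by rewrite /mod2pi; ring.
have := mod2pi_bounds x; rewrite /mod2pi => /andP[h1 h2].
by apply/andP; split; lra.
Qed.

Lemma measurable_mod2pi : measurable_fun [set: R] (@mod2pi R).
Proof.
rewrite /mod2pi; apply: measurable_funB => //.
apply: measurable_funM => //; apply: nondecreasing_measurable => // a b ab.
rewrite ler_int; apply: Num.Theory.le_floor.
by rewrite ler_pM2r// invr_gt0 pi2_gt0.
Qed.


Lemma profile_Circle x : 0 <= x <= 2 * pi -> profile Circle x = peakG Circle x.
Proof.
move=> /andP[x0]; rewrite le_eqVlt => /predU1P[->|x2] /=; last first.
  by rewrite mod2pi_id// x0.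
rewrite -[2 * pi]add0r mod2piD mod2pi_id ?lexx ?pi2_gt0// add0r -coshN.
by congr cosh; ring.
Qed.

Lemma periodic_profile : Defs.periodic (@profile R Circle).
Proof. by move=> x /=; rewrite mod2piD. Qed.

Lemma periodic_dprofile : Defs.periodic (dprofile Circle).
Proof. by move=> x /=; rewrite mod2piD. Qed.

Lemma profileN X x : profile X (- x) = profile X x.
Proof.
case: X => /=; first by rewrite normrN.
have /andP[h1 h2] := mod2pi_bounds x.
(* Reflection sends [mod2pi x] to 2 pi - [mod2pi x], except at the multiples of 2 pi, where it stays
   0. *)
have [h|h] := eqVneq (mod2pi x) 0.
  have e : - x - 2 * pi * (- Num.floor (x / (2 * pi)))%:~R = - mod2pi x.
    by rewrite mulrNz /mod2pi; ring.
  by rewrite (@mod2pi_unique (- x) (- Num.floor (x / (2 * pi)))) e h oppr0// lexx pi2_gt0.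
have h0 : 0 < mod2pi x by rewrite lt_def h.
rewrite -coshN; congr cosh.
have e : - x - 2 * pi * (- (Num.floor (x / (2 * pi)) + 1))%:~R = 2 * pi - mod2pi x.
  by rewrite mulrNz intrD /mod2pi; ring.
rewrite (@mod2pi_unique (- x) (- (Num.floor (x / (2 * pi)) + 1))) e; first by ring.
by apply/andP; split; lra.
Qed.

Lemma profile_le_abs X x : (X = Circle -> `|x| <= 2 * pi) -> profile X x = peakG X `|x|.
Proof.
case: X => // /(_ erefl) h.
have [x0|x0] := leP 0 x; first by rewrite profile_Circle ?ger0_norm// x0 -(ger0_norm x0).
move: h; rewrite ltr0_norm// => h; rewrite -profileN profile_Circle//.
by apply/andP; split; lra.
Qed.

Lemma dprofile_pos X x : 0 < x -> (X = Circle -> x < 2 * pi) ->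
  dprofile X x = peakS X x.
Proof.
case: X => /= x0; first by rewrite ltW.
by move=> /(_ erefl) x2; rewrite mod2pi_id// ltW.
Qed.

Lemma dprofile_neg X x : x < 0 -> (X = Circle -> - x < 2 * pi) ->
  dprofile X x = - peakS X (- x).
Proof.
case: X => /= x0; first by rewrite leNgt x0/= !opprK.
move=> /(_ erefl) x2; rewrite -mod2piD mod2pi_id; last by apply/andP; split; lra.
by rewrite -sinhN; congr sinh; ring.
Qed.

Lemma profile_gt0 X x : 0 < profile X x.
Proof. by case: X => /=; [exact: expR_gt0|exact: cosh_gt0]. Qed.

Lemma profile_le X x : profile X x <= peakG X 0.
Proof.
case: X => /=; first by rewrite oppr0 ler_expR oppr_le0.
rewrite sub0r coshN; apply: le_cosh; rewrite ler_norml.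
by have /andP[] := mod2pi_bounds x; move=> *; apply/andP; split; lra.
Qed.

Lemma normr_dprofile_le X x : `|dprofile X x| <= profile X x.
Proof.
case: X => /=; last exact: normr_sinh_le.
case: ifPn => [x0|]; first by rewrite normrN (ger0_norm x0) ger0_norm ?expR_ge0.
by rewrite -ltNge => x0; rewrite (ltr0_norm x0) opprK ger0_norm ?expR_ge0.
Qed.

(** One constant serves both domains: on the line e^{|c|} compensates for the shift, on the circle
    the profile takes values between 1 and cosh pi. *)
Lemma profile_shift X x c :
  profile X (x + c) <= cosh pi * expR `|c| * profile X x.
Proof.
have c1 := cosh_ge1 (pi : R).
have e1 : 1 <= expR `|c| by rewrite -expR0 ler_expR.
case: X => /=.
  rewrite -mulrA -expRD -[leLHS]mul1r; apply: ler_pM; rewrite ?expR_ge0//.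
  rewrite ler_expR; have := ler_normB (x + c) c; rewrite addrK; lra.
apply: (@le_trans _ _ (cosh pi)).
  by have := profile_le Circle (x + c); rewrite /= sub0r coshN.
rewrite -[leLHS]mulr1; have := cosh_ge1 (mod2pi x - pi).
move: c1 e1; set a := cosh pi; set b := expR _; set d := cosh _ => a1 b1 d1.
rewrite -mulrA ler_pM2l ?(lt_le_trans ltr01)//.
by rewrite -[leLHS]mulr1; apply: ler_pM.
Qed.

Lemma measurable_cosh : measurable_fun [set: R] cosh.
Proof.
by apply: continuous_measurable_fun => x; exact: is_derive1_continuous (is_derive_cosh x).
Qed.

Lemma measurable_sinh : measurable_fun [set: R] sinh.
Proof.
by apply: continuous_measurable_fun => x; exact: is_derive1_continuous (is_derive_sinh x).
Qed.

Lemma measurable_profile X : measurable_fun [set: R] (profile X).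
Proof.
case: X => /=.
  apply: measurableT_comp => //; apply: measurableT_comp => //; exact: measurableT_comp.
apply: (measurableT_comp measurable_cosh); apply: measurable_funB => //.
exact: measurable_mod2pi.
Qed.

Lemma measurable_dprofile X : measurable_fun [set: R] (dprofile X).
Proof.
case: X => /=.
  apply: measurable_fun_if => //.
  - by apply: measurable_fun_ler.
  - by apply: measurable_funTS; apply: measurableT_comp => //; apply: measurableT_comp => //; exact: measurableT_comp.
  - exact: measurable_funTS.
apply: (measurableT_comp measurable_sinh); apply: measurable_funB => //.
exact: measurable_mod2pi.
Qed.

End Profile.

(** * Integrals over the domain of functions dominated by the profile *)

Section DomainIntegral.
Context {R : realType}.
Local Notation mu := (@lebesgue_measure R).
Implicit Types (X : spatial_domain) (f : R -> R) (c : R).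

Lemma measurable_dom X : measurable (dom X : set (measurableTypeR R)).
Proof. by case: X => /=. Qed.

Lemma integrable_profile X : mu.-integrable (dom X) (EFin \o profile X).
Proof.
case: X => /=; last first.
  apply: measurable_bounded_integrable => //.
  - by rewrite /= lebesgue_measure_itv/= lte_fin pi2_gt0 -EFinB ltry.
  - by apply: measurable_funTS; exact: (measurable_profile Circle).
  - exists (peakG Circle 0); split; first exact: num_real.
    move=> M hM x _ /=; rewrite ger0_norm ?(ltW (profile_gt0 Circle x))//.
    exact: le_trans (profile_le Circle x) (ltW hM).
apply/integrableP; split.
  by apply/measurable_EFinP; exact: (measurable_profile Line).
under eq_integral do rewrite /= ger0_norm ?expR_ge0//.
have ce : continuous (fun x : R => expR (- `|x|)).
  move=> x; apply: continuous_comp; last exact: continuous_expR.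
  by apply: continuous_comp; [exact: norm_continuous|exact: opp_continuous].
rewrite (@ge0_symfun_integralT R (fun x => expR (- `|x|)))//; last first.
  by move=> x /=; rewrite normrN.
have /integrableP[_] := integrable_expNx (1 : R) 0.
under eq_integral do rewrite /= mul1r ger0_norm ?expR_ge0//.
rewrite set_itvcy => h; apply: lte_mul_pinfty => //.
have -> : (\int[mu]_(x in [set x | (0 <= x)%R]) (expR (- `|x|))%:E =
           \int[mu]_(x in [set x | (0 <= x)%R]) (expR (- x))%:E)%E => //.
by apply: eq_integral => x; rewrite inE/= => x0; rewrite ger0_norm.
Qed.

Lemma integrable_dominated X (D : set R) f M : measurable D -> D `<=` dom X ->
  measurable_fun setT f ->
  (forall x, D x -> `|f x| <= M * profile X x) -> mu.-integrable D (EFin \o f).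
Proof.
move=> mD DX mf bf.
have := integrableZl (measurable_dom X) M (integrable_profile X).
move=> /(integrableS (measurable_dom X) mD DX); apply: le_integrable => //.
  by apply/measurable_EFinP; exact: measurable_funTS.
by move=> x Dx /=; rewrite lee_fin (le_trans (bf _ Dx))// ler_norm.
Qed.

Lemma periodicz f x (n : int) : Defs.periodic f -> f (x + 2 * pi * n%:~R) = f x.
Proof.
move=> pf.
have pn (m : nat) y : f (y + 2 * pi * m%:R) = f y.
  elim: m y => [|m IH] y; first by rewrite mulr0 addr0.
  by rewrite -[m.+1]addn1 natrD mulrDr mulr1 addrA pf IH.
case: n => n; first exact: pn.
rewrite NegzE mulrNz mulrN; apply/esym.
by rewrite -[in LHS](subrK (2 * pi * n.+1%:R) x) pn.
Qed.

(** On the circle c is reduced to d in [0, 2 pi); the shift moves the period to [d, 2 pi + d], and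
    the piece that sticks out is the translate by 2 pi of the missing piece (0, d]. *)
Lemma Rintegral_dom_shift X f c M : measurable_fun setT f -> on_domain X f ->
  (forall x, `|f x| <= M * profile X x) ->
  \int[mu]_(x in dom X) f (x + c) = \int[mu]_(x in dom X) f x.
Proof.
case: X => /= mf pf bf.
  by rewrite [RHS](Rintegral_shift c).
pose d := mod2pi c; have /andP[d0 d2] := mod2pi_bounds c.
have -> : \int[mu]_(x in `[0, 2 * pi]) f (x + c) =
    \int[mu]_(x in `[0, 2 * pi]) f (x + d).
  apply: eq_Rintegral => x _.
  rewrite -(@periodicz f (x + d) (Num.floor (c / (2 * pi))) pf).
  by congr f; rewrite /d /mod2pi; ring.
have int a b : mu.-integrable `[a, b] (EFin \o f).
  apply: measurable_bounded_integrable => //.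
  - by rewrite /= lebesgue_measure_itv/=; case: ifP => _; rewrite ?ltry// -EFinB ltry.
  - exact: measurable_funTS.
  - exists (`|M| * peakG Circle 0); split; first exact: num_real.
    move=> N hN x _ /=; apply: le_trans (bf x) _; apply: ltW; apply: le_lt_trans hN.
    apply: (@le_trans _ _ (`|M| * profile Circle x)).
      by apply: ler_wpM2r; [exact: ltW (profile_gt0 Circle x)|exact: ler_norm].
    by apply: ler_wpM2l => //; exact: (profile_le Circle).
have into a b : mu.-integrable `]a, b] (EFin \o f).
  by apply: integrableS (int a b) => //; exact: subset_itv_oc_cc.
have -> : \int[mu]_(x in `[0, 2 * pi]) f (x + d) = \int[mu]_(x in `[d, 2 * pi + d]) f x.
  rewrite [RHS](Rintegral_shift d)//.
  suff -> : [set x | `[d, 2 * pi + d]%classic (x + d)] = `[0, 2 * pi]%classic by [].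
  by apply/seteqP; split => x /=; rewrite !in_itv/= lerD2r lerDr.
have s2 : \int[mu]_(x in `]0, d]) f x = \int[mu]_(x in `]2 * pi, 2 * pi + d]) f x.
  rewrite [RHS](Rintegral_shift (2 * pi))//.
  have -> : [set x | `]2 * pi, 2 * pi + d]%classic (x + 2 * pi)] = `]0, d]%classic.
    by apply/seteqP; split => x /=; rewrite !in_itv/= ltrDr [2 * pi + d]addrC lerD2r.
  by apply: eq_Rintegral => x _; rewrite pf.
have e1 := @Rintegral_itvB R f (BLeft 0) (BRight (2 * pi)) d (int _ _).
have e2 := @Rintegral_itvB R f (BLeft d) (BRight (2 * pi + d)) (2 * pi) (int _ _).
rewrite !bnd_simp in e1 e2.
have {}e1 := e1 d0 (ltW d2).
have {}e2 := e2 (ltW d2) (ltac:(by rewrite lerDl)).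
rewrite -s2 in e2.
rewrite Rintegral_itv_obnd_cbnd in e1; last exact: into.
rewrite Rintegral_itv_obnd_cbnd in e2; last exact: into.
move: e1 e2; set i1 := Rintegral _ _ _; set i2 := Rintegral _ _ _; set i3 := Rintegral _ _ _.
by set i4 := Rintegral _ _ _; lra.
Qed.

(* Fundamental theorem of calculus for a function with kinks at 0 and q. *)
Lemma Rintegral_dom_pieces X f (q M : R) (F0 f0 F1 f1 F2 f2 : R -> R) :
  measurable_fun setT f -> (forall x, dom X x -> `|f x| <= M * profile X x) ->
  0 < q -> (X = Circle -> q < 2 * pi) ->
  (forall x : R, is_derive x 1 F0 (f0 x)) -> continuous f0 ->
  (forall x : R, is_derive x 1 F1 (f1 x)) -> continuous f1 ->
  (forall x : R, is_derive x 1 F2 (f2 x)) -> continuous f2 ->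
  (forall x, 0 < x < q -> f x = f1 x) ->
  (forall x, q < x -> (X = Circle -> x < 2 * pi) -> f x = f2 x) ->
  (X = Line -> forall x, x < 0 -> f x = f0 x) ->
  (X = Circle -> F0 0 = F2 (2 * pi)) ->
  (X = Line -> forall x, x <= 0 -> `|f0 x| <= M * expR x /\ `|F0 x| <= M * expR x) ->
  (X = Line -> forall x, q <= x -> `|f2 x| <= M * expR (- x) /\ `|F2 x| <= M * expR (- x)) ->
  \int[mu]_(x in dom X) f x = F1 q - F1 0 + F0 0 - F2 q.
Proof.
move=> mf bf q0 q2 dF0 c0 dF1 c1 dF2 c2 e1 e2 e0 per b0 b2.
have int D : measurable D -> D `<=` dom X -> mu.-integrable D (EFin \o f).
  by move=> mD DX; apply: (integrable_dominated mD DX mf) => x Dx; apply: bf; exact: DX.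
have i1 : \int[mu]_(x in `]0, q]) f x = F1 q - F1 0.
  rewrite -(Rintegral_FTC (ltW q0) dF1 c1).
  have sub : `]0, q]%classic `<=` dom X.
    case: X q2 {int mf bf e1 e2 e0 per b0 b2} => //= /(_ erefl) q2 x /=; rewrite !in_itv/= => /andP[x0 xq].
    by apply/andP; split; lra.
  have intf1 : mu.-integrable `[0, q] (EFin \o f1).
    apply: continuous_compact_integrable => //; first exact: segment_compact.
    exact: continuous_subspaceT.
  have io : mu.-integrable `]0, q] (EFin \o f1).
    by apply: integrableS intf1 => //; exact: subset_itv_oc_cc.
  rewrite -Rintegral_itv_obnd_cbnd//.
  rewrite -[LHS]Rintegral_itv_bndo_bndc; last first.
    by apply: int => // x h; apply: sub; exact: subset_itv_oo_oc h.
  rewrite -[RHS]Rintegral_itv_bndo_bndc; last first.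
    by apply: integrableS io => //; exact: subset_itv_oo_oc.
  by apply: eq_Rintegral => x; rewrite inE/= in_itv/=; exact: e1.
(* On the line the two outer pieces contribute F0 0 and - F2 q. On the circle there is one outer
   piece, contributing F2 (2 pi) - F2 q, and F2 (2 pi) = F0 0; so one formula covers both
   domains. *)
case: X q2 e2 e0 per b0 b2 int bf => /= q2 e2 e0 per b0 b2 int bf; last first.
  have {}q2 := q2 erefl; have {}per := per erefl.
  have i2 : \int[mu]_(x in `]q, 2 * pi]) f x = F2 (2 * pi) - F2 q.
    rewrite -(Rintegral_FTC (ltW q2) dF2 c2).
    have intf2 : mu.-integrable `[q, 2 * pi] (EFin \o f2).
      apply: continuous_compact_integrable => //; first exact: segment_compact.
      exact: continuous_subspaceT.
    have io : mu.-integrable `]q, 2 * pi] (EFin \o f2).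
      by apply: integrableS intf2 => //; exact: subset_itv_oc_cc.
    rewrite -[RHS]Rintegral_itv_obnd_cbnd//.
    rewrite -[LHS]Rintegral_itv_bndo_bndc; last first.
      by apply: int => // x /=; rewrite !in_itv/= => /andP[? ?]; apply/andP; split; lra.
    rewrite -[RHS]Rintegral_itv_bndo_bndc; last first.
      by apply: integrableS io => //; exact: subset_itv_oo_oc.
    apply: eq_Rintegral => x; rewrite inE/= in_itv/= => /andP[h1 h2].
    by apply: e2.
  have h := @Rintegral_itvB R f (BLeft 0) (BRight (2 * pi)) q (int _ (measurable_itv _) (@subset_refl _ _)).
  rewrite !bnd_simp in h; have {}h := h (ltW q0) (ltW q2).
  rewrite i2 -[X in _ - X]Rintegral_itv_obnd_cbnd ?i1 in h; last first.
    by apply: int => // x /=; rewrite !in_itv/= => /andP[? ?]; apply/andP; split; lra.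
  by rewrite per; move: h; set i := Rintegral _ _ _; lra.
have {}b0 := b0 erefl; have {}b2 := b2 erefl; have {}e0 := e0 erefl.
have i2 : \int[mu]_(x in `]q, +oo[) f x = - F2 q.
  have <- := Rintegral_FTCy dF2 c2 (fun x h => (b2 x h).1) (fun x h => (b2 x h).2).
  rewrite -Rintegral_itv_obnd_cbnd; last first.
    apply: (@integrableS _ _ _ mu `[q, +oo[%classic) => //.
      by move=> x /=; rewrite !in_itv/= !andbT; exact: ltW.
    apply: le_integrable (integrable_expNx M q) => //.
      by apply/measurable_EFinP; apply: measurable_funTS; exact: continuous_measurable_fun.
    by move=> x /=; rewrite in_itv/= andbT => /b2[h _]; rewrite lee_fin (le_trans h)// ler_norm.
  apply: eq_Rintegral => x; rewrite inE/= in_itv/= andbT => h1.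
  by apply: e2.
have i0 : \int[mu]_(x in `]-oo, 0]) f x = F0 0.
  have dFN (x : R) : is_derive x 1 (fun x => - F0 (- x)) (f0 (- x)).
    have dF : is_derive (- x) 1 F0 (f0 (- x)) := dF0 _.
    by apply: is_derive_eq; rewrite /GRing.scale/=; ring.
  have cfN : continuous (fun x => f0 (- x)).
    by move=> x; apply: continuous_comp; [exact: opp_continuous|exact: c0].
  have bb (x : R) : 0 <= x -> `|f0 (- x)| <= M * expR (- x) /\ `|- F0 (- x)| <= M * expR (- x).
    by move=> x0; rewrite normrN; apply: b0; rewrite oppr_le0.
  have := Rintegral_FTCy dFN cfN (fun x h => (bb x h).1) (fun x h => (bb x h).2).
  rewrite oppr0 opprK => <-.
  rewrite (Rintegral_opp _ mf)//.
  have -> : [set x : R | `]-oo, 0]%classic (- x)] = `[0, +oo[%classic.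
    by apply/seteqP; split => x /=; rewrite !in_itv/= ?andbT oppr_le0.
  rewrite -[LHS]Rintegral_itv_obnd_cbnd; last first.
    apply: (@integrable_dominated Line _ _ M) => //.
      by apply: (measurableT_comp mf); exact: oppr_measurable.
    by move=> x _; rewrite -(profileN Line); exact: bf.
  rewrite -[RHS]Rintegral_itv_obnd_cbnd; last first.
    apply: (@integrableS _ _ _ mu `[0, +oo[%classic) => //.
      by move=> x /=; rewrite !in_itv/= !andbT; exact: ltW.
    apply: le_integrable (integrable_expNx M 0) => //.
      by apply/measurable_EFinP; apply: measurable_funTS; exact: continuous_measurable_fun.
    by move=> x /=; rewrite in_itv/= andbT => /bb[h _]; rewrite lee_fin (le_trans h)// ler_norm.
  apply: eq_Rintegral => x; rewrite inE/= in_itv/= andbT => h1.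
  by rewrite e0// oppr_lt0.
have h := @Rintegral_itvB R f -oo%O +oo%O 0 (int _ (measurable_itv _) (fun _ _ => I)).
rewrite !bnd_simp in h; have {h}h := h isT isT.
have h' := @Rintegral_itvB R f (BRight 0) +oo%O q (int _ (measurable_itv _) (fun _ _ => I)).
rewrite !bnd_simp in h'; have {h'}h' := h' (ltW q0) isT.
rewrite i0 in h; rewrite i1 i2 in h'; rewrite set_itvNyy in h.
move: h h'; set i := Rintegral _ _ _; set j := Rintegral _ _ _; lra.
Qed.

End DomainIntegral.

(** * Integration by parts and the Green function of 1 - d^2/dx^2 *)

Section Green.
Context {R : realType}.
Local Notation mu := (@lebesgue_measure R).
Implicit Types (X : spatial_domain) (f phi psi : R -> R) (c : R).

Lemma ler_normrM (a b A B : R) : `|a| <= A -> `|b| <= B -> `|a * b| <= A * B.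
Proof. by move=> aA bB; rewrite normrM; apply: ler_pM. Qed.

Lemma expR_dom_le1 (x : R) : 0 <= x -> expR (- x) <= 1.
Proof. by move=> x0; rewrite -expR0 ler_expR oppr_le0. Qed.

Lemma continuous_peakG X : continuous (@peakG R X).
Proof. by move=> x; exact: is_derive1_continuous (is_derive_peakG X x). Qed.

Lemma continuous_peakS X : continuous (@peakS R X).
Proof. by move=> x; exact: is_derive1_continuous (is_derive_peakS X x). Qed.

Lemma is_derive_comp_opp (F f : R -> R) (a x : R) : (forall x : R, is_derive x 1 F (f x)) ->
  is_derive x 1 (fun z => F (a - z)) (- f (a - x)).
Proof.
move=> dF; have dFa : is_derive (a - x) 1 F (f (a - x)) by [].
by apply: is_derive_eq; rewrite /GRing.scale/=; ring.
Qed.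

Lemma is_derive_comp_shift (F f : R -> R) (a x : R) : (forall x : R, is_derive x 1 F (f x)) ->
  is_derive x 1 (fun z => F (z + a)) (f (x + a)).
Proof.
move=> dF; have dFa : is_derive (x + a) 1 F (f (x + a)) by [].
by apply: is_derive_eq; rewrite /GRing.scale/=; ring.
Qed.

(** Boundedness stands in place of compact support because the class must contain resolvents of test
    functions, whose support need not be compact. The derivative is carried along as a function of
    its own. *)
Record test1 X phi phi1 : Prop := Test1 {
  test1_derive : forall x : R, is_derive x 1 phi (phi1 x);
  test1_cont : continuous phi1;
  test1_per : on_domain X phi;
  test1_bound : exists B, forall x, `|phi x| <= B /\ `|phi1 x| <= B }.

Lemma test1_measurable X phi phi1 : test1 X phi phi1 -> measurable_fun setT phi.
Proof.
move=> [d _ _ _]; apply: continuous_measurable_fun => x.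
exact: is_derive1_continuous (d x).
Qed.

Lemma test1_measurable1 X phi phi1 : test1 X phi phi1 -> measurable_fun setT phi1.
Proof. by move=> [_ c _ _]; exact: continuous_measurable_fun. Qed.

Lemma on_domain0 X phi : on_domain X phi -> X = Circle -> phi (2 * pi) = phi 0.
Proof. by move=> + e; rewrite e => /= /(_ 0); rewrite add0r. Qed.

Lemma test1_shift X phi phi1 c : test1 X phi phi1 ->
  test1 X (fun x => phi (x + c)) (fun x => phi1 (x + c)).
Proof.
move=> [d ct p [B b]]; split.
- by move=> x; exact: is_derive_comp_shift.
- by move=> x; apply: continuous_comp; [apply: cvgD; [exact: cvg_id|exact: cvg_cst]|exact: ct].
- by case: X p => //= p x; rewrite -addrA (addrC _ c) addrA p.
- by exists B => x; exact: b.
Qed.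

Lemma continuous_comp_opp (f : R -> R) (a : R) : continuous f -> continuous (fun z => f (a - z)).
Proof.
move=> cf x; apply: continuous_comp; last exact: cf.
by apply: cvgB; [exact: cvg_cst|exact: cvg_id].
Qed.


Lemma continuous_add (f g : R -> R) : continuous f -> continuous g ->
  continuous (fun x => f x + g x).
Proof. by move=> cf cg x; apply: cvgD; [exact: cf|exact: cg]. Qed.

Lemma continuous_sub (f g : R -> R) : continuous f -> continuous g ->
  continuous (fun x => f x - g x).
Proof. by move=> cf cg x; apply: cvgB; [exact: cf|exact: cg]. Qed.

Lemma continuous_mul (f g : R -> R) : continuous f -> continuous g ->
  continuous (fun x => f x * g x).
Proof. by move=> cf cg x; apply: cvgM; [exact: cf|exact: cg]. Qed.

(** The profile is continuous at its kink, so the boundary terms from the two sides of 0 cancel. *)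
Lemma by_parts_profile0 X phi phi1 : test1 X phi phi1 ->
  \int[mu]_(x in dom X) (profile X x * phi1 x) =
  - \int[mu]_(x in dom X) (dprofile X x * phi x).
Proof.
move=> t; have [d ct p [B b]] := t.
have mp := @measurable_profile R X; have mdp := @measurable_dprofile R X.
have m0 := test1_measurable t; have m1 := test1_measurable1 t.
have B0 : 0 <= B by apply: le_trans (b 0).1.
have cp : continuous phi by move=> x; exact: is_derive1_continuous (d x).
have bp (x : R) : `|profile X x| <= profile X x by rewrite ger0_norm// ltW// profile_gt0.
have b1 (x : R) : `|profile X x * phi1 x| <= B * profile X x.
  by rewrite [_ * phi1 x]mulrC; exact: ler_normrM (b x).2 (bp x).
have b2 (x : R) : `|dprofile X x * phi x| <= B * profile X x.
  by rewrite [_ * phi x]mulrC; exact: ler_normrM (b x).1 (normr_dprofile_le X x).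
have mD := @measurable_dom R X.
have mf1 := measurable_funM mp m1; have mf2 := measurable_funM mdp m0.
apply/eqP; rewrite -addr_eq0 -RintegralD//; last 2 first.
- by apply: (@integrable_dominated R X _ _ B mD _ mf1) => // x _; exact: b1.
- by apply: (@integrable_dominated R X _ _ B mD _ mf2) => // x _; exact: b2.
pose F (x : R) := peakG X x * phi x.
pose f (x : R) := peakG X x * phi1 x + peakS X x * phi x.
pose F0 (x : R) := peakG X (0 - x) * phi x.
pose f0 (x : R) := peakG X (0 - x) * phi1 x - peakS X (0 - x) * phi x.
have dF (x : R) : is_derive x 1 F (f x).
  have dG := is_derive_peakG X x; have dp := d x.
  by apply: is_derive_eq; rewrite /f /GRing.scale/=; ring.
have dF0 (x : R) : is_derive x 1 F0 (f0 x).
  have dG := is_derive_comp_opp 0 x (is_derive_peakG X); have dp := d x.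
  by apply: is_derive_eq; rewrite /f0 /GRing.scale/=; ring.
have cG := @continuous_peakG X; have cS := @continuous_peakS X.
have cG0 := continuous_comp_opp (a := 0) cG; have cS0 := continuous_comp_opp (a := 0) cS.
have cf : continuous f := continuous_add (continuous_mul cG ct) (continuous_mul cS cp).
have cf0 : continuous f0 := continuous_sub (continuous_mul cG0 ct) (continuous_mul cS0 cp).
(* The only kink is at 0. The second cut at [pi] is a dummy, with the same primitive on both of its
   sides. *)
rewrite (@Rintegral_dom_pieces R X _ pi (B + B) F0 f0 F f F f)//.
- by rewrite /F /F0 subr0; apply/eqP; ring.
- exact: measurable_funD.
- by move=> x _; rewrite mulrDl; apply: le_trans (ler_normD _ _) _; apply: lerD.
- exact: pi_gt0.
- by move=> _; have := pi_gt0 R; lra.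
- move=> x /andP[x0 xp]; rewrite /f profile_le_abs ?(gtr0_norm x0) ?dprofile_pos//.
  + by move=> _; lra.
  + by move=> _; lra.
- move=> x px xp; have x0 : 0 < x by apply: lt_trans px; exact: pi_gt0.
  by rewrite /f profile_le_abs ?(gtr0_norm x0) ?dprofile_pos// => /xp/ltW.
- move=> XL x x0; subst X; rewrite profile_le_abs// dprofile_neg// /f0 ltr0_norm//.
  by rewrite sub0r mulNr.
- move=> XC; rewrite /F /F0 (on_domain0 p XC) XC subr0.
  by rewrite -[in RHS](subr0 (2 * pi)) peakG2pi.
- move=> XL x x0; subst X; rewrite /f0 /F0 /= !sub0r !opprK.
  have e : `|expR x| <= expR x by rewrite ger0_norm.
  split; last first.
    rewrite mulrC; apply: ler_normrM => //.
    by apply: le_trans (b x).1 _; rewrite lerDl.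
  rewrite mulNr opprK mulrDl; apply: le_trans (ler_normD _ _) _.
  by apply: lerD; rewrite mulrC; apply: ler_normrM => //; case: (b x).
- move=> XL x x0; subst X; rewrite /f /F /=.
  have e : `|expR (- x)| <= expR (- x) by rewrite ger0_norm.
  split; last first.
    rewrite mulrC; apply: ler_normrM => //.
    by apply: le_trans (b x).1 _; rewrite lerDl.
  rewrite mulNr mulrDl; apply: le_trans (ler_normB _ _) _.
  by apply: lerD; rewrite mulrC; apply: ler_normrM => //; case: (b x).
Qed.

(** This is g - g'' = 2 A delta_0: off its kink the profile satisfies g'' = g, and there its
    derivative drops from A to - A. *)
Lemma green_profile0 X phi phi1 phi2 : test1 X phi phi1 -> test1 X phi1 phi2 ->
  \int[mu]_(x in dom X) (profile X x * (phi x - phi2 x)) = 2 * peakA X * phi 0.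
Proof.
move=> t t'; have [d ct p [B b]] := t; have [d1 ct1 p1 [B1 b1]] := t'.
have mp := @measurable_profile R X.
have m0 := test1_measurable t; have m2 := test1_measurable1 t'.
have B0 : 0 <= B by apply: le_trans (b 0).1.
have B10 : 0 <= B1 by apply: le_trans (b1 0).1.
have cp : continuous phi by move=> x; exact: is_derive1_continuous (d x).
pose F (x : R) := peakS X x * phi x - peakG X x * phi1 x.
pose f (x : R) := peakG X x * phi x - peakG X x * phi2 x.
pose F0 (x : R) := - peakS X (0 - x) * phi x - peakG X (0 - x) * phi1 x.
pose f0 (x : R) := peakG X (0 - x) * phi x - peakG X (0 - x) * phi2 x.
have dF (x : R) : is_derive x 1 F (f x).
  have dG := is_derive_peakG X x; have dS := is_derive_peakS X x.
  have dp := d x; have dp1 := d1 x.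
  by apply: is_derive_eq; rewrite /f /GRing.scale/=; ring.
have dF0 (x : R) : is_derive x 1 F0 (f0 x).
  have dG := is_derive_comp_opp 0 x (is_derive_peakG X).
  have dS := is_derive_comp_opp 0 x (is_derive_peakS X).
  have dp := d x; have dp1 := d1 x.
  by apply: is_derive_eq; rewrite /f0 /GRing.scale/=; ring.
have cG := @continuous_peakG X; have cS := @continuous_peakS X.
have cG0 := continuous_comp_opp (a := 0) cG; have cS0 := continuous_comp_opp (a := 0) cS.
have cf : continuous f := continuous_sub (continuous_mul cG cp) (continuous_mul cG ct1).
have cf0 : continuous f0 := continuous_sub (continuous_mul cG0 cp) (continuous_mul cG0 ct1).
have bnd (a y c x : R) : `|a| <= expR x -> `|y| <= B -> `|c| <= B1 ->
    `|a * y - a * c| <= (B + B1) * expR x.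
  move=> ha hb hc; rewrite mulrDl; apply: le_trans (ler_normB _ _) _.
  by apply: lerD; rewrite mulrC; exact: ler_normrM.
rewrite (@Rintegral_dom_pieces R X _ pi (B + B1) F0 f0 F f F f)//.
- by rewrite /F /F0 subr0 peakS0; ring.
- by apply: measurable_funM => //; exact: measurable_funB.
- move=> x _; rewrite mulrC; apply: ler_normrM.
    by apply: le_trans (ler_normB _ _) _; apply: lerD; [exact: (b x).1|exact: (b1 x).2].
  by rewrite ger0_norm// ltW// profile_gt0.
- exact: pi_gt0.
- by move=> _; have := pi_gt0 R; lra.
- move=> x /andP[x0 xp]; rewrite /f -mulrBr profile_le_abs ?(gtr0_norm x0)//.
  by move=> _; lra.
- move=> x px xp; have x0 : 0 < x by apply: lt_trans px; exact: pi_gt0.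
  by rewrite /f -mulrBr profile_le_abs ?(gtr0_norm x0)// => /xp/ltW.
- move=> XL x x0; subst X; rewrite profile_le_abs// /f0 ltr0_norm//.
  by rewrite sub0r mulrBr.
- move=> XC; rewrite /F /F0 (on_domain0 p XC) (on_domain0 p1 XC) XC subr0.
  by rewrite -[in RHS](subr0 (2 * pi)) peakG2pi peakS2pi.
- move=> XL x x0; subst X; rewrite /f0 /F0 /= !sub0r !opprK.
  have e : `|expR x| <= expR x by rewrite ger0_norm.
  by split; apply: bnd => //; [exact: (b x).1|exact: (b1 x).2|exact: (b x).1|exact: (b1 x).1].
- move=> XL x x0; subst X; rewrite /f /F /=.
  have e : `|expR (- x)| <= expR (- x) by rewrite ger0_norm.
  split; first by apply: bnd => //; [exact: (b x).1|exact: (b1 x).2].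
  rewrite -[_ - _]opprK normrN opprB addrC -mulNr opprK.
  rewrite -[_ * phi1 x]opprK -mulrN; apply: bnd => //; last by rewrite normrN; exact: (b1 x).1.
  exact: (b x).1.
Qed.

Lemma profile_shift_prod X (f : R -> R) c B : measurable_fun setT f ->
  on_domain X f -> (forall x, `|f x| <= B) ->
  \int[mu]_(x in dom X) (profile X (x - c) * f x) =
  \int[mu]_(x in dom X) (profile X x * f (x + c)).
Proof.
move=> mf pf bf; have mp := @measurable_profile R X.
have B0 : 0 <= B by apply: le_trans (bf 0).
have ms : measurable_fun setT (fun x : R => profile X (x - c)).
  by apply: (measurableT_comp mp); exact: measurable_funB.
have mh : measurable_fun setT (fun x : R => profile X (x - c) * f x) by exact: measurable_funM.
have ph : on_domain X (fun x : R => profile X (x - c) * f x).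
  case: X pf {mp ms mh} => //= pf x; rewrite pf; congr (cosh _ * _).
  by rewrite -[x + 2 * pi - c]addrA (addrC (2 * pi)) addrA mod2piD.
have bh (x : R) : `|profile X (x - c) * f x| <= B * (cosh pi * expR `|c|) * profile X x.
  rewrite mulrC -mulrA; apply: ler_normrM => //.
  by rewrite ger0_norm ?(ltW (profile_gt0 _ _))// -(normrN c); exact: profile_shift.
have e := Rintegral_dom_shift c mh ph bh.
apply: etrans (esym e) _.
by apply: eq_Rintegral => x _; rewrite addrK.
Qed.

Lemma dprofile_shift_prod X (f : R -> R) c B : measurable_fun setT f ->
  on_domain X f -> (forall x, `|f x| <= B) ->
  \int[mu]_(x in dom X) (dprofile X (x - c) * f x) =
  \int[mu]_(x in dom X) (dprofile X x * f (x + c)).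
Proof.
move=> mf pf bf; have mp := @measurable_dprofile R X.
have B0 : 0 <= B by apply: le_trans (bf 0).
have ms : measurable_fun setT (fun x : R => dprofile X (x - c)).
  by apply: (measurableT_comp mp); exact: measurable_funB.
have mh : measurable_fun setT (fun x : R => dprofile X (x - c) * f x) by exact: measurable_funM.
have ph : on_domain X (fun x : R => dprofile X (x - c) * f x).
  case: X pf {mp ms mh} => //= pf x; rewrite pf; congr (sinh _ * _).
  by rewrite -[x + 2 * pi - c]addrA (addrC (2 * pi)) addrA mod2piD.
have bh (x : R) : `|dprofile X (x - c) * f x| <= B * (cosh pi * expR `|c|) * profile X x.
  rewrite mulrC -mulrA; apply: ler_normrM => //.
  by apply: le_trans (normr_dprofile_le _ _) _; rewrite -(normrN c); exact: profile_shift.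
have e := Rintegral_dom_shift c mh ph bh.
apply: etrans (esym e) _.
by apply: eq_Rintegral => x _; rewrite addrK.
Qed.

Lemma green_profile X phi phi1 phi2 c : test1 X phi phi1 -> test1 X phi1 phi2 ->
  \int[mu]_(x in dom X) (profile X x * (phi (x + c) - phi2 (x + c))) =
  2 * peakA X * phi c.
Proof.
move=> t t'; have := green_profile0 (test1_shift c t) (test1_shift c t').
by rewrite add0r.
Qed.

Lemma by_parts_profile X phi phi1 c : test1 X phi phi1 ->
  \int[mu]_(x in dom X) (profile X x * phi1 (x + c)) =
  - \int[mu]_(x in dom X) (dprofile X x * phi (x + c)).
Proof. by move=> t; exact: by_parts_profile0 (test1_shift c t). Qed.

End Green.

(** * The weak formulation for peakons *)

Section Nonlinear.
Context {R : realType}.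
Local Notation mu := (@lebesgue_measure R).
Implicit Types (X : spatial_domain) (psi : R -> R).

Definition flux (u v s s1 : R) : R := - (u * u * v) * s1 + 1 / 2 * u * (v * v) * s.

(* The local terms of the equation tested against s - s'': where u'' = u and
   v = u' they form the exact derivative of the flux. *)
Definition flux_density (u v s s1 s2 : R) : R :=
  u * u * v * (s - s2) - (u * u * u + 3 / 2 * u * (v * v)) * s1 + 1 / 2 * (v * v * v) * s.

Lemma is_derive_flux (u v s s1 s2 : R -> R) (x : R) :
  is_derive x 1 u (v x) -> is_derive x 1 v (u x) ->
  is_derive x 1 s (s1 x) -> is_derive x 1 s1 (s2 x) ->
  is_derive x 1 (fun x => flux (u x) (v x) (s x) (s1 x))
    (flux_density (u x) (v x) (s x) (s1 x) (s2 x)).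
Proof.
move=> du dv ds ds1; rewrite /flux /flux_density.
by apply: is_derive_eq; rewrite /GRing.scale/=; field.
Qed.

Lemma continuous_flux_density (u v s s1 s2 : R -> R) :
  continuous u -> continuous v -> continuous s -> continuous s1 -> continuous s2 ->
  continuous (fun x => flux_density (u x) (v x) (s x) (s1 x) (s2 x)).
Proof.
move=> cu cv cs cs1 cs2; have cc (r : R) : continuous (fun _ : R => r) by move=> x; exact: cvg_cst.
have cvv := continuous_mul cv cv; have cuu := continuous_mul cu cu.
exact: (continuous_add (continuous_sub
  (continuous_mul (continuous_mul cuu cv) (continuous_sub cs cs2))
  (continuous_mul (continuous_add (continuous_mul cuu cu)
    (continuous_mul (continuous_mul (cc _) cu) cvv)) cs1))
  (continuous_mul (continuous_mul (cc _) (continuous_mul cvv cv)) cs)).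
Qed.

Lemma normr_cube_le (a b c w : R) : `|a| <= w -> `|b| <= w -> `|c| <= w ->
  `|a * b * c| <= w ^+ 3.
Proof.
by move=> ha hb hc; rewrite !exprS expr0 mulr1 mulrA; apply: ler_normrM => //; exact: ler_normrM.
Qed.

Lemma flux_density_le (u v s s1 s2 w B : R) : `|u| <= w -> `|v| <= w ->
  `|s| <= B -> `|s1| <= B -> `|s2| <= B ->
  `|flux_density u v s s1 s2| <= 5 * B * w ^+ 3.
Proof.
move=> hu hv hs hs1 hs2; rewrite /flux_density.
have -> : 5 * B * w ^+ 3 = w ^+ 3 * (B + B) + (w ^+ 3 + 3 / 2 * w ^+ 3) * B + 1 / 2 * w ^+ 3 * B.
  by field.
apply: le_trans (ler_normD _ _) _; apply: lerD; last first.
  apply: ler_normrM => //; apply: ler_normrM; first by rewrite ger0_norm.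
  exact: normr_cube_le.
apply: le_trans (ler_normB _ _) _; apply: lerD.
  apply: ler_normrM; first exact: normr_cube_le.
  by apply: le_trans (ler_normB _ _) _; apply: lerD.
apply: ler_normrM => //; apply: le_trans (ler_normD _ _) _; apply: lerD; first exact: normr_cube_le.
rewrite -[_ * (v * v)]mulrA; apply: ler_normrM; first by rewrite ger0_norm// divr_ge0.
by rewrite mulrA; exact: normr_cube_le.
Qed.

Lemma flux_le (u v s s1 w B : R) : `|u| <= w -> `|v| <= w ->
  `|s| <= B -> `|s1| <= B -> `|flux u v s s1| <= 5 * B * w ^+ 3.
Proof.
move=> hu hv hs hs1; rewrite /flux.
have w0 : 0 <= w by apply: le_trans hu.
have B0 : 0 <= B by apply: le_trans hs.
apply: (@le_trans _ _ (w ^+ 3 * B + 1 / 2 * w ^+ 3 * B)); last first.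
  have : 0 <= w ^+ 3 * B by rewrite mulr_ge0// exprn_ge0.
  by rewrite -mulrA -[5 * _ * _]mulrA [B * _]mulrC; lra.
apply: le_trans (ler_normD _ _) _; apply: lerD.
  by apply: ler_normrM => //; rewrite normrN; exact: normr_cube_le.
apply: ler_normrM => //; rewrite -[_ * (v * v)]mulrA; apply: ler_normrM; first by rewrite ger0_norm.
by rewrite mulrA; exact: normr_cube_le.
Qed.

Definition pk2 X (p1 p2 q1 q2 x : R) : R :=
  p1 * profile X (x - q1) + p2 * profile X (x - q2).

Definition dpk2 X (p1 p2 q1 q2 x : R) : R :=
  p1 * dprofile X (x - q1) + p2 * dprofile X (x - q2).

Lemma measurable_pk2 X p1 p2 q1 q2 : measurable_fun setT (pk2 X p1 p2 q1 q2).
Proof.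
by apply: measurable_funD; apply: measurable_funM => //;
  apply: (measurableT_comp (measurable_profile X)); exact: measurable_funB.
Qed.

Lemma measurable_dpk2 X p1 p2 q1 q2 : measurable_fun setT (dpk2 X p1 p2 q1 q2).
Proof.
by apply: measurable_funD; apply: measurable_funM => //;
  apply: (measurableT_comp (measurable_dprofile X)); exact: measurable_funB.
Qed.

Definition pk2_bound (p1 p2 q1 q2 : R) : R :=
  cosh pi * (`|p1| * expR `|q1| + `|p2| * expR `|q2|).

Lemma pk2_le X p1 p2 q1 q2 x :
  `|pk2 X p1 p2 q1 q2 x| <= pk2_bound p1 p2 q1 q2 * profile X x.
Proof.
rewrite /pk2 /pk2_bound mulrDr mulrDl.
apply: le_trans (ler_normD _ _) _; apply: lerD;
  rewrite normrM [cosh _ * _]mulrCA -mulrA ler_wpM2l// (ger0_norm (ltW (profile_gt0 _ _))).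
  by rewrite -(normrN q1); exact: profile_shift.
by rewrite -(normrN q2); exact: profile_shift.
Qed.

Lemma dpk2_le X p1 p2 q1 q2 x :
  `|dpk2 X p1 p2 q1 q2 x| <= pk2_bound p1 p2 q1 q2 * profile X x.
Proof.
rewrite /dpk2 /pk2_bound mulrDr mulrDl.
apply: le_trans (ler_normD _ _) _; apply: lerD;
  rewrite normrM [cosh _ * _]mulrCA -mulrA ler_wpM2l//; apply: le_trans (normr_dprofile_le _ _) _.
  by rewrite -(normrN q1); exact: profile_shift.
by rewrite -(normrN q2); exact: profile_shift.
Qed.


Lemma cube_profile_le X (K x : R) : 0 <= K ->
  (K * profile X x) ^+ 3 <= K ^+ 3 * peakG X 0 ^+ 2 * profile X x.
Proof.
move=> K0; rewrite exprMn -mulrA ler_wpM2l ?exprn_ge0//.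
have := profile_gt0 X x; have := profile_le X x; set g := profile X x; set C := peakG X 0.
move=> gC g0; rewrite exprSr ler_wpM2r ?(ltW g0)// ler_sqr// nnegrE; apply: ltW => //.
exact: lt_le_trans gC.
Qed.

(** Between the peaks the integrand is the derivative of the flux, so the integral is minus the sum
    of the jumps of the flux. At a peak only v jumps, by - 2 A p_j, and v^2 jumps by twice the mean
    slope times that amount; this produces u(q_j)^2 psi1 - u(q_j) w_j psi with w_j the mean slope,
    equal to - p2 G'(q) at the left peak and to p1 G'(q) at the right one. *)
Lemma flux_balance0 X (p1 p2 q : R) psi psi1 psi2 :
  0 < q -> (X = Circle -> q < 2 * pi) ->
  test1 X psi psi1 -> test1 X psi1 psi2 ->
  \int[mu]_(x in dom X) flux_density (pk2 X p1 p2 0 q x) (dpk2 X p1 p2 0 q x)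
     (psi x) (psi1 x) (psi2 x) =
  - (2 * peakA X) *
    (p1 * ((p1 * peakG X 0 + p2 * peakG X q) ^+ 2 * psi1 0
           - (p1 * peakG X 0 + p2 * peakG X q) * (- p2 * peakS X q) * psi 0) +
     p2 * ((p2 * peakG X 0 + p1 * peakG X q) ^+ 2 * psi1 q
           - (p2 * peakG X 0 + p1 * peakG X q) * (p1 * peakS X q) * psi q)).
Proof.
move=> q0 q2 t t'; have [d ct p [B b]] := t; have [d1 ct1 p' [B1 b1]] := t'.
pose K := pk2_bound p1 p2 0 q; pose BB := Num.max B B1.
have K0 : 0 <= K.
  by rewrite /K /pk2_bound mulr_ge0 ?(ltW (cosh_gt0 _))// addr_ge0// mulr_ge0// expR_ge0.
have hb0 x : `|psi x| <= BB by rewrite le_max (b x).1.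
have hb1 x : `|psi1 x| <= BB by rewrite le_max (b x).2.
have hb2 x : `|psi2 x| <= BB by rewrite le_max (b1 x).2 orbT.
have BB0 : 0 <= BB by apply: le_trans (hb0 0).
have cp : continuous psi by move=> x; exact: is_derive1_continuous (d x).
have mf : measurable_fun setT (fun x : R => flux_density (pk2 X p1 p2 0 q x)
    (dpk2 X p1 p2 0 q x) (psi x) (psi1 x) (psi2 x)).
  have mu1 := measurable_pk2 X p1 p2 0 q; have mv1 := measurable_dpk2 X p1 p2 0 q.
  have m0 := test1_measurable t; have m1 := test1_measurable t'; have m2 := test1_measurable1 t'.
  rewrite /flux_density; repeat first [exact: m0|exact: m1|exact: m2|exact: mu1|exact: mv1|exact: measurable_cst|
    apply: measurable_funB|apply: measurable_funD|apply: measurable_funM].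
pose M := 5 * BB * K ^+ 3 * peakG X 0 ^+ 2.
have bnd (u v g x : R) : 0 < g -> g <= 1 -> `|u| <= K * g -> `|v| <= K * g ->
    X = Line ->
    `|flux_density u v (psi x) (psi1 x) (psi2 x)| <= M * g /\
    `|flux u v (psi x) (psi1 x)| <= M * g.
  move=> g0 g1 hu hv XL.
  have h : 5 * BB * (K * g) ^+ 3 <= M * g.
    rewrite /M XL /= oppr0 expR0 expr1n mulr1 exprMn mulrA ler_wpM2l//.
      by rewrite !mulr_ge0// exprn_ge0.
    by rewrite -[leRHS]expr1; apply: ler_wiXn2l => //; exact: ltW.
  split; apply: le_trans h; [exact: flux_density_le|exact: flux_le].
have comb (a1 a2 g : R) : `|a1| <= g -> `|a2| <= expR q * g -> `|p1 * a1 + p2 * a2| <= K * g.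
  move=> h1 h2; have g0 : 0 <= g by apply: le_trans h1.
  apply: (@le_trans _ _ (`|p1| * g + `|p2| * (expR q * g))).
    by apply: le_trans (ler_normD _ _) _; apply: lerD; exact: ler_normrM.
  have -> : `|p1| * g + `|p2| * (expR q * g) = (`|p1| * expR `|0 : R| + `|p2| * expR `|q|) * g.
    by rewrite normr0 expR0 (gtr0_norm q0); ring.
  rewrite /K /pk2_bound -[cosh pi * _ * g]mulrA -[leLHS]mul1r; apply: ler_wpM2r; last exact: cosh_ge1.
  by rewrite mulr_ge0// addr_ge0// mulr_ge0// expR_ge0.
(* The smooth branches of u and u_x, each defined on the whole line: index 1 between the peaks, 2 to
   the right of q, 0 to the left of 0. *)
pose u1 (x : R) := p1 * peakG X x + p2 * peakG X (q - x).
pose v1 (x : R) := p1 * peakS X x - p2 * peakS X (q - x).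
pose u2 (x : R) := p1 * peakG X x + p2 * peakG X (x + - q).
pose v2 (x : R) := p1 * peakS X x + p2 * peakS X (x + - q).
pose u0 (x : R) := p1 * peakG X (0 - x) + p2 * peakG X (q - x).
pose v0 (x : R) := - p1 * peakS X (0 - x) - p2 * peakS X (q - x).
have du1 (x : R) : is_derive x 1 u1 (v1 x).
  have a1 := is_derive_peakG X x; have a2 := is_derive_comp_opp q x (is_derive_peakG X).
  by apply: is_derive_eq; rewrite /v1 /GRing.scale/=; ring.
have dv1 (x : R) : is_derive x 1 v1 (u1 x).
  have a1 := is_derive_peakS X x; have a2 := is_derive_comp_opp q x (is_derive_peakS X).
  by apply: is_derive_eq; rewrite /u1 /GRing.scale/=; ring.
have du2 (x : R) : is_derive x 1 u2 (v2 x).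
  have a1 := is_derive_peakG X x; have a2 := is_derive_comp_shift (- q) x (is_derive_peakG X).
  by apply: is_derive_eq; rewrite /v2 /GRing.scale/=; ring.
have dv2 (x : R) : is_derive x 1 v2 (u2 x).
  have a1 := is_derive_peakS X x; have a2 := is_derive_comp_shift (- q) x (is_derive_peakS X).
  by apply: is_derive_eq; rewrite /u2 /GRing.scale/=; ring.
have du0 (x : R) : is_derive x 1 u0 (v0 x).
  have a1 := is_derive_comp_opp 0 x (is_derive_peakG X); have a2 := is_derive_comp_opp q x (is_derive_peakG X).
  by apply: is_derive_eq; rewrite /v0 /GRing.scale/=; ring.
have dv0 (x : R) : is_derive x 1 v0 (u0 x).
  have a1 := is_derive_comp_opp 0 x (is_derive_peakS X); have a2 := is_derive_comp_opp q x (is_derive_peakS X).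
  by apply: is_derive_eq; rewrite /u0 /GRing.scale/=; ring.
have cder (f g : R -> R) (h : forall x : R, is_derive x 1 f (g x)) : continuous f.
  by move=> x; exact: is_derive1_continuous (h x).
have cu0 := cder _ _ du0; have cv0 := cder _ _ dv0.
have cu1 := cder _ _ du1; have cv1 := cder _ _ dv1.
have cu2 := cder _ _ du2; have cv2 := cder _ _ dv2.
have dF0 x := is_derive_flux (du0 x) (dv0 x) (d x) (d1 x).
have dF1 x := is_derive_flux (du1 x) (dv1 x) (d x) (d1 x).
have dF2 x := is_derive_flux (du2 x) (dv2 x) (d x) (d1 x).
have cF0 := continuous_flux_density cu0 cv0 cp ct ct1.
have cF1 := continuous_flux_density cu1 cv1 cp ct ct1.
have cF2 := continuous_flux_density cu2 cv2 cp ct ct1.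
rewrite (@Rintegral_dom_pieces R X _ q M _ _ _ _ _ _ mf _ q0 q2 dF0 cF0 dF1 cF1 dF2 cF2).
- rewrite /u0 /v0 /u1 /v1 /u2 /v2 /flux !subr0 !subrr !peakS0.
  by field.
- move=> x _; apply: le_trans.
    by apply: flux_density_le (hb0 x) (hb1 x) (hb2 x); [exact: pk2_le|exact: dpk2_le].
  rewrite /M -/K -2!(mulrA (5 * BB)) ler_wpM2l ?mulr_ge0//.
  exact: cube_profile_le.
- move=> x /andP[x0 xq].
  have e1 : profile X (x - 0) = peakG X x.
    by rewrite subr0 profile_le_abs gtr0_norm// => /q2; lra.
  have e2 : profile X (x - q) = peakG X (q - x).
    by rewrite profile_le_abs distrC gtr0_norm ?subr_gt0// => /q2; lra.
  have e3 : dprofile X (x - 0) = peakS X x.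
    by rewrite subr0 dprofile_pos// => /q2; lra.
  have e4 : dprofile X (x - q) = - peakS X (q - x).
    by rewrite dprofile_neg ?opprB ?subr_lt0// => /q2; lra.
  by rewrite /pk2 /dpk2 e1 e2 e3 e4 mulrN.
- move=> x qx x2; have x0 := lt_trans q0 qx.
  have e1 : profile X (x - 0) = peakG X x.
    by rewrite subr0 profile_le_abs gtr0_norm// => /x2; lra.
  have e2 : profile X (x - q) = peakG X (x - q).
    by rewrite profile_le_abs gtr0_norm ?subr_gt0// => /x2; lra.
  have e3 : dprofile X (x - 0) = peakS X x.
    by rewrite subr0 dprofile_pos.
  have e4 : dprofile X (x - q) = peakS X (x - q).
    by rewrite dprofile_pos ?subr_gt0// => /x2; lra.
  by rewrite /pk2 /dpk2 e1 e2 e3 e4.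
- move=> XL x x0; subst X.
  have xq : x - q < 0 by rewrite subr_lt0 (lt_trans x0).
  have e1 : profile Line (x - 0) = peakG Line (0 - x).
    by rewrite subr0 sub0r profile_le_abs ltr0_norm.
  have e2 : profile Line (x - q) = peakG Line (q - x).
    by rewrite profile_le_abs// ltr0_norm// opprB.
  have e3 : dprofile Line (x - 0) = - peakS Line (0 - x).
    by rewrite subr0 sub0r dprofile_neg.
  have e4 : dprofile Line (x - q) = - peakS Line (q - x).
    by rewrite dprofile_neg// opprB.
  by rewrite /pk2 /dpk2 /u0 /v0 e1 e2 e3 e4 !mulrN mulNr.
- move=> XC; rewrite (on_domain0 p XC) (on_domain0 p' XC) /u0 /v0 /u2 /v2 XC.
  rewrite peakG2pi peakS2pi -[in RHS](subr0 (2 * pi)) peakG2pi peakS2pi !subr0.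
  by rewrite !mulrN mulNr.
- move=> XL x x0.
  have g1 : expR x <= 1 by rewrite -(opprK x) expR_dom_le1// oppr_ge0.
  have e0 : `|expR x| <= expR x by rewrite ger0_norm.
  have e1 : `|expR (x - q)| <= expR q * expR x.
    by rewrite ger0_norm// -expRD ler_expR; lra.
  have gx := expR_gt0 x; apply: bnd => //; rewrite /u0 /v0 XL /= sub0r opprK opprB.
    by apply: comb.
  by rewrite mulNr !mulrN !opprK; apply: comb.
- move=> XL x qx; have x0 : 0 <= x by apply: le_trans qx; exact: ltW.
  have g1 := expR_dom_le1 x0.
  have e0 : `|expR (- x)| <= expR (- x) by rewrite ger0_norm.
  have e1 : `|expR (- (x - q))| <= expR q * expR (- x).
    by rewrite ger0_norm// -expRD ler_expR; lra.
  have gx := expR_gt0 (- x); apply: bnd => //; rewrite /u2 /v2 XL /=.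
    by apply: comb.
  by apply: comb; rewrite normrN.
Qed.

Lemma test1_per1 X psi psi1 : test1 X psi psi1 -> on_domain X psi1.
Proof.
case: X => // -[d _ p _] /= x.
have := is_derive_comp_shift (2 * pi) x d.
have -> : (fun z : R => psi (z + 2 * pi)) = psi by apply/funext => z; exact: p.
by move=> h; have [_ <-] := h; have [_ ->] := d x.
Qed.

Lemma periodic_pk2 p1 p2 q1 q2 : Defs.periodic (pk2 Circle p1 p2 q1 q2).
Proof.
by move=> x; rewrite /pk2 -!addrA !(addrC (2 * pi)) !addrA !periodic_profile.
Qed.

Lemma periodic_dpk2 p1 p2 q1 q2 : Defs.periodic (dpk2 Circle p1 p2 q1 q2).
Proof.
by move=> x; rewrite /dpk2 -!addrA !(addrC (2 * pi)) !addrA !periodic_dprofile.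
Qed.

Lemma flux_balance X (p1 p2 q1 q2 : R) psi psi1 psi2 :
  let q := q2 - q1 in
  0 < q -> (X = Circle -> q < 2 * pi) ->
  test1 X psi psi1 -> test1 X psi1 psi2 ->
  \int[mu]_(x in dom X) flux_density (pk2 X p1 p2 q1 q2 x) (dpk2 X p1 p2 q1 q2 x)
     (psi x) (psi1 x) (psi2 x) =
  - (2 * peakA X) *
    (p1 * ((p1 * peakG X 0 + p2 * peakG X q) ^+ 2 * psi1 q1
           - (p1 * peakG X 0 + p2 * peakG X q) * (- p2 * peakS X q) * psi q1) +
     p2 * ((p2 * peakG X 0 + p1 * peakG X q) ^+ 2 * psi1 q2
           - (p2 * peakG X 0 + p1 * peakG X q) * (p1 * peakS X q) * psi q2)).
Proof.
move=> q q0 q2pi t t'; have [d ct p [B b]] := t; have [d1 ct1 p' [B1 b1]] := t'.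
have := flux_balance0 p1 p2 q0 q2pi (test1_shift q1 t) (test1_shift q1 t').
rewrite !add0r [q + q1]subrK => <-.
pose BB := Num.max B B1; pose K := pk2_bound p1 p2 q1 q2.
have K0 : 0 <= K.
  by rewrite /K /pk2_bound mulr_ge0 ?(ltW (cosh_gt0 _))// addr_ge0// mulr_ge0// expR_ge0.
have hb0 x : `|psi x| <= BB by rewrite le_max (b x).1.
have hb1 x : `|psi1 x| <= BB by rewrite le_max (b x).2.
have hb2 x : `|psi2 x| <= BB by rewrite le_max (b1 x).2 orbT.
have BB0 : 0 <= BB by apply: le_trans (hb0 0).
rewrite -(@Rintegral_dom_shift R X _ q1 (5 * BB * K ^+ 3 * peakG X 0 ^+ 2)).
- apply: eq_Rintegral => x _; rewrite /pk2 /dpk2 addrK subr0.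
  by rewrite /q opprB addrA.
- have mu1 := measurable_pk2 X p1 p2 q1 q2; have mv1 := measurable_dpk2 X p1 p2 q1 q2.
  have m0 := test1_measurable t; have m1 := test1_measurable t'; have m2 := test1_measurable1 t'.
  rewrite /flux_density; repeat first [exact: m0|exact: m1|exact: m2|exact: mu1|exact: mv1|exact: measurable_cst|
    apply: measurable_funB|apply: measurable_funD|apply: measurable_funM].
- have p2' := test1_per1 t'; case: X q2pi t t' p p' p2' => //= _ _ _ p p' p2' x.
  by rewrite p p' p2' (periodic_pk2 _ _ _ _ x) (periodic_dpk2 _ _ _ _ x).
- move=> x; apply: le_trans.
    by apply: flux_density_le (hb0 x) (hb1 x) (hb2 x); [exact: pk2_le|exact: dpk2_le].
  rewrite -/K -2!(mulrA (5 * BB)) ler_wpM2l ?mulr_ge0//.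
  exact: cube_profile_le.
Qed.

End Nonlinear.

(** * The inverse of 1 - d^2/dx^2 on test functions *)

Section Resolvent.
Context {R : realType}.
Local Notation mu := (@lebesgue_measure R).
Implicit Types (X : spatial_domain) (phi : R -> R).

(** Convolution with the even Green function g / (2 A), that is, D^{-2} phi. The translation is put
    on phi, so that derivatives in y fall on phi and not on the kinked profile. *)
Definition resolvent X phi (y : R) : R :=
  (2 * peakA X)^-1 * \int[mu]_(z in dom X) (profile X z * phi (z + y)).

Lemma integrable_profileM X (f : R -> R) (B : R) : measurable_fun setT f ->
  (forall x, `|f x| <= B) ->
  mu.-integrable (dom X) (EFin \o (fun z => profile X z * f z)).
Proof.
move=> mf bf; apply: (@integrable_dominated R X _ _ B) => //.
- exact: measurable_dom.
- by apply: measurable_funM => //; exact: measurable_profile.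
- move=> x _; rewrite mulrC; apply: ler_normrM => //.
  by rewrite ger0_norm// ltW// profile_gt0.
Qed.

Lemma is_derive_resolvent X phi phi1 (y : R) : test1 X phi phi1 ->
  is_derive y 1 (resolvent X phi) (resolvent X phi1 y).
Proof.
move=> t; have [d ct p [B b]] := t.
have B0 : 0 <= B by apply: le_trans (b 0).1.
have mD := @measurable_dom R X.
pose f (y z : R) := profile X z * phi (z + y).
have df (x z : R) : is_derive x 1 (f ^~ z) (profile X z * phi1 (z + x)).
  have h : is_derive (z + x) 1 phi (phi1 (z + x)) by [].
  by apply: is_derive_eq; rewrite /GRing.scale/=; ring.
have intf (x : R) : `]y - 1, y + 1[%classic x -> mu.-integrable (dom X) (EFin \o f x).
  move=> _; have [m _ _ _] := test1_shift x t.
  by apply: (@integrable_profileM _ _ B); [exact: test1_measurable (test1_shift x t)|move=> z; exact: (b _).1].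
have derf (x z : R) : `]y - 1, y + 1[%classic x -> dom X z -> derivable (f ^~ z) x 1.
  by move=> _ _; have [] := df x z.
have p1 (x z : R) : derive1 (f ^~ z) x = profile X z * phi1 (z + x).
  by rewrite derive1E; have [_ ->] := df x z.
have Iy : `]y - 1, y + 1[%classic y by rewrite /= in_itv/=; apply/andP; split; lra.
have bG (x z : R) : `]y - 1, y + 1[%classic x -> dom X z ->
    `|derive1 (f ^~ z) x| <= profile X z * B.
  move=> _ _; rewrite p1; apply: ler_normrM; last exact: (b _).2.
  by rewrite ger0_norm// ltW// profile_gt0.
have G0 (z : R) : 0 <= profile X z * B by rewrite mulr_ge0// ltW// profile_gt0.
have intG : mu.-integrable (dom X) (EFin \o (fun z => profile X z * B)).
  by apply: (@integrable_profileM _ (cst B) B) => // z; rewrite ger0_norm.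
have dI := @derivable_under_integral R _ _ mu f (dom X) mD y (y - 1) (y + 1) Iy intf derf _ G0 intG bG.
have eI := @differentiation_under_integral R _ _ mu f (dom X) mD y (y - 1) (y + 1) Iy intf derf _ G0 intG bG.
have h : is_derive y 1 (fun x' => \int[mu]_(y in dom X) f x' y)
    (\int[mu]_(z in dom X) (profile X z * phi1 (z + y))).
  split=> //; rewrite -derive1E eI; apply: eq_Rintegral => z _; exact: p1.
by rewrite /resolvent; apply: is_derive_eq; rewrite /GRing.scale/=; ring.
Qed.

Lemma resolvent_le X phi (B y : R) : measurable_fun setT phi ->
  (forall x, `|phi x| <= B) ->
  `|resolvent X phi y| <= B * ((2 * peakA X)^-1 * \int[mu]_(z in dom X) profile X z).
Proof.
move=> mp bp; have A0 := @peakA_gt0 R X.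
have mD := @measurable_dom R X.
have B0 : 0 <= B by apply: le_trans (bp 0).
have ms : measurable_fun setT (fun z : R => phi (z + y)).
  by apply: (measurableT_comp mp); exact: measurable_funD.
have ii := @integrable_profileM X (fun z => phi (z + y)) B ms (fun z => bp _).
rewrite /resolvent normrM mulrCA; apply: ler_pM => //.
  by rewrite ger0_norm// invr_ge0 mulr_ge0// ltW.
apply: le_trans (le_normr_Rintegral mD ii) _.
rewrite -RintegralZl//; last exact: integrable_profile.
apply: le_Rintegral => //.
- exact: (integrable_norm ii).
- exact: integrableZl (integrable_profile X).
- move=> z _ /=; rewrite mulrC; apply: ler_normrM => //.
  by rewrite ger0_norm// ltW// profile_gt0.
Qed.

Lemma test1_resolvent X phi phi1 phi2 : test1 X phi phi1 -> test1 X phi1 phi2 ->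
  test1 X (resolvent X phi) (resolvent X phi1).
Proof.
move=> t t'; have [d ct p [B b]] := t; have [d1 ct1 p1 [B1 b1]] := t'.
split.
- by move=> x; exact: is_derive_resolvent.
- by move=> x; exact: is_derive1_continuous (is_derive_resolvent x t').
- case: X p t t' p1 => //= p _ _ _ x; rewrite /resolvent; congr (_ * _).
  by apply: eq_Rintegral => z _; rewrite addrA p.
- exists (B * ((2 * peakA X)^-1 * \int[mu]_(z in dom X) profile X z)) => x.
  split; apply: resolvent_le.
  + exact: test1_measurable t.
  + by move=> z; exact: (b z).1.
  + exact: test1_measurable1 t.
  + by move=> z; exact: (b z).2.
Qed.

Lemma resolvent_green X phi phi1 phi2 (y : R) : test1 X phi phi1 -> test1 X phi1 phi2 ->
  resolvent X phi y - resolvent X phi2 y = phi y.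
Proof.
move=> t t'; have [d ct p [B b]] := t; have [d1 ct1 p1 [B1 b1]] := t'.
have mD := @measurable_dom R X.
rewrite /resolvent -mulrBr -RintegralB//; last 2 first.
- by apply: (@integrable_profileM _ _ B); [exact: test1_measurable (test1_shift y t)|move=> z; exact: (b _).1].
- by apply: (@integrable_profileM _ _ B1); [exact: test1_measurable1 (test1_shift y t')|move=> z; exact: (b1 _).2].
under eq_Rintegral do rewrite -mulrBr.
rewrite (green_profile y t t') mulKf// mulf_neq0//; exact: lt0r_neq0 (peakA_gt0 X).
Qed.

End Resolvent.

(** * Partial derivatives, supports and bounds of test functions *)

Section TestFunctions.
Context {R : realType}.
Implicit Types (X : spatial_domain) (phi : R^o * R^o -> R) (T : R).

(** The increment along (g s, s) splits into one in x at fixed t, where the one-variable chain rule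
    applies, and one in t at x = g s. The difference quotient of the latter is a value of [ft] at an
    intermediate time, by the mean value theorem, and converges by continuity of [ft]. This form
    suits test functions, whose smoothness is expressed by directional derivatives. *)
Lemma chain_rule2 (f fx ft : R^o * R^o -> R) (g : R -> R) (dg t : R) :
  (forall x t : R, is_derive x 1 (fun x : R => f (x, t)) (fx (x, t))) ->
  (forall x t : R, is_derive t 1 (fun t : R => f (x, t)) (ft (x, t))) ->
  continuous ft -> is_derive t 1 g dg ->
  is_derive t 1 (fun s : R => f (g s, s)) (fx (g t, t) * dg + ft (g t, t)).
Proof.
move=> dfx dft cft Dg.
have d1 : is_derive t 1 (fun s : R => f (g s, t)) (fx (g t, t) * dg).
  exact: (@is_derive1_comp _ (fun x : R => f (x, t)) g t _ _ (dfx (g t) t) Dg).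
have /is_derive1_caratheodory [h1 [e1 c1 v1]] := d1.
apply/is_derive1_caratheodory.
pose h2 (s : R) := if s == t then ft (g t, t) else (f (g s, s) - f (g s, t)) / (s - t).
exists (fun s => h1 s + h2 s); split.
- move=> s; rewrite mulrDl -e1 /h2; case: eqVneq => [->|st].
    by rewrite !subrr mulr0 addr0.
  by rewrite divfK ?subr_eq0//; ring.
- apply: cvgD; first exact: c1.
  have -> : h2 t = ft (g t, t) by rewrite /h2 eqxx.
  apply/cvgrPdist_le => /= e e0.
  have /cvgrPdist_le/(_ e e0)/nbhs_ballP[r /= r0 hr] : ft z @[z --> ((g t : R^o), (t : R^o))] --> ft (g t, t).
    exact: cft.
  have cg : {for t, continuous g} by exact: is_derive1_continuous Dg.
  have ng : \forall s \near t, `|g t - g s| < r by move/cvgrPdist_lt : cg; exact.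
  have nt : \forall s \near t, `|t - s| < r.
    by move/cvgrPdist_lt : (@cvg_id _ (nbhs t)); exact.
  near=> s; rewrite /h2; case: eqVneq => [_|st].
    by rewrite subrr normr0 ltW.
  have hg : `|g t - g s| < r by near: s.
  have ht : `|t - s| < r by near: s.
  have cfs : continuous (fun t : R => f (g s, t)).
    by move=> z; exact: is_derive1_continuous (dft _ _).
  have [xi [hxi ->]] : exists xi : R, `|t - xi| <= `|t - s| /\
      (f (g s, s) - f (g s, t)) / (s - t) = ft (g s, xi).
    have [lt_st|lt_ts|est] := ltgtP s t; last by rewrite est eqxx in st.
      have [xi] := @MVT_segment R (fun t => f (g s, t)) (fun t => ft (g s, t)) s t
        (ltW lt_st) (fun x _ => dft _ _) (continuous_subspaceT cfs).
      rewrite in_itv/= => /andP[h h'] E; exists xi; split.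
        by rewrite !ger0_norm ?subr_ge0// ?(ltW lt_st)//; lra.
      rewrite -[X in X / _]opprB E; rewrite -[t - s]opprB mulrN opprK mulfK// subr_eq0//.
    have [xi] := @MVT_segment R (fun t => f (g s, t)) (fun t => ft (g s, t)) t s
      (ltW lt_ts) (fun x _ => dft _ _) (continuous_subspaceT cfs).
    rewrite in_itv/= => /andP[h h'] E; exists xi; split.
      by rewrite distrC [leRHS]distrC !ger0_norm ?subr_ge0// ?(ltW lt_ts)//; lra.
    by rewrite E mulfK// subr_eq0.
  apply: (hr (g s, xi)); split => //=.
  by rewrite /ball_/=; exact: le_lt_trans ht.
- by rewrite v1 /h2 eqxx.
Unshelve. all: by end_near. Qed.

Lemma smooth_derive (V : normedModType R) (phi : V -> R) (v : V) :
  smooth phi -> smooth ('D_v phi).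
Proof.
move=> s vs; have := s (rcons vs v).
by rewrite /iterated_derivative foldr_rcons.
Qed.

Lemma smooth_continuous (V : normedModType R) (phi : V -> R) : smooth phi -> continuous phi.
Proof. by move=> s; have [c _] := s [::]. Qed.

Lemma is_derive_dx phi (x t : R) : smooth phi ->
  is_derive x 1 (fun x : R => phi (x, t)) (dx phi (x, t)).
Proof.
move=> s; have [_ /(_ (1, 0) (x, t)) D] := s [::].
have E : (fun h : R => h^-1 *: (((fun x : R => phi (x, t)) \o shift x) (h *: (1 : R)) - phi (x, t)))
   = (fun h : R => h^-1 *: ((phi \o shift ((x, t) : R^o * R^o)) (h *: ((1, 0) : R^o * R^o)) - phi (x, t))).
  apply/funext => h; rewrite /= /GRing.scale/=; congr (_ * (phi _ - _)).
  by congr pair; rewrite /= /scale_pair/= scaler0 add0r.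
split; first by rewrite /derivable E.
by rewrite /dx /derive E.
Qed.

Lemma is_derive_dt phi (x t : R) : smooth phi ->
  is_derive t 1 (fun t : R => phi (x, t)) (dt phi (x, t)).
Proof.
move=> s; have [_ /(_ (0, 1) (x, t)) D] := s [::].
have E : (fun h : R => h^-1 *: (((fun t : R => phi (x, t)) \o shift t) (h *: (1 : R)) - phi (x, t)))
   = (fun h : R => h^-1 *: ((phi \o shift ((x, t) : R^o * R^o)) (h *: ((0, 1) : R^o * R^o)) - phi (x, t))).
  apply/funext => h; rewrite /= /GRing.scale/=; congr (_ * (phi _ - _)).
  by congr pair; rewrite /= /scale_pair/= scaler0 add0r.
split; first by rewrite /derivable E.
by rewrite /dt /derive E.
Qed.

Lemma is_derive_near0 (f : R -> R) (x df : R) : is_derive x 1 f df ->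
  (\forall y \near x, f y = 0) -> df = 0.
Proof.
move=> [_ <-] h; have <- : 'D_1 (cst 0 : R -> R) x = 0 by rewrite derive_cst.
by apply: near_eq_derive; exact: h.
Qed.

Lemma is_derive1_periodic (f df : R -> R) : (forall x : R, is_derive x 1 f (df x)) ->
  Defs.periodic f -> Defs.periodic df.
Proof.
move=> d p x.
have := is_derive_comp_shift (2 * pi) x d.
have -> : (fun z : R => f (z + 2 * pi)) = f by apply/funext => z; exact: p.
by move=> h; have [_ <-] := h; have [_ ->] := d x.
Qed.

Lemma test_function_dx X T phi : test_function X T phi -> test_function X T (dx phi).
Proof.
move=> [s [c [d [c0 dT supp hX]]]]; split; first exact: smooth_derive.
have z0 x t : ~ (c <= t <= d) -> phi (x, t) = 0.
  by move=> h; apply/eqP/negP => /negP/supp.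
exists c, d; split => //.
  move=> x t; apply: contraNT => /negP h; apply/eqP.
  apply: (is_derive_near0 (is_derive_dx x t s)).
  by near=> y; exact: z0.
case: X hX => [[a [b hab]]|p]; last first.
  by move=> t; apply: is_derive1_periodic (p t) => x; exact: is_derive_dx.
exists a, b => x t; apply: contraNT => h; apply/eqP.
apply: (is_derive_near0 (is_derive_dx x t s)).
have : x < a \/ b < x by move: h; rewrite negb_and -!ltNge => /orP.
have zz y : y < a \/ b < y -> phi (y, t) = 0.
  move=> hy; apply/eqP/negP => /negP/hab/andP[h1 h2].
  by case: hy; rewrite ltNge ?h1 ?h2.
case=> hx.
  by near=> y; apply: zz; left; near: y; exact: lt_nbhsl.
by near=> y; apply: zz; right; near: y; exact: lt_nbhsr.
Unshelve. all: by end_near. Qed.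

Lemma test_function_dt X T phi : test_function X T phi -> test_function X T (dt phi).
Proof.
move=> [s [c [d [c0 dT supp hX]]]]; split; first exact: smooth_derive.
exists c, d; split => //.
  move=> x t; apply: contraNT => h; apply/eqP.
  apply: (is_derive_near0 (is_derive_dt x t s)).
  have : t < c \/ d < t by move: h; rewrite negb_and -!ltNge => /orP.
  have zz y : y < c \/ d < y -> phi (x, y) = 0.
    move=> hy; apply/eqP/negP => /negP/supp/andP[h1 h2].
    by case: hy; rewrite ltNge ?h1 ?h2.
  case=> hx.
    by near=> y; apply: zz; left; near: y; exact: lt_nbhsl.
  by near=> y; apply: zz; right; near: y; exact: lt_nbhsr.
case: X hX => [[a [b hab]]|p]; last first.
  move=> t x.
  have d1 := is_derive_dt x t s; have d2 := is_derive_dt (x + 2 * pi) t s.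
  have [_ <-] := d2; have [_ <-] := d1; congr ('D_1 _ t).
  by apply/funext => u; exact: p.
exists a, b => x t; apply: contraNT => h; apply/eqP.
apply: (is_derive_near0 (is_derive_dt x t s)); near=> y.
by apply/eqP/negP => /negP/hab; exact/negP.
Unshelve. all: by end_near. Qed.

(** On the line the support lies in a compact rectangle; on the circle periodicity reduces x to one
    period, and the extreme value theorem applies to that rectangle. *)
Lemma test_function_bounded X T phi : test_function X T phi ->
  exists B, forall x t, `|phi (x, t)| <= B.
Proof.
move=> [s [c [d [c0 dT supp hX]]]].
have cphi := smooth_continuous s.
have bnd (a b : R) : exists B, forall x t, a <= x <= b -> c <= t <= d -> `|phi (x, t)| <= B.
  have [ab|ba] := leP a b; last by exists 0 => x t /andP[h1 h2]; lra.
  have [cd|dc] := leP c d; last by exists 0 => x t _ /andP[h1 h2]; lra.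
  pose A : set (R^o * R^o) := `[a, b] `*` `[c, d].
  have cA : compact A by apply: compact_setX; exact: segment_compact.
  have A0 : A !=set0.
    by exists (a, c); split => /=; rewrite in_itv/= lexx.
  have cn : {within A, continuous (fun z : R^o * R^o => `|phi z|)}.
    apply: continuous_subspaceT => z; apply: continuous_comp; first exact: cphi.
    exact: norm_continuous.
  have [z zA hz] := compact_EVT_max A0 cA cn.
  exists `|phi z| => x t hx ht; apply: (hz (x, t)).
  by rewrite inE; split => /=; rewrite in_itv.
have [[a b] hB] : exists ab : R * R, forall B, (forall x t, ab.1 <= x <= ab.2 -> c <= t <= d -> `|phi (x, t)| <= B) ->
   0 <= B -> forall x t, `|phi (x, t)| <= B.
  case: X hX => [[a [b hab]]|p].
    exists (a, b) => B hB B0 x t; have [->|h] := eqVneq (phi (x, t)) 0; first by rewrite normr0.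
    by apply: hB; [exact: hab h|exact: supp h].
  exists (0, 2 * pi) => B hB B0 x t.
  have [->|h] := eqVneq (phi (x, t)) 0; first by rewrite normr0.
  have -> : phi (x, t) = phi (mod2pi x, t).
    have := periodicz (mod2pi x) (Num.floor (x / (2 * pi))) (p t).
    by rewrite /mod2pi subrK.
  apply: hB; last exact: supp h.
  by have /andP[-> /ltW ->] := mod2pi_bounds x.
have [B h] := bnd a b; exists (Num.max B 0) => x t; apply: hB.
  by move=> y u hy hu; rewrite le_max h.
by rewrite le_max lexx orbT.
Qed.

Lemma test_function_test1 X T phi (t : R) : test_function X T phi ->
  test1 X (fun x => phi (x, t)) (fun x => dx phi (x, t)).
Proof.
move=> tf; have [B b] := test_function_bounded tf.
have tf1 := test_function_dx tf; have [B1 b1] := test_function_bounded tf1.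
have [s _] := tf; have [s1 _] := tf1.
split.
- by move=> x; exact: is_derive_dx.
- by move=> x; exact: is_derive1_continuous (is_derive_dx x t s1).
- by case: tf => _ [c [d [_ _ _]]]; case: X {tf1 b1} => //= ->.
- by exists (Num.max B B1) => x; rewrite !le_max b b1 orbT.
Qed.

Lemma test_function_measurable X T phi : test_function X T phi ->
  measurable_fun [set: R * R] phi.
Proof. by move=> [/smooth_continuous s _]; exact: continuous_measurable2. Qed.

End TestFunctions.

(** * Fubini's theorem under a product bound *)

Section Fubini.
Context {R : realType}.
Local Notation mu := (@lebesgue_measure R).
Local Notation mu2 := (mu \x mu)%E.

(** The extension H of h by zero to the plane is integrable by Tonelli, since its inner integrals
    are at most |a(x)| times the integral of |b|. The conclusions are the properties of H read back
    on D1 x D2. *)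
Lemma dominated_fubini (D1 D2 : set (measurableTypeR R))
    (h : measurableTypeR R * measurableTypeR R -> R) (a b : R -> R) :
  measurable D1 -> measurable D2 -> measurable_fun setT h ->
  mu.-integrable D1 (EFin \o a) -> mu.-integrable D2 (EFin \o b) ->
  (forall x t, D1 x -> D2 t -> `|h (x, t)| <= a x * b t) ->
  [/\ mu2.-integrable (D1 `*` D2) (EFin \o h),
      mu.-integrable D2 (EFin \o (fun t => \int[mu]_(x in D1) h (x, t))),
      \int[mu2]_(z in D1 `*` D2) h z = \int[mu]_(t in D2) \int[mu]_(x in D1) h (x, t) &
      \int[mu]_(x in D1) \int[mu]_(t in D2) h (x, t) =
      \int[mu]_(t in D2) \int[mu]_(x in D1) h (x, t)].
Proof.
move=> mD1 mD2 mh ia ib hab.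
have mD : measurable (D1 `*` D2) by exact: measurableX.
pose H := ((EFin \o h) \_ (D1 `*` D2)).
have mEh : measurable_fun setT (EFin \o h) by exact/measurable_EFinP.
have mH : measurable_fun setT H.
  by apply/(measurable_restrictT _ mD); exact: measurable_funTS.
have m1 t : measurable_fun setT (fun x => h (x, t)) by exact: (measurableT_comp mh).
have m2 x : measurable_fun setT (fun t => h (x, t)) by exact: (measurableT_comp mh).
have i1 t : D2 t -> mu.-integrable D1 (EFin \o (fun x => h (x, t))).
  move=> Dt; apply: (le_integrable mD1 _ _ (integrableZr mD1 (b t) ia)).
    by apply/measurable_EFinP; exact: measurable_funTS.
  by move=> x Dx; rewrite lee_fin (le_trans (hab _ _ Dx Dt))// ler_norm.
have i2 x : D1 x -> mu.-integrable D2 (EFin \o (fun t => h (x, t))).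
  move=> Dx; apply: (le_integrable mD2 _ _ (integrableZl mD2 (a x) ib)).
    by apply/measurable_EFinP; exact: measurable_funTS.
  by move=> t Dt; rewrite lee_fin (le_trans (hab _ _ Dx Dt))// ler_norm.
have F1 x : (\int[mu]_t H (x, t) = ((fun x => (\int[mu]_(t in D2) h (x, t))%:E) \_ D1) x)%E.
  rewrite patchE; case: ifPn => [|nDx].
    rewrite inE => Dx.
    rewrite /Rintegral fineK; last exact: integrable_fin_num (i2 _ Dx).
    rewrite [RHS]integral_mkcond; apply: eq_integral => t _.
    rewrite /H !patchE; case: ifPn; case: ifPn => //.
      by move=> /negP + /[!inE] -[_ /= Dt]; rewrite inE.
    by move=> /[!inE] Dt /negP; rewrite inE; case; split.
  apply: integral0_eq => t _; rewrite /H patchE; case: ifPn => //.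
  by rewrite inE => -[/= Dx _]; move: nDx; rewrite mem_set.
have F2 t : (\int[mu]_x H (x, t) = ((fun t => (\int[mu]_(x in D1) h (x, t))%:E) \_ D2) t)%E.
  rewrite patchE; case: ifPn => [|nDt].
    rewrite inE => Dt.
    rewrite /Rintegral fineK; last exact: integrable_fin_num (i1 _ Dt).
    rewrite [RHS]integral_mkcond; apply: eq_integral => x _.
    rewrite /H !patchE; case: ifPn; case: ifPn => //.
      by move=> /negP + /[!inE] -[/= Dx _]; rewrite inE.
    by move=> /[!inE] Dx /negP; rewrite inE; case; split.
  apply: integral0_eq => x _; rewrite /H patchE; case: ifPn => //.
  by rewrite inE => -[/= _ Dt]; move: nDt; rewrite mem_set.
have iH : mu2.-integrable setT H.
  apply/integrable12ltyP => //.
  apply: (@le_lt_trans _ _ (\int[mu]_(x in D1) (`|a x| * \int[mu]_(t in D2) `|b t|)%:E)%E).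
    rewrite [leRHS]integral_mkcond; apply: ge0_le_integral => //.
    - by move=> x _; exact: integral_ge0.
    - apply: (measurable_fun_fubini_tonelli_F (abse \o H)) => //.
        exact: (measurableT_comp (@abse_measurable R setT) mH).
      by move=> z; exact: abse_ge0.
    - have mm : measurable_fun D1 (fun x => (`|a x| * \int[mu]_(t in D2) `|b t|)%:E).
        apply/measurable_EFinP; apply: measurable_funM => //.
        by apply: measurableT_comp => //; apply/measurable_EFinP; exact: measurable_int ia.
      by move/(measurable_restrictT _ mD1) : mm.
    - move=> x _; rewrite patchE; case: ifPn; last first.
        move=> nDx; rewrite integral0_eq// => t _; rewrite /H patchE; case: ifPn.
          by rewrite inE => -[/= Dx _]; move: nDx; rewrite mem_set.
        by rewrite abse0.
      rewrite inE => Dx; rewrite EFinM.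
      have ib' := integrable_norm ib.
      rewrite {1}/Rintegral fineK; last exact: integrable_fin_num ib'.
      rewrite -integralZl//.
      rewrite [leRHS]integral_mkcond; apply: ge0_le_integral => //.
      + exact: (measurableT_comp (@abse_measurable R setT) (measurableT_comp mH (pair1_measurable x))).
      + have mm : measurable_fun D2 (fun t => `|a x|%:E * (EFin \o (Num.norm \o b)) t)%E.
          by apply: emeasurable_funM => //; exact: measurable_int ib'.
        by move/(measurable_restrictT _ mD2) : mm.
      + move=> t _; rewrite /H !patchE; case: ifPn.
          rewrite inE => -[/= _ Dt]; rewrite mem_set//= lee_fin.
          by rewrite -normrM (le_trans (hab _ _ Dx Dt))// ler_norm.
        by move=> _; rewrite abse0; case: ifPn => // _; rewrite -EFinM lee_fin mulr_ge0.
  have ia' := integrableZr mD1 (\int[mu]_(t in D2) `|b t|) (integrable_norm ia).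
  apply: (integrable_lty mD1); exact: ia'.
have iF : mu2.-integrable (D1 `*` D2) (EFin \o h) by apply/(integrable_mkcond _ mD).
have iG' : mu.-integrable D2 (EFin \o (fun t => \int[mu]_(x in D1) h (x, t))).
  have ia' := integrable_norm ia.
  apply: (le_integrable mD2 _ _ (integrableZl mD2 (\int[mu]_(x in D1) `|a x|) (integrable_norm ib))).
    apply/(measurable_restrictT _ mD2); have := measurable_fubini_G iH.
    by congr (measurable_fun _ _); apply/funext => t; rewrite /fubini_G F2.
  move=> t Dt /=; rewrite lee_fin [leRHS]ger0_norm ?mulr_ge0//; last exact: Rintegral_ge0.
  apply: le_trans (le_normr_Rintegral mD1 (i1 _ Dt)) _.
  rewrite -RintegralZr//; apply: le_Rintegral => //.
  - exact: integrable_norm (i1 _ Dt).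
  - exact: (integrableZr mD1 `|b t| ia').
  - by move=> x Dx; rewrite -normrM (le_trans (hab _ _ Dx Dt))// ler_norm.
have e1 : (\int[mu2]_(z in D1 `*` D2) (h z)%:E = \int[mu]_(t in D2) (\int[mu]_(x in D1) h (x, t))%:E)%E.
  rewrite integral_mkcond -/H -(integral21_prod_meas1 iH) [RHS]integral_mkcond.
  by apply: eq_integral => t _; rewrite /fubini_G F2.
have e2 : (\int[mu2]_(z in D1 `*` D2) (h z)%:E = \int[mu]_(x in D1) (\int[mu]_(t in D2) h (x, t))%:E)%E.
  rewrite integral_mkcond -/H -(integral12_prod_meas1 iH) [RHS]integral_mkcond.
  by apply: eq_integral => t _; rewrite /fubini_F F1.
split => //; first by rewrite /Rintegral e1.
by rewrite {1}/Rintegral -e2 e1.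
Qed.

End Fubini.

(** * Pairings with test functions as iterated integrals *)

Section Pairing.
Context {R : realType}.
Local Notation mu := (@lebesgue_measure R).
Local Notation mu2 := (mu \x mu)%E.
Implicit Types (X : spatial_domain) (T : R) (f : R -> R -> R).

Definition jmeas (f : R -> R -> R) := measurable_fun [set: R * R] (fun z => f z.1 z.2).

Definition loc_bounded T f := jmeas f /\
  forall c d, 0 < c -> d < T -> exists M, forall x t, c <= t <= d -> `|f x t| <= M.

(** Decay like the profile gives integrability in x on the line, and products inherit it. Time is
    confined to compact subintervals of (0, T) because the momenta are unbounded near T. *)
Definition loc_dominated X T f := jmeas f /\
  forall c d, 0 < c -> d < T ->
    exists M, forall x t, c <= t <= d -> `|f x t| <= M * profile X x.

(** What the pairings use of a test function, smoothness left aside; the class is closed under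
    differences and so contains phi - phi_xx. *)
Record weak_test X T (chi : R * R -> R) : Prop := WeakTest {
  wt_meas : measurable_fun [set: R * R] chi;
  wt_bound : exists B, forall x t, `|chi (x, t)| <= B;
  wt_per : forall t, on_domain X (fun x => chi (x, t));
  wt_time : exists c d, [/\ 0 < c, c < d, d < T & forall x t, chi (x, t) != 0 -> c < t < d];
  wt_space : exists a b, forall x t, dom X x -> chi (x, t) != 0 -> a <= x <= b }.

Lemma test_function_weak X T phi : 0 < T -> test_function X T phi -> weak_test X T phi.
Proof.
move=> T0 tf; have := tf => -[s [c [d [c0 dT supp hX]]]]; split.
- exact: test_function_measurable tf.
- exact: test_function_bounded tf.
- by case: X hX {tf} => //= _.
- have [cd|dc] := leP c d.
    exists (c / 2), ((d + T) / 2); split; [lra|lra|lra|].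
    by move=> x t /supp/andP[h1 h2]; apply/andP; split; lra.
  exists (T / 3), (2 * T / 3); split; [lra|lra|lra|].
  by move=> x t /supp/andP[h1 h2]; lra.
- case: X hX {tf} => [[a [b h]]|_]; first by exists a, b => x t _; exact: h.
  by exists 0, (2 * pi) => x t /=; rewrite in_itv.
Qed.

Lemma weak_test_sub X T (f g : R * R -> R) : weak_test X T f -> weak_test X T g ->
  weak_test X T (fun z => f z - g z).
Proof.
move=> [mf [B b] pf [c [d [c0 cd dT st]]] [a [a' sx]]].
move=> [mg [B' b'] pg [c' [d' [c0' cd' dT' st']]] [e [e' sx']]].
have nz z : f z - g z != 0 -> f z != 0 \/ g z != 0.
  by have [->|] := eqVneq (f z) 0; [rewrite sub0r oppr_eq0; right|left].
split.
- exact: measurable_funB.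
- by exists (B + B') => x t; apply: le_trans (ler_normB _ _) _; apply: lerD.
- by move=> t; case: X pf pg sx sx' => //= pf pg _ _ x; rewrite pf pg.
- exists (Num.min c c'), (Num.max d d'); split.
  + by rewrite lt_min c0.
  + by rewrite gt_min lt_max cd.
  + by rewrite gt_max dT.
  + move=> x t /nz [/st|/st'] /andP[h1 h2]; rewrite gt_min lt_max h1 h2 ?orbT//.
- exists (Num.min a e), (Num.max a' e') => x t Dx /nz [/(sx _ _ Dx)|/(sx' _ _ Dx)] /andP[h1 h2];
  by rewrite ge_min le_max h1 h2 ?orbT.
Qed.

Lemma jmeas_cst (r : R) : jmeas (fun _ _ => r).
Proof. exact: measurable_cst. Qed.

Lemma jmeasD f g : jmeas f -> jmeas g -> jmeas (fun x t => f x t + g x t).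
Proof. exact: measurable_funD. Qed.

Lemma jmeasM f g : jmeas f -> jmeas g -> jmeas (fun x t => f x t * g x t).
Proof. exact: measurable_funM. Qed.

Lemma loc_dominated_bounded X T f : loc_dominated X T f -> loc_bounded T f.
Proof.
move=> [m h]; split => // c d c0 dT; have [M hM] := h c d c0 dT.
exists (M * peakG X 0) => x t ht; apply: le_trans (hM x t ht) _.
have M0 : 0 <= M.
  by have := le_trans (normr_ge0 _) (hM x t ht); rewrite pmulr_lge0// profile_gt0.
by apply: ler_wpM2l => //; exact: profile_le.
Qed.

Lemma loc_dominatedD X T f g : loc_dominated X T f -> loc_dominated X T g ->
  loc_dominated X T (fun x t => f x t + g x t).
Proof.
move=> [m h] [m' h']; split; first exact: jmeasD.
move=> c d c0 dT; have [M hM] := h c d c0 dT; have [M' hM'] := h' c d c0 dT.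
exists (M + M') => x t ht; rewrite mulrDl; apply: le_trans (ler_normD _ _) _.
by apply: lerD; [exact: hM|exact: hM'].
Qed.

Lemma loc_dominatedM X T f g : loc_bounded T f -> loc_dominated X T g ->
  loc_dominated X T (fun x t => f x t * g x t).
Proof.
move=> [m h] [m' h']; split; first exact: jmeasM.
move=> c d c0 dT; have [M hM] := h c d c0 dT; have [M' hM'] := h' c d c0 dT.
by exists (M * M') => x t ht; rewrite -mulrA; apply: ler_normrM; [exact: hM|exact: hM'].
Qed.

Lemma loc_bounded_cst T (r : R) : loc_bounded T (fun _ _ => r).
Proof. by split; [exact: jmeas_cst|move=> *; exists `|r|]. Qed.

Lemma loc_bounded_L1loc X T f : loc_bounded T f -> L1loc X T f.
Proof.
move=> [m h] a b c d c0 dT; have [M hM] := h c d c0 dT.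
have mD1 : measurable (dom X `&` `[a, b] : set (measurableTypeR R)).
  by apply: measurableI => //; exact: measurable_dom.
have mD2 : measurable (`[c, d] : set (measurableTypeR R)) by [].
have i1 : mu.-integrable (dom X `&` `[a, b]) (EFin \o (fun x => M * \1_`[a, b] x)).
  apply: (integrableS measurableT) => //.
  exact: (integrableZl measurableT M (integrable_indic_itv a b true false)).
have i2 : mu.-integrable `[c, d] (EFin \o (\1_`[c, d] : R -> R)).
  by apply: (integrableS measurableT) => //; exact: integrable_indic_itv.
have [] := dominated_fubini mD1 mD2 m i1 i2; last by [].
by move=> x t [_ hx] ht; rewrite !indicE !mem_set// !mulr1; exact: hM.
Qed.

Lemma pairing_iterated X T f chi : loc_bounded T f -> weak_test X T chi ->
  mu.-integrable `]0, T[ (EFin \o (fun t => \int[mu]_(x in dom X) (f x t * chi (x, t)))) /\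
  pairing X T f chi = \int[mu]_(t in `]0, T[) \int[mu]_(x in dom X) (f x t * chi (x, t)).
Proof.
move=> [m h] [mc [B b] pc [c [d [c0 cd dT st]]] [a [a' sx]]].
have [M hM] := h c d c0 dT.
have mD2 : measurable (`]0, T[ : set (measurableTypeR R)) by [].
have mf : measurable_fun setT (fun z : R * R => f z.1 z.2 * chi z).
  exact: measurable_funM.
have i1 : mu.-integrable (dom X) (EFin \o (fun x => M * B * \1_`[a, a'] x)).
  apply: (integrableS measurableT) => //; first exact: measurable_dom.
  exact: (integrableZl measurableT (M * B) (integrable_indic_itv a a' true false)).
have i2 : mu.-integrable `]0, T[ (EFin \o (\1_`[c, d] : R -> R)).
  by apply: (integrableS measurableT) => //; exact: integrable_indic_itv.
have [|_ ig e _] := dominated_fubini (@measurable_dom R X) mD2 mf i1 i2.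
  move=> x t Dx _ /=; have [->|nz] := eqVneq (chi (x, t)) 0.
    have M0 : 0 <= M by apply: le_trans (hM x c _) => //; rewrite lexx ltW.
    have B0 : 0 <= B by apply: le_trans (b x t).
    rewrite mulr0 normr0 !indicE; apply: mulr_ge0 => //; apply: mulr_ge0 => //.
    exact: mulr_ge0.
  have /andP[h1 h2] := st _ _ nz.
  rewrite !indicE !mem_set/= ?in_itv/= ?(sx _ _ Dx nz) ?(ltW h1) ?(ltW h2)// !mulr1.
  by apply: ler_normrM => //; apply: hM; rewrite !ltW.
by split.
Qed.

End Pairing.

(** * The nonlocal terms as convolutions *)

Section Convolution.
Context {R : realType}.
Local Notation mu := (@lebesgue_measure R).
Implicit Types (X : spatial_domain) (T : R) (f : R -> R -> R).

(** Tonelli gives the measurability of the integrals of the positive and of the negative part;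
    [fine] of their difference stays measurable even where the integral diverges. *)
Lemma measurable_Rintegral_param d (S : measurableType d) (D : set (measurableTypeR R))
    (h : S * measurableTypeR R -> R) : measurable D -> measurable_fun setT h ->
  measurable_fun setT (fun s => \int[mu]_(y in D) h (s, y)).
Proof.
move=> mD mh.
have mDD : measurable (setT `*` D : set (S * measurableTypeR R)) by exact: measurableX.
pose H := (EFin \o h) \_ (setT `*` D).
have mH : measurable_fun setT H.
  apply/(measurable_restrictT _ mDD); apply: measurable_funTS; exact/measurable_EFinP.
have e s : (\int[mu]_(y in D) (h (s, y))%:E =
    \int[mu]_y (H^\+ (s, y)) - \int[mu]_y (H^\- (s, y)))%E.
  rewrite integral_mkcond integralE.
  have E y : ((fun y => (h (s, y))%:E) \_ D) y = H (s, y).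
    rewrite /H !patchE; have [Dy|nDy] := boolP (y \in D).
      by rewrite mem_set//; split => //; rewrite inE in Dy.
    by case: ifPn => //; rewrite inE => -[_ /= Dy]; move: nDy; rewrite mem_set.
  by congr (_ - _)%E; apply: eq_integral => y _; rewrite ?funeposE ?funenegE E.
have m1 := measurable_fun_fubini_tonelli_F (m2 := mu) _ (measurable_funepos mH) (fun x => funepos_ge0 _ x).
have m2 := measurable_fun_fubini_tonelli_F (m2 := mu) _ (measurable_funeneg mH) (fun x => funeneg_ge0 _ x).
rewrite /Rintegral; under eq_fun do rewrite e.
by apply: (measurableT_comp (@fine_measurable R setT measurableT)); exact: emeasurable_funB.
Qed.

(** D^{-2} applied to f at each time, by the same kernel as [resolvent], which acts on test
    functions. *)
Definition conv X f (x t : R) : R :=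
  (2 * peakA X)^-1 * \int[mu]_(y in dom X) (profile X (x - y) * f y t).

Lemma conv_loc_bounded X T f : loc_dominated X T f -> loc_bounded T (conv X f).
Proof.
move=> [m h]; have mD := @measurable_dom R X; split.
  apply: measurable_funM => //.
  pose hh (z : (measurableTypeR R * measurableTypeR R) * measurableTypeR R) : R :=
    profile X (z.1.1 - z.2) * f z.2 z.1.2.
  apply: (@measurable_Rintegral_param _ _ _ hh) => //.
  apply: measurable_funM.
    apply: (measurableT_comp (measurable_profile X)); apply: measurable_funB => //.
    exact: (measurableT_comp measurable_fst measurable_fst).
  have mm : measurable_fun setT (fun z : (measurableTypeR R * measurableTypeR R) * measurableTypeR R =>
      (z.2, z.1.2)).
    apply: measurable_fun_pair => //.
    exact: (measurableT_comp measurable_snd measurable_fst).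
  exact: (measurableT_comp m mm).
move=> c d c0 dT; have [M hM] := h c d c0 dT.
exists ((2 * peakA X)^-1 * (peakG X 0 * M * \int[mu]_(y in dom X) profile X y)) => x t ht.
have A0 : 0 <= (2 * peakA X)^-1 :> R by rewrite ltW// invr_gt0 mulr_gt0// peakA_gt0.
rewrite /conv normrM (ger0_norm A0); apply: ler_wpM2l => //.
have b y : `|profile X (x - y) * f y t| <= peakG X 0 * M * profile X y.
  rewrite -mulrA; apply: ler_normrM; last exact: hM.
  by rewrite ger0_norm ?profile_le// ltW// profile_gt0.
have mt : measurable_fun setT (fun y : R => profile X (x - y) * f y t).
  apply: measurable_funM; last by exact: (measurableT_comp m (pair2_measurable t)).
  by apply: (measurableT_comp (measurable_profile X)); exact: measurable_funB.
have ii := @integrable_dominated R X _ _ _ mD (@subset_refl _ _) mt (fun y _ => b y).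
apply: le_trans (le_normr_Rintegral mD ii) _.
rewrite -RintegralZl//; last exact: integrable_profile.
apply: le_Rintegral => //; first exact: integrable_norm ii.
exact: (integrableZl mD (peakG X 0 * M) (integrable_profile X)).
Qed.

(** Symmetry of D^{-2}: by Fubini the kernel passes from f to the test function. *)
Lemma conv_pairing X T f chi (t : R) : 0 < t < T ->
  loc_dominated X T f -> weak_test X T chi ->
  \int[mu]_(x in dom X) (conv X f x t * chi (x, t)) =
  \int[mu]_(y in dom X) (f y t * resolvent X (fun x => chi (x, t)) y).
Proof.
move=> /andP[t0 tT] [m h] [mc [B b] pc [c [d [c0 cd dT st]]] [a [a' sx]]].
have [M hM] := h t t t0 tT; have {}hM y : `|f y t| <= M * profile X y by apply: hM; rewrite lexx.
have mD := @measurable_dom R X.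
have mct : measurable_fun setT (fun x : R => chi (x, t)) by exact: (measurableT_comp mc (pair2_measurable t)).
have mft : measurable_fun setT (fun x : R => f x t) by exact: (measurableT_comp m (pair2_measurable t)).
pose hh (z : measurableTypeR R * measurableTypeR R) : R :=
  profile X (z.1 - z.2) * f z.2 t * chi (z.1, t).
have mh : measurable_fun setT hh.
  apply: measurable_funM; last by apply: (measurableT_comp mct).
  apply: measurable_funM; last by apply: (measurableT_comp mft).
  by apply: (measurableT_comp (measurable_profile X)); apply: measurable_funB.
have i1 : mu.-integrable (dom X) (EFin \o (fun x => peakG X 0 * B * \1_`[a, a'] x)).
  apply: (integrableS measurableT) => //.
  exact: (integrableZl measurableT (peakG X 0 * B) (integrable_indic_itv a a' true false)).
have i2 : mu.-integrable (dom X) (EFin \o (fun y => M * profile X y)).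
  exact: (integrableZl mD M (integrable_profile X)).
have B0 : 0 <= B by apply: le_trans (b 0 t).
have G0 : 0 <= @peakG R X 0 by apply: ltW; exact: peakG_gt0.
have [|_ _ _ e] := dominated_fubini mD mD mh i1 i2.
  move=> x y Dx Dy; rewrite /hh/=.
  have g1 : `|profile X (x - y)| <= peakG X 0.
    by rewrite ger0_norm ?profile_le// ltW// profile_gt0.
  have -> : peakG X 0 * B * \1_`[a, a'] x * (M * profile X y) =
    peakG X 0 * (M * profile X y) * (B * \1_`[a, a'] x) by ring.
  apply: ler_normrM; first by exact: ler_normrM.
  have [->|nz] := eqVneq (chi (x, t)) 0.
    by rewrite normr0 indicE mulr_ge0.
  by rewrite indicE mem_set ?mulr1//= in_itv/= (sx _ _ Dx nz).
have s1 : \int[mu]_(x in dom X) (conv X f x t * chi (x, t)) =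
    (2 * peakA X)^-1 * \int[mu]_(x in dom X) \int[mu]_(y in dom X) hh (x, y).
  rewrite -RintegralZl//.
    apply: eq_Rintegral => x _; rewrite /conv -mulrA; congr (_ * _).
    rewrite -RintegralZr//.
    apply: (@integrable_dominated R X _ _ (peakG X 0 * M)) => //.
      apply: measurable_funM => //.
      by apply: (measurableT_comp (measurable_profile X)); exact: measurable_funB.
    move=> y _; rewrite -mulrA; apply: ler_normrM => //.
    by rewrite ger0_norm ?profile_le// ltW// profile_gt0.
  have i1' : mu.-integrable (dom X) (EFin \o (fun x => \int[mu]_(y in dom X) hh (x, y))).
    have mh' : measurable_fun setT (fun z : measurableTypeR R * measurableTypeR R => hh (z.2, z.1)).
      by apply: (measurableT_comp mh); exact: measurable_swap.
    have [|_ + _ _] := dominated_fubini mD mD mh' i2 i1; last by [].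
    move=> y x Dy Dx; rewrite /hh/=.
    have g1 : `|profile X (x - y)| <= peakG X 0.
      by rewrite ger0_norm ?profile_le// ltW// profile_gt0.
    have -> : M * profile X y * (peakG X 0 * B * \1_`[a, a'] x) =
      peakG X 0 * (M * profile X y) * (B * \1_`[a, a'] x) by ring.
    apply: ler_normrM; first by exact: ler_normrM.
    have [->|nz] := eqVneq (chi (x, t)) 0.
      by rewrite normr0 indicE mulr_ge0.
    by rewrite indicE mem_set ?mulr1//= in_itv/= (sx _ _ Dx nz).
  exact: i1'.
rewrite s1 e -RintegralZl//; last first.
  have [|_ + _ _] := dominated_fubini mD mD mh i1 i2; last by [].
  move=> x y Dx Dy; rewrite /hh/=.
  have g1 : `|profile X (x - y)| <= peakG X 0.
    by rewrite ger0_norm ?profile_le// ltW// profile_gt0.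
  have -> : peakG X 0 * B * \1_`[a, a'] x * (M * profile X y) =
    peakG X 0 * (M * profile X y) * (B * \1_`[a, a'] x) by ring.
  apply: ler_normrM; first by exact: ler_normrM.
  have [->|nz] := eqVneq (chi (x, t)) 0.
    by rewrite normr0 indicE mulr_ge0.
  by rewrite indicE mem_set ?mulr1//= in_itv/= (sx _ _ Dx nz).
apply: eq_Rintegral => y _; rewrite /resolvent mulrCA; congr (_ * _).
rewrite -(profile_shift_prod y mct (pc t) (fun x => b x t)) -RintegralZl//.
  by apply: eq_Rintegral => x _; rewrite /hh/=; ring.
apply: (@integrable_dominated R X _ _ (B * (cosh pi * expR `|y|))) => //.
  apply: measurable_funM => //.
  by apply: (measurableT_comp (measurable_profile X)); exact: measurable_funB.
move=> x _; rewrite [_ * chi _]mulrC -mulrA; apply: ler_normrM => //.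
by rewrite ger0_norm ?(ltW (profile_gt0 _ _))// -(normrN y); exact: profile_shift.
Qed.

(** After [conv_pairing] the resolvent meets phi - phi_xx, and [resolvent_green] turns the result
    into phi. *)
Lemma conv_is_Dm2 X T f : 0 < T -> loc_dominated X T f -> is_Dm2 X T f (conv X f).
Proof.
move=> T0 df; have bw := conv_loc_bounded df.
split.
- exact: loc_bounded_L1loc (loc_dominated_bounded df).
- exact: loc_bounded_L1loc bw.
- move=> c d c0 dT; have [M hM] := bw.2 c d c0 dT.
  by exists M => x t _ ht; exact: hM.
move=> phi tf; have tf1 := test_function_dx tf; have tf2 := test_function_dx tf1.
have w0 := test_function_weak T0 tf; have w2 := test_function_weak T0 tf2.
have [_ ->] := pairing_iterated bw (weak_test_sub w0 w2).
have [_ ->] := pairing_iterated (loc_dominated_bounded df) w0.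
apply: eq_Rintegral => t; rewrite inE/= in_itv/= => ht.
rewrite (conv_pairing ht df (weak_test_sub w0 w2)).
apply: eq_Rintegral => y _; congr (_ * _).
have t1 := test_function_test1 t tf; have t2 := test_function_test1 t tf1.
rewrite -(resolvent_green y t1 t2) /resolvent -mulrBr; congr (_ * _).
have [B b] := wt_bound w0; have [B' b'] := wt_bound w2.
rewrite -RintegralB//; last 3 first.
- exact: measurable_dom.
- by apply: (@integrable_profileM _ _ _ B); [exact: test1_measurable (test1_shift y t1)|move=> z; exact: b].
- by apply: (@integrable_profileM _ _ _ B'); [exact: test1_measurable1 (test1_shift y t2)|move=> z; exact: b'].
by apply: eq_Rintegral => z _; rewrite mulrBr.
Qed.

End Convolution.

(** * Moving peaks tested against phi *)

Section Transport.
Context {R : realType}.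
Local Notation mu := (@lebesgue_measure R).
Variables (X : spatial_domain) (T : R).
Hypothesis T0 : 0 < T.

Lemma continuous_loc_bounded (f : R -> R) :
  (forall t, 0 < t < T -> {for t, continuous f}) ->
  forall c d, 0 < c -> d < T -> exists M, forall t, c <= t <= d -> `|f t| <= M.
Proof.
move=> cf c d c0 dT; have [cd|dc] := leP c d; last by exists 0 => t /andP[h1 h2]; lra.
have {}cf : {within `[c, d], continuous (fun t => `|f t|)}.
  apply: continuous_in_subspaceT => t; rewrite inE/= in_itv/= => /andP[h1 h2].
  apply: continuous_comp; last exact: norm_continuous.
  by apply: cf; apply/andP; split; lra.
have [z _ hz] := EVT_max cd cf.
by exists `|f z| => t ht; apply: hz; rewrite in_itv.
Qed.

(** The time derivative of [p t * phi (z + q t, t)], when p' = dp and q' = dq. *)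
Definition transport_density (p dp q dq : R -> R) (phi : R^o * R^o -> R) (z t : R) : R :=
  dp t * phi (z + q t, t) + p t * (dx phi (z + q t, t) * dq t + dt phi (z + q t, t)).

(** For fixed z the density is the derivative in t of a function that vanishes near 0 and near T, so
    its time integral is zero. Fubini exchanges this with the integral in z. *)
Lemma transport_null (p dp q dq : R -> R) (phi : R^o * R^o -> R) :
  measurable_fun setT p -> measurable_fun setT q ->
  measurable_fun setT dp -> measurable_fun setT dq ->
  (forall t, 0 < t < T -> is_derive t 1 p (dp t)) ->
  (forall t, 0 < t < T -> is_derive t 1 q (dq t)) ->
  (forall t, 0 < t < T -> {for t, continuous dp}) ->
  (forall t, 0 < t < T -> {for t, continuous dq}) ->
  test_function X T phi ->
  mu.-integrable `]0, T[ (EFin \o (fun t =>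
    \int[mu]_(z in dom X) (profile X z * transport_density p dp q dq phi z t))) /\
  \int[mu]_(t in `]0, T[) \int[mu]_(z in dom X)
     (profile X z * transport_density p dp q dq phi z t) = 0.
Proof.
move=> mp mq mdp mdq Dp Dq cdp cdq tf.
have [sm _] := tf; have tfx := test_function_dx tf; have tft := test_function_dt tf.
have [smx _] := tfx; have [smt _] := tft.
have w0 := test_function_weak T0 tf; have wx := test_function_weak T0 tfx.
have wt := test_function_weak T0 tft.
have [B b] := wt_bound w0; have [Bx bx] := wt_bound wx; have [Bt bt] := wt_bound wt.
have [c [d [c0 cd dT s0 [sx st]]]] : exists c d, [/\ 0 < c, c < d, d < T,
    forall x t, phi (x, t) != 0 -> c < t < d &
    (forall x t, dx phi (x, t) != 0 -> c < t < d) /\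
    (forall x t, dt phi (x, t) != 0 -> c < t < d)].
  have [c1 [d1 [a1 b1 e1 f1]]] := wt_time w0.
  have [c2 [d2 [a2 b2 e2 f2]]] := wt_time wx.
  have [c3 [d3 [a3 b3 e3 f3]]] := wt_time wt.
  exists (Num.min c1 (Num.min c2 c3)), (Num.max d1 (Num.max d2 d3)).
  split; [by rewrite !lt_min a1 a2| by rewrite gt_min !lt_max b1|by rewrite !gt_max e1 e2| |split].
  - by move=> x t /f1/andP[h1 h2]; rewrite gt_min lt_max h1 h2.
  - by move=> x t /f2/andP[h1 h2]; rewrite !gt_min !lt_max h1 h2 !orbT.
  - by move=> x t /f3/andP[h1 h2]; rewrite !gt_min !lt_max h1 h2 !orbT.
have D0 z t : ~~ (c < t < d) -> transport_density p dp q dq phi z t = 0.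
  move=> h; rewrite /transport_density.
  have -> : phi (z + q t, t) = 0 by apply/eqP; apply: contraNT h; exact: s0.
  have -> : dx phi (z + q t, t) = 0 by apply/eqP; apply: contraNT h; exact: sx.
  have -> : dt phi (z + q t, t) = 0 by apply/eqP; apply: contraNT h; exact: st.
  by rewrite mul0r addr0 !mulr0 addr0.
have DN z t : 0 < t < T -> is_derive t 1 (fun t => p t * phi (z + q t, t))
    (transport_density p dp q dq phi z t).
  move=> ht; have h1 := Dp t ht; have h2 := Dq t ht.
  have h2' : is_derive t 1 (fun t => z + q t) (dq t).
    by apply: (is_derive_eq (is_deriveD (is_derive_cst z t 1) h2)); rewrite add0r.
  have h3 := chain_rule2 (fun x t => is_derive_dx x t sm) (fun x t => is_derive_dt x t sm)
    (smooth_continuous smt) h2'.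
  have h4 := is_deriveM h1 h3.
  by apply: (is_derive_eq h4); rewrite /transport_density /GRing.scale/=; ring.
have cD z t : 0 < t < T -> {for t, continuous (transport_density p dp q dq phi z)}.
  move=> ht; have cp := is_derive1_continuous (Dp t ht); have cq := is_derive1_continuous (Dq t ht).
  have cpt : {for t, continuous (fun t => (z + q t, t) : R^o * R^o)}.
    rewrite /prop_for/= /continuous_at.
    have c1 : (z + q t0) @[t0 --> t] --> (z + q t : R^o) by apply: cvgD => //; exact: cvg_cst.
    exact: (@cvg_pair _ _ _ (nbhs t) (nbhs (z + q t : R^o)) (nbhs (t : R^o)) _ _ _ (fun t => z + q t) id c1 (@cvg_id _ (nbhs t))).
  have cphi (f : R^o * R^o -> R) : continuous f -> {for t, continuous (fun t => f (z + q t, t))}.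
    by move=> cf; apply: (continuous_comp cpt); exact: cf.
  apply: cvgD; first by apply: cvgM; [exact: cdp|exact: cphi (smooth_continuous sm)].
  apply: cvgM; first exact: cp.
  apply: cvgD; last exact: cphi (smooth_continuous smt).
  by apply: cvgM; [exact: cphi (smooth_continuous smx)|exact: cdq].
have int0 z : \int[mu]_(t in `]0, T[) transport_density p dp q dq phi z t = 0.
  have -> : \int[mu]_(t in `]0, T[) transport_density p dp q dq phi z t =
      \int[mu]_(t in `[c, d]) transport_density p dp q dq phi z t.
    rewrite Rintegral_mkcond [RHS]Rintegral_mkcond; apply: eq_Rintegral => t _.
    rewrite !patchE; have [h|h] := boolP (c < t < d); last by rewrite D0 // !if_same.
    by move: h => /andP[h1 h2]; rewrite !mem_set//= in_itv/=; apply/andP; split; lra.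
  rewrite /Rintegral (@continuous_FTC2 R _ (fun t => p t * phi (z + q t, t)))//=.
  - have -> : phi (z + q d, d) = 0 by apply/eqP; apply: contraTT cd => /s0/andP[]; rewrite ltxx.
    have -> : phi (z + q c, c) = 0 by apply/eqP; apply: contraTT cd => /s0/andP[]; rewrite ltxx.
    by rewrite !mulr0 subrr.
  - apply: continuous_in_subspaceT => t; rewrite inE/= in_itv/= => /andP[h1 h2].
    by apply: cD; apply/andP; split; lra.
  - have cN t : c <= t <= d -> {for t, continuous (fun t => p t * phi (z + q t, t))}.
      by move=> /andP[h1 h2]; apply: is_derive1_continuous (DN z t _); apply/andP; split; lra.
    split.
    + move=> t; rewrite in_itv/= => /andP[h1 h2].
      by have [] := DN z t (ltac:(apply/andP; split; lra)).
    + by apply: cvg_at_right_filter; apply: cN; rewrite lexx ltW.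
    + by apply: cvg_at_left_filter; apply: cN; rewrite lexx ltW.
  - move=> t; rewrite in_itv/= => /andP[h1 h2]; rewrite derive1E.
    by have [_ ->] := DN z t (ltac:(apply/andP; split; lra)).
have cont_of (f g : R -> R) : (forall t, 0 < t < T -> is_derive t 1 f (g t)) ->
    forall t, 0 < t < T -> {for t, continuous f}.
  by move=> h t ht; exact: is_derive1_continuous (h t ht).
have [P hP] := continuous_loc_bounded (cont_of _ _ Dp) c0 dT.
have [P' hP'] := continuous_loc_bounded cdp c0 dT.
have [Q' hQ'] := continuous_loc_bounded cdq c0 dT.
pose M := P' * B + P * (Bx * Q' + Bt).
have mD : measurable_fun setT (fun z : measurableTypeR R * measurableTypeR R =>
    profile X z.1 * transport_density p dp q dq phi z.1 z.2).
  have msnd (f : R -> R) : measurable_fun setT f ->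
      measurable_fun setT (fun z : measurableTypeR R * measurableTypeR R => f z.2).
    by move=> mf; exact: (measurableT_comp mf measurable_snd).
  have mm : measurable_fun setT (fun z : measurableTypeR R * measurableTypeR R => (z.1 + q z.2, z.2)).
    by apply: measurable_fun_pair => //; apply: measurable_funD => //; exact: msnd.
  have mphi (f : R^o * R^o -> R) : measurable_fun [set: R * R] f ->
      measurable_fun setT (fun z : measurableTypeR R * measurableTypeR R => f (z.1 + q z.2, z.2)).
    by move=> mf; exact: (measurableT_comp mf mm).
  apply: measurable_funM; first by exact: (measurableT_comp (measurable_profile X) measurable_fst).
  apply: measurable_funD.
    by apply: measurable_funM; [exact: msnd|exact: mphi (wt_meas w0)].
  apply: measurable_funM; first exact: msnd.
  apply: measurable_funD; last exact: mphi (wt_meas wt).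
  by apply: measurable_funM; [exact: mphi (wt_meas wx)|exact: msnd].
have i2 : mu.-integrable `]0, T[ (EFin \o (fun t => M * \1_`[c, d] t)).
  apply: (integrableS measurableT) => //.
  exact: (integrableZl measurableT M (integrable_indic_itv c d true false)).
have bD (z t : R) : `|transport_density p dp q dq phi z t| <= M * \1_`[c, d] t.
  have [h|h] := boolP (c < t < d); last first.
    rewrite D0// normr0 mulr_ge0//.
    have h' : c <= c <= d by rewrite lexx ltW.
    have P0 := le_trans (normr_ge0 _) (hP c h').
    have P'0 := le_trans (normr_ge0 _) (hP' c h').
    have Q'0 := le_trans (normr_ge0 _) (hQ' c h').
    have B0 := le_trans (normr_ge0 _) (b 0 0).
    have Bx0 := le_trans (normr_ge0 _) (bx 0 0).
    have Bt0 := le_trans (normr_ge0 _) (bt 0 0).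
    by rewrite /M addr_ge0// mulr_ge0// addr_ge0// mulr_ge0.
  have ht : c <= t <= d by move: h => /andP[/ltW-> /ltW->].
  rewrite indicE mem_set/= ?in_itv// mulr1.
  apply: le_trans (ler_normD _ _) _; apply: lerD; apply: ler_normrM; rewrite ?hP ?hP' ?b//.
  by apply: le_trans (ler_normD _ _) _; apply: lerD; rewrite ?bt//; apply: ler_normrM; rewrite ?bx ?hQ'.
have [|_ h1 _ h2] := dominated_fubini (@measurable_dom R X) (measurable_itv `]0, T[) mD (integrable_profile X) i2.
  move=> z t _ _ /=; apply: ler_normrM => //.
  by rewrite ger0_norm// ltW// profile_gt0.
split; first exact: h1.
have key (D : set (measurableTypeR R)) (c' : R) (f : R -> R) : measurable D ->
    mu.-integrable D (EFin \o f) ->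
    \int[mu]_(t in D) (c' * f t) = c' * \int[mu]_(t in D) f t.
  by move=> mD' h; exact: RintegralZl.
rewrite -h2; transitivity (\int[mu]_(z in dom X) (0 : R)); last by rewrite /Rintegral integral0.
apply: eq_Rintegral => z _.
suff it : mu.-integrable `]0, T[ (EFin \o transport_density p dp q dq phi z).
  transitivity (profile X z * \int[mu]_(t in `]0, T[) transport_density p dp q dq phi z t).
    rewrite /=. exact: key.
  by rewrite int0 mulr0.
have mz : measurable_fun setT (fun t => profile X z * transport_density p dp q dq phi z t).
  exact: (measurableT_comp mD (pair1_measurable z)).
have mz2 : measurable_fun setT (transport_density p dp q dq phi z).
  move: mz; set f := transport_density p dp q dq phi z => mz.
  have mc : measurable_fun setT (cst (profile X z)^-1 : R -> R) by exact: measurable_cst.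
  have := measurable_funM mc mz.
  suff -> : (cst (profile X z)^-1 \* (fun t => profile X z * f t)) = f by [].
  apply/funext => t; exact: (mulKf (lt0r_neq0 (profile_gt0 X z))).
have mI : measurable (`]0, T[ : set (measurableTypeR R)) by exact: measurable_itv.
apply: (le_integrable mI _ _ i2).
  by apply/measurable_EFinP; exact: measurable_funTS.
move=> t _; rewrite lee_fin; exact: le_trans (bD z t) (ler_norm _).
Qed.

End Transport.

(** * Peakon flows are weak solutions of the Novikov equation *)

Section NovikovPeakons.
Context {R : realType}.
Local Notation mu := (@lebesgue_measure R).
Implicit Types (X : spatial_domain) (T : R).

(* u(q_j) and the mean of the one-sided derivatives u_x(q_j) for
   u = p g(x - q_j) + p' g(x - q_i), where d = q_j - q_i > 0 and, in the
   second case, the sign of d is reversed. *)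
Definition peak_value X (p p' d : R) : R := p * peakG X 0 + p' * peakG X d.
Definition peak_slope X (p d : R) : R := p * peakS X d.

(** Measurability is recorded separately and on all of R, since the differential equations say
    nothing outside (0, T). On the circle the gap must stay below a full turn for the formulas
    between the peaks to apply. *)
Record peakon_flow X T (p1 p2 q1 q2 : R -> R) : Prop := PeakonFlow {
  pf_meas : [/\ measurable_fun setT p1, measurable_fun setT p2,
                measurable_fun setT q1 & measurable_fun setT q2];
  pf_gap : forall t, 0 < t < T ->
    0 < q2 t - q1 t /\ (X = Circle -> q2 t - q1 t < 2 * pi);
  pf_p1 : forall t, 0 < t < T -> is_derive t 1 p1
    (p1 t * peak_value X (p1 t) (p2 t) (q2 t - q1 t) * peak_slope X (p2 t) (q2 t - q1 t));
  pf_p2 : forall t, 0 < t < T -> is_derive t 1 p2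
    (- (p2 t * peak_value X (p2 t) (p1 t) (q2 t - q1 t) * peak_slope X (p1 t) (q2 t - q1 t)));
  pf_q1 : forall t, 0 < t < T ->
    is_derive t 1 q1 (peak_value X (p1 t) (p2 t) (q2 t - q1 t) ^+ 2);
  pf_q2 : forall t, 0 < t < T ->
    is_derive t 1 q2 (peak_value X (p2 t) (p1 t) (q2 t - q1 t) ^+ 2) }.

Section Flow.
Variables (X : spatial_domain) (T : R) (p1 p2 q1 q2 : R -> R).
Hypotheses (T0 : 0 < T) (flow : peakon_flow X T p1 p2 q1 q2).

Let U1 t := peak_value X (p1 t) (p2 t) (q2 t - q1 t).
Let U2 t := peak_value X (p2 t) (p1 t) (q2 t - q1 t).
Let V1 t := peak_slope X (p2 t) (q2 t - q1 t).
Let V2 t := peak_slope X (p1 t) (q2 t - q1 t).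

Let u : R -> R -> R := two_peakon X p1 p2 q1 q2.
Let v (x t : R) : R := dpk2 X (p1 t) (p2 t) (q1 t) (q2 t) x.

Let cont_of (f g : R -> R) : (forall t, 0 < t < T -> is_derive t 1 f (g t)) ->
  forall t, 0 < t < T -> {for t, continuous f}.
Proof. by move=> h t ht; exact: is_derive1_continuous (h t ht). Qed.

Let msnd (f : R -> R) : measurable_fun setT f -> jmeas (fun _ t : R => f t).
Proof. by move=> mf; exact: (measurableT_comp mf measurable_snd). Qed.

Let loc_bounded_time (f : R -> R) : measurable_fun setT f ->
  (forall t, 0 < t < T -> {for t, continuous f}) -> loc_bounded T (fun _ t => f t).
Proof.
move=> mf cf; split; first exact: msnd.
by move=> c d c0 dT; have [M hM] := continuous_loc_bounded cf c0 dT; exists M => _ t; exact: hM.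
Qed.

Let loc_dominated_peak (g : R -> R) (q : R -> R) : measurable_fun setT g ->
  (forall x, `|g x| <= profile X x) -> measurable_fun setT q ->
  (forall t, 0 < t < T -> {for t, continuous q}) ->
  loc_dominated X T (fun x t => g (x - q t)).
Proof.
move=> mg bg mq cq; split.
  have mm : measurable_fun setT (fun z : measurableTypeR R * measurableTypeR R => z.1 - q z.2).
    by apply: measurable_funB => //; exact: (measurableT_comp mq measurable_snd).
  exact: (measurableT_comp mg mm).
move=> c d c0 dT; have [M hM] := continuous_loc_bounded cq c0 dT.
exists (cosh pi * expR M) => x t ht; apply: le_trans (bg _) _.
apply: le_trans (profile_shift _ _ _) _.
apply: ler_wpM2r; first exact: ltW (profile_gt0 X x).
apply: ler_wpM2l; first exact: ltW (cosh_gt0 _).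
by rewrite ler_expR normrN; exact: hM.
Qed.

Let prof_norm (x : R) : `|profile X x| <= profile X x.
Proof. by rewrite ger0_norm//; exact: ltW (profile_gt0 X x). Qed.

Let du : loc_dominated X T u.
Proof.
have [mp1 mp2 mq1 mq2] := pf_meas flow.
apply: loc_dominatedD; apply: loc_dominatedM.
- exact: loc_bounded_time mp1 (cont_of (pf_p1 flow)).
- exact: loc_dominated_peak (measurable_profile X) prof_norm mq1 (cont_of (pf_q1 flow)).
- exact: loc_bounded_time mp2 (cont_of (pf_p2 flow)).
- exact: loc_dominated_peak (measurable_profile X) prof_norm mq2 (cont_of (pf_q2 flow)).
Qed.

Let dv : loc_dominated X T v.
Proof.
have [mp1 mp2 mq1 mq2] := pf_meas flow.
apply: loc_dominatedD; apply: loc_dominatedM.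
- exact: loc_bounded_time mp1 (cont_of (pf_p1 flow)).
- exact: loc_dominated_peak (measurable_dprofile X) (normr_dprofile_le X) mq1 (cont_of (pf_q1 flow)).
- exact: loc_bounded_time mp2 (cont_of (pf_p2 flow)).
- exact: loc_dominated_peak (measurable_dprofile X) (normr_dprofile_le X) mq2 (cont_of (pf_q2 flow)).
Qed.

Let f0 (x t : R) : R := u x t ^+ 2 * v x t.
Let f1 (x t : R) : R := u x t ^+ 3 + 3 / 2 * u x t * v x t ^+ 2.
Let f2 (x t : R) : R := 1 / 2 * v x t ^+ 3.

Let bu := loc_dominated_bounded du.
Let bv := loc_dominated_bounded dv.

Let df0 : loc_dominated X T f0.
Proof.
have -> : f0 = (fun x t => u x t * (u x t * v x t)).
  by apply/funext => x; apply/funext => t; rewrite /f0 expr2 mulrA.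
by apply: loc_dominatedM bu _; exact: loc_dominatedM bu dv.
Qed.

Let df1 : loc_dominated X T f1.
Proof.
have -> : f1 = (fun x t => u x t * (u x t * u x t) + 3 / 2 * (u x t * (v x t * v x t))).
  by apply/funext => x; apply/funext => t; rewrite /f1; ring.
apply: loc_dominatedD.
  by apply: loc_dominatedM bu _; exact: loc_dominatedM bu du.
apply: loc_dominatedM; first exact: loc_bounded_cst.
by apply: loc_dominatedM bu _; exact: loc_dominatedM bv dv.
Qed.

Let df2 : loc_dominated X T f2.
Proof.
have -> : f2 = (fun x t => 1 / 2 * (v x t * (v x t * v x t))).
  by apply/funext => x; apply/funext => t; rewrite /f2; ring.
apply: loc_dominatedM; first exact: loc_bounded_cst.
by apply: loc_dominatedM bv _; exact: loc_dominatedM bv dv.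
Qed.

Let slice_prod (f : R -> R -> R) (g : R -> R) (t B : R) : 0 < t < T ->
  loc_dominated X T f -> measurable_fun setT g -> (forall x, `|g x| <= B) ->
  mu.-integrable (dom X) (EFin \o (fun x => f x t * g x)).
Proof.
move=> /andP[t0 tT] [m h] mg bg; have [M hM] := h t t t0 tT.
apply: (@integrable_dominated R X _ _ (B * M)) => //.
- exact: measurable_dom.
- by apply: measurable_funM => //; exact: (measurableT_comp m (pair2_measurable t)).
- move=> x _; rewrite mulrC -mulrA; apply: ler_normrM => //.
  by apply: hM; rewrite lexx.
Qed.

Let peak_pairing (t : R) (g : R -> R) (B : R) : measurable_fun setT g ->
  on_domain X g -> (forall x, `|g x| <= B) ->
  \int[mu]_(x in dom X) (u x t * g x) =
  p1 t * \int[mu]_(z in dom X) (profile X z * g (z + q1 t)) +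
  p2 t * \int[mu]_(z in dom X) (profile X z * g (z + q2 t)).
Proof.
move=> mg pg bg; have mD := @measurable_dom R X.
have ii c : mu.-integrable (dom X) (EFin \o (fun x => profile X (x - c) * g x)).
  apply: (@integrable_dominated R X _ _ (B * (cosh pi * expR `|c|))) => //.
    apply: measurable_funM => //.
    by apply: (measurableT_comp (measurable_profile X)); exact: measurable_funB.
  move=> x _; rewrite [_ * g x]mulrC -mulrA; apply: ler_normrM => //.
  apply: le_trans (prof_norm _) _.
  by rewrite -(normrN c); exact: profile_shift.
rewrite -!(profile_shift_prod _ mg pg bg) -!RintegralZl// -RintegralD//.
- by apply: eq_Rintegral => x _; rewrite /u /two_peakon; ring.
- exact: (integrableZl mD (p1 t) (ii (q1 t))).
- exact: (integrableZl mD (p2 t) (ii (q2 t))).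
Qed.

Let dpeak_pairing (t : R) (g : R -> R) (B : R) : measurable_fun setT g ->
  on_domain X g -> (forall x, `|g x| <= B) ->
  \int[mu]_(x in dom X) (v x t * g x) =
  p1 t * \int[mu]_(z in dom X) (dprofile X z * g (z + q1 t)) +
  p2 t * \int[mu]_(z in dom X) (dprofile X z * g (z + q2 t)).
Proof.
move=> mg pg bg; have mD := @measurable_dom R X.
have ii c : mu.-integrable (dom X) (EFin \o (fun x => dprofile X (x - c) * g x)).
  apply: (@integrable_dominated R X _ _ (B * (cosh pi * expR `|c|))) => //.
    apply: measurable_funM => //.
    by apply: (measurableT_comp (measurable_dprofile X)); exact: measurable_funB.
  move=> x _; rewrite [_ * g x]mulrC -mulrA; apply: ler_normrM => //.
  apply: le_trans (normr_dprofile_le _ _) _.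
  by rewrite -(normrN c); exact: profile_shift.
rewrite -!(dprofile_shift_prod _ mg pg bg) -!RintegralZl// -RintegralD//.
- by apply: eq_Rintegral => x _; rewrite /v /dpk2; ring.
- exact: (integrableZl mD (p1 t) (ii (q1 t))).
- exact: (integrableZl mD (p2 t) (ii (q2 t))).
Qed.

Let weak_dx_u : weak_dx X T u v.
Proof.
split; [exact: loc_bounded_L1loc bu|exact: loc_bounded_L1loc bv|].
move=> phi tf; have tfx := test_function_dx tf.
have w0 := test_function_weak T0 tf; have wx := test_function_weak T0 tfx.
have [_ ->] := pairing_iterated bu wx; have [iv ->] := pairing_iterated bv w0.
rewrite -mulN1r -RintegralZl//; apply: eq_Rintegral => t _.
have t1 := test_function_test1 t tf; have t2 := test_function_test1 t tfx.
have [B b] := wt_bound w0; have [B' b'] := wt_bound wx.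
rewrite (peak_pairing t (test1_measurable t2) (test1_per t2) (fun x => b' x t)).
rewrite (dpeak_pairing t (test1_measurable t1) (test1_per t1) (fun x => b x t)).
by rewrite !(by_parts_profile _ t1); ring.
Qed.

(** With psi the resolvent of phi, [conv_pairing] moves both nonlocal terms onto psi, and phi = psi
    - psi'' in the local term makes the sum the integral of [flux_density]. The values 2 A psi(q_j)
    and 2 A psi'(q_j) left by [flux_balance] are turned back into integrals of the profile against
    phi and phi_x, the shape in which [transport_pairing] gives the moving peaks. *)
Let flux_pairing (t : R) (phi : R^o * R^o -> R) : 0 < t < T -> test_function X T phi ->
  \int[mu]_(x in dom X) (f0 x t * phi (x, t))
  - \int[mu]_(x in dom X) (conv X f1 x t * dx phi (x, t))
  + \int[mu]_(x in dom X) (conv X f2 x t * phi (x, t)) =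
  - (p1 t * (U1 t ^+ 2 * \int[mu]_(z in dom X) (profile X z * dx phi (z + q1 t, t))
      + U1 t * V1 t * \int[mu]_(z in dom X) (profile X z * phi (z + q1 t, t)))
   + p2 t * (U2 t ^+ 2 * \int[mu]_(z in dom X) (profile X z * dx phi (z + q2 t, t))
      - U2 t * V2 t * \int[mu]_(z in dom X) (profile X z * phi (z + q2 t, t)))).
Proof.
move=> ht tf; have tfx := test_function_dx tf; have tfxx := test_function_dx tfx.
have w0 := test_function_weak T0 tf; have wx := test_function_weak T0 tfx.
have t1 := test_function_test1 t tf; have t2 := test_function_test1 t tfx.
have t3 := test_function_test1 t tfxx.
rewrite (conv_pairing ht df1 wx) (conv_pairing ht df2 w0).
set psi := resolvent X (fun x => phi (x, t)).
set psi1 := resolvent X (fun x => dx phi (x, t)).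
pose psi2 := resolvent X (fun x => dx (dx phi) (x, t)).
have r1 : test1 X psi psi1 := test1_resolvent t1 t2.
have r2 : test1 X psi1 psi2 := test1_resolvent t2 t3.
have mD := @measurable_dom R X.
have [B b] := wt_bound w0.
have i0 := slice_prod ht df0 (test1_measurable t1) (fun x => b x t).
have [_ _ _ [B1 b1]] := r1.
have i1 := slice_prod ht df1 (test1_measurable r2) (fun x => (b1 x).2).
have i2 := slice_prod ht df2 (test1_measurable r1) (fun x => (b1 x).1).
have ib := RintegralB mD i0 i1.
have id := RintegralD mD (integrableB mD i0 i1) i2.
rewrite -ib; rewrite -id.
have [gap0 gap2] := pf_gap flow ht.
have fb := flux_balance (p1 t) (p2 t) gap0 gap2 r1 r2.
transitivity (\int[mu]_(x in dom X) flux_density (pk2 X (p1 t) (p2 t) (q1 t) (q2 t) x)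
    (dpk2 X (p1 t) (p2 t) (q1 t) (q2 t) x) (psi x) (psi1 x) (psi2 x)).
  apply: eq_Rintegral => x _.
  have ep : phi (x, t) = psi x - psi2 x := esym (resolvent_green x t1 t2).
  change (f0 x t * phi (x, t) - f1 x t * psi1 x + f2 x t * psi x =
    flux_density (u x t) (v x t) (psi x) (psi1 x) (psi2 x)).
  rewrite ep /flux_density /f0 /f1 /f2; move: (u x t) (v x t) (psi x) (psi1 x) (psi2 x).
  by move=> *; field.
have A0 : 2 * peakA X != 0 :> R by apply: mulf_neq0 => //; exact: lt0r_neq0 (peakA_gt0 X).
have e y : 2 * peakA X * psi y = \int[mu]_(z in dom X) (profile X z * phi (z + y, t)).
  by rewrite /psi /resolvent mulVKf.
have e1 y : 2 * peakA X * psi1 y = \int[mu]_(z in dom X) (profile X z * dx phi (z + y, t)).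
  by rewrite /psi1 /resolvent mulVKf.
rewrite fb -!e -!e1 /U1 /U2 /V1 /V2 /peak_value /peak_slope.
move: (psi (q1 t)) (psi (q2 t)) (psi1 (q1 t)) (psi1 (q2 t)) (peakG X 0)
  (peakG X (q2 t - q1 t)) (peakS X (q2 t - q1 t)) (peakA X) (p1 t) (p2 t).
by clear; move=> *; ring.
Qed.

(** The coefficients are frozen: at time t the density involves only their values at t, so the
    identity applies by conversion to time-dependent p, dp, q, dq. *)
Let transport_pairing (t p dp q dq : R) (phi : R^o * R^o -> R) : test_function X T phi ->
  \int[mu]_(z in dom X) (profile X z *
     transport_density (fun _ => p) (fun _ => dp) (fun _ => q) (fun _ => dq) phi z t) =
  dp * \int[mu]_(z in dom X) (profile X z * phi (z + q, t)) +
  p * (dq * \int[mu]_(z in dom X) (profile X z * dx phi (z + q, t)) +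
       \int[mu]_(z in dom X) (profile X z * dt phi (z + q, t))).
Proof.
move=> tf; have tfx := test_function_dx tf; have tft := test_function_dt tf.
have mD := @measurable_dom R X.
have ii (f : R^o * R^o -> R) : test_function X T f ->
    mu.-integrable (dom X) (EFin \o (fun z => profile X z * f (z + q, t))).
  move=> tff; have [B b] := wt_bound (test_function_weak T0 tff).
  apply: (@integrable_profileM _ _ _ B); last by move=> z; exact: b.
  exact: test1_measurable (test1_shift q (test_function_test1 t tff)).
have h0 := ii _ tf; have h1 := ii _ tfx; have h2 := ii _ tft.
have e0 := RintegralZl dp mD h0; have e1 := RintegralZl dq mD h1.
have k0 := integrableZl mD dp h0; have k1 := integrableZl mD dq h1.
have e2 := RintegralD mD k1 h2.
have k2 := integrableD mD k1 h2.
have e3 := RintegralZl p mD k2; have k3 := integrableZl mD p k2.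
have e4 := RintegralD mD k0 k3.
rewrite -e0 -e1 -e2 -e3 -e4; apply: eq_Rintegral => z _.
by rewrite /transport_density; ring.
Qed.

Theorem novikov_peakon_flow : Novikov X T u.
Proof.
exists v, (conv X f1), (conv X f2); split.
- exact: weak_dx_u.
- exact: loc_bounded_L1loc (loc_dominated_bounded df0).
- exact: conv_is_Dm2 T0 df1.
- exact: conv_is_Dm2 T0 df2.
move=> phi tf; have tfx := test_function_dx tf; have tft := test_function_dt tf.
have w0 := test_function_weak T0 tf; have wx := test_function_weak T0 tfx.
have wt := test_function_weak T0 tft.
have [mp1 mp2 mq1 mq2] := pf_meas flow.
have cp1 := cont_of (pf_p1 flow); have cp2 := cont_of (pf_p2 flow).
have cq1 := cont_of (pf_q1 flow); have cq2 := cont_of (pf_q2 flow).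
have cst_c (r t : R) : {for t, continuous (fun _ : R => r)} by exact: cvg_cst.
have mq : measurable_fun setT (fun t => q2 t - q1 t) by exact: measurable_funB.
have cq t : 0 < t < T -> {for t, continuous (fun t => q2 t - q1 t)}.
  by move=> ht; apply: cvgB; [exact: cq2|exact: cq1].
have mG : measurable_fun setT (fun t => peakG X (q2 t - q1 t)).
  by apply: (measurableT_comp _ mq); apply: continuous_measurable_fun; exact: continuous_peakG.
have mS : measurable_fun setT (fun t => peakS X (q2 t - q1 t)).
  by apply: (measurableT_comp _ mq); apply: continuous_measurable_fun; exact: continuous_peakS.
have cG t : 0 < t < T -> {for t, continuous (fun t => peakG X (q2 t - q1 t))}.
  by move=> ht; apply: (continuous_comp (cq t ht)); exact: continuous_peakG.
have cS t : 0 < t < T -> {for t, continuous (fun t => peakS X (q2 t - q1 t))}.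
  by move=> ht; apply: (continuous_comp (cq t ht)); exact: continuous_peakS.
have mU1 : measurable_fun setT U1 by apply: measurable_funD; apply: measurable_funM.
have mU2 : measurable_fun setT U2 by apply: measurable_funD; apply: measurable_funM.
have mV1 : measurable_fun setT V1 by apply: measurable_funM.
have mV2 : measurable_fun setT V2 by apply: measurable_funM.
have cU1 t : 0 < t < T -> {for t, continuous U1}.
  by move=> ht; apply: cvgD; apply: cvgM; [exact: cp1|exact: cst_c|exact: cp2|exact: cG].
have cU2 t : 0 < t < T -> {for t, continuous U2}.
  by move=> ht; apply: cvgD; apply: cvgM; [exact: cp2|exact: cst_c|exact: cp1|exact: cG].
have cV1 t : 0 < t < T -> {for t, continuous V1}.
  by move=> ht; apply: cvgM; [exact: cp2|exact: cS].
have cV2 t : 0 < t < T -> {for t, continuous V2}.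
  by move=> ht; apply: cvgM; [exact: cp1|exact: cS].
pose dp1 t := p1 t * U1 t * V1 t; pose dp2 t := - (p2 t * U2 t * V2 t).
pose dq1 t := U1 t ^+ 2; pose dq2 t := U2 t ^+ 2.
have mdp1 : measurable_fun setT dp1 by do 2 apply: measurable_funM => //.
have mdp2 : measurable_fun setT dp2.
  have mdp2' : measurable_fun setT (fun t => p2 t * U2 t * V2 t) by do 2 apply: measurable_funM => //.
  by apply: (measurableT_comp _ mdp2'); exact: oppr_measurable.
have mdq1 : measurable_fun setT dq1 by exact: measurable_funX.
have mdq2 : measurable_fun setT dq2 by exact: measurable_funX.
have cdp1 t : 0 < t < T -> {for t, continuous dp1}.
  by move=> ht; apply: cvgM; [apply: cvgM; [exact: cp1|exact: cU1]|exact: cV1].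
have cdp2 t : 0 < t < T -> {for t, continuous dp2}.
  by move=> ht; apply: cvgN; apply: cvgM; [apply: cvgM; [exact: cp2|exact: cU2]|exact: cV2].
have cdq1 t : 0 < t < T -> {for t, continuous dq1}.
  move=> ht; have -> : dq1 = (fun t => U1 t * U1 t) by apply/funext => r; rewrite /dq1 expr2.
  by apply: cvgM; exact: cU1.
have cdq2 t : 0 < t < T -> {for t, continuous dq2}.
  move=> ht; have -> : dq2 = (fun t => U2 t * U2 t) by apply/funext => r; rewrite /dq2 expr2.
  by apply: cvgM; exact: cU2.
have [j1 z1] := transport_null T0 mp1 mq1 mdp1 mdq1 (pf_p1 flow) (pf_q1 flow) cdp1 cdq1 tf.
have [j2 z2] := transport_null T0 mp2 mq2 mdp2 mdq2 (pf_p2 flow) (pf_q2 flow) cdp2 cdq2 tf.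
have [iA ->] := pairing_iterated bu wt.
have [iB ->] := pairing_iterated (loc_dominated_bounded df0) w0.
have [iC ->] := pairing_iterated (conv_loc_bounded df1) wx.
have [iE ->] := pairing_iterated (conv_loc_bounded df2) w0.
have mI : measurable (`]0, T[ : set (measurableTypeR R)) by exact: measurable_itv.
have s1 := RintegralB mI iB iC; have k1 := integrableB mI iB iC.
have s2 := RintegralD mI k1 iE; have k2 := integrableD mI k1 iE.
have s3 := RintegralB mI k2 iA; have k3 := integrableB mI k2 iA.
have s4 := RintegralD mI j1 j2.
(* At each t the weak form equals minus the time derivative of the two moving peaks tested against
   phi. The equations for q_j match the phi_x terms, those for p_j the phi terms; then
   [transport_null] makes the time integral vanish. *)
have key : \int[mu]_(t in `]0, T[)
    (\int[mu]_(x in dom X) (f0 x t * phi (x, t))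
     - \int[mu]_(x in dom X) (conv X f1 x t * dx phi (x, t))
     + \int[mu]_(x in dom X) (conv X f2 x t * phi (x, t))
     - \int[mu]_(x in dom X) (u x t * dt phi (x, t))) =
  - \int[mu]_(t in `]0, T[)
     (\int[mu]_(z in dom X) (profile X z * transport_density p1 dp1 q1 dq1 phi z t)
      + \int[mu]_(z in dom X) (profile X z * transport_density p2 dp2 q2 dq2 phi z t)).
  rewrite -mulN1r -RintegralZl//; last exact: (integrableD mI j1 j2).
  apply: eq_Rintegral => t; rewrite inE/= in_itv/= => ht.
  rewrite (flux_pairing ht tf).
  have [B b] := wt_bound wt.
  have t1 := test_function_test1 t tft.
  rewrite (peak_pairing t (test1_measurable t1) (test1_per t1) (fun x => b x t)).
  have -> : \int[mu]_(z in dom X) (profile X z * transport_density p1 dp1 q1 dq1 phi z t) =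
     dp1 t * \int[mu]_(z in dom X) (profile X z * phi (z + q1 t, t)) +
     p1 t * (dq1 t * \int[mu]_(z in dom X) (profile X z * dx phi (z + q1 t, t)) +
       \int[mu]_(z in dom X) (profile X z * dt phi (z + q1 t, t))) :=
    transport_pairing t (p1 t) (dp1 t) (q1 t) (dq1 t) tf.
  have -> : \int[mu]_(z in dom X) (profile X z * transport_density p2 dp2 q2 dq2 phi z t) =
     dp2 t * \int[mu]_(z in dom X) (profile X z * phi (z + q2 t, t)) +
     p2 t * (dq2 t * \int[mu]_(z in dom X) (profile X z * dx phi (z + q2 t, t)) +
       \int[mu]_(z in dom X) (profile X z * dt phi (z + q2 t, t))) :=
    transport_pairing t (p2 t) (dp2 t) (q2 t) (dq2 t) tf.
  have alg (a' b' v1 v2 w1 w2 P1 X1 D1 P2 X2 D2 : R) :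
      - (a' * (v1 ^+ 2 * X1 + v1 * w1 * P1) + b' * (v2 ^+ 2 * X2 - v2 * w2 * P2))
        - (a' * D1 + b' * D2) =
      - 1 * (a' * v1 * w1 * P1 + a' * (v1 ^+ 2 * X1 + D1)
             + (- (b' * v2 * w2) * P2 + b' * (v2 ^+ 2 * X2 + D2))) by ring.
  exact: alg.
have alg (a b c e x y z : R) : x = b - c -> y = x + e -> z = y - a -> z = 0 ->
  - a + b - c + e = 0 by move=> -> -> -> <-; ring.
have h4 := etrans s4 (etrans (f_equal2 +%R z1 z2) (addr0 0)).
have h5 := f_equal (@GRing.opp R) h4; rewrite oppr0 in h5.
apply: (alg _ _ _ _ _ _ _ s1 s2 s3).
exact: etrans key h5.
Qed.

End Flow.
End NovikovPeakons.

(** * Sobolev norms of combinations of profiles *)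

Section FrequencySum.
Context {R : realType}.
Implicit Types (F G : R -> R) (X : spatial_domain).
Local Notation mu := (@lebesgue_measure R).
Local Open Scope ereal_scope.

(** The integral over real frequencies and the sum over integer ones under a single name, so that
    estimates are stated once for both domains. *)
Definition frequency_sum X F : \bar R :=
  match X with
  | Line => \int[mu]_k (F k)%:E
  | Circle => \esum_(n in [set: int]) (F n%:~R)%:E
  end.

Lemma frequency_sum_ge0 X F : (forall k : R, (0 <= F k)%R) ->
  0 <= frequency_sum X F.
Proof.
by move=> F0; case: X => /=; [apply: integral_ge0|apply: esum_ge0] => *;
  rewrite lee_fin.
Qed.

Lemma le_frequency_sum X F G : (forall k : R, (0 <= F k <= G k)%R) ->
  measurable_fun setT F -> measurable_fun setT G ->
  frequency_sum X F <= frequency_sum X G.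
Proof.
move=> FG mF mG; case: X => /=; last first.
  by apply: le_esum => n _; rewrite lee_fin; case/andP: (FG n%:~R).
apply: ge0_le_integral => //.
- by move=> k _; rewrite lee_fin; case/andP: (FG k).
- exact/measurable_EFinP.
- exact/measurable_EFinP.
- by move=> k _; rewrite lee_fin; case/andP: (FG k).
Qed.

Lemma frequency_sumD X F G : (forall k : R, (0 <= F k)%R) ->
  (forall k : R, (0 <= G k)%R) ->
  measurable_fun setT F -> measurable_fun setT G ->
  frequency_sum X (fun k => F k + G k)%R = frequency_sum X F + frequency_sum X G.
Proof.
move=> F0 G0 mF mG; case: X => /=; last first.
  by rewrite -esumD => [|n _|n _]; rewrite ?lee_fin.
rewrite -ge0_integralD //.
- by move=> k _; rewrite lee_fin.
- exact/measurable_EFinP.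
- by move=> k _; rewrite lee_fin.
- exact/measurable_EFinP.
Qed.

Lemma esum_int (a : int -> \bar R) : (forall n, 0 <= a n) ->
  \esum_(n in [set: int]) a n =
  \sum_(n <oo) a (Posz n) + \sum_(n <oo) a (Negz n).
Proof.
move=> a0; rewrite (esumID (range Posz)) //.
rewrite !setTI; congr (_ + _).
  by rewrite nneseries_esumT ?esum_image // => m n _ _ [].
rewrite (_ : ~` range Posz = range Negz) ?nneseries_esumT ?esum_image //.
  by move=> m n _ _ [].
apply/seteqP; split => [[n|n]|n [m _ <-]] //=.
- by move=> nP; exfalso; apply: nP; exists n.
- by move=> _; exists n.
- by case.
Qed.

Lemma frequency_sumZ X (r : R) F : (0 <= r)%R -> (forall k : R, (0 <= F k)%R) ->
  measurable_fun setT F ->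
  frequency_sum X (fun k => r * F k)%R = r%:E * frequency_sum X F.
Proof.
move=> r0 F0 mF; case: X => /=.
  rewrite -ge0_integralZl //.
  - exact/measurable_EFinP.
  - by move=> k _; rewrite lee_fin.
rewrite !esum_int; try by move=> n; rewrite lee_fin ?mulr_ge0.
rewrite ge0_muleDr; try by apply: nneseries_ge0 => *; rewrite lee_fin.
by rewrite -!nneseriesZl //; do ?by move=> *; rewrite lee_fin.
Qed.

(** Integral comparison: F (n + 1) is at most the integral of F over [n, n + 1), and evenness
    doubles the tail. *)
Lemma frequency_sum_Circle_le F : (forall k : R, (0 <= F k)%R) ->
  (forall k : R, F (- k)%R = F k) ->
  (forall k l : R, (0 <= k <= l)%R -> (F l <= F k)%R) ->
  measurable_fun setT F ->
  frequency_sum Circle F <=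
  (F 0)%:E + 2%:E * \int[mu]_(k in `[0%R, +oo[) (F k)%:E.
Proof.
move=> F0 evenF antiF mF /=.
have mFE : measurable_fun setT (EFin \o F) by exact/measurable_EFinP.
rewrite esum_int; last by move=> n; rewrite lee_fin.
have tail : \sum_(n <oo) (F n.+1%:R)%:E <= \int[mu]_(k in `[0%R, +oo[) (F k)%:E.
  pose A (n : nat) : set R := `[n%:R, n.+1%:R[%classic.
  have mA n : measurable (A n) by exact: measurable_itv.
  have trA : trivIset setT A.
    move=> m n _ _ [x []]; rewrite /A /= !in_itv /= => /andP[mx xm] /andP[nx xn].
    have : (m < n.+1)%N by rewrite -(ltr_nat R); exact: le_lt_trans xn.
    have : (n < m.+1)%N by rewrite -(ltr_nat R); exact: le_lt_trans xm.
    by rewrite !ltnS => nm nm'; apply/eqP; rewrite eqn_leq nm nm'.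
  apply: (@le_trans _ _ (\sum_(n <oo) \int[mu]_(k in A n) (F k)%:E)).
    apply: lee_nneseries => [n _ _|n _]; first by rewrite lee_fin.
    rewrite -[leLHS]mule1.
    have muA : mu (A n) = 1.
      rewrite /A lebesgue_measure_itv /= lte_fin ltr_nat ltnSn -EFinB.
      by rewrite -natrB // subSnn.
    rewrite -muA -(@integral_cst _ _ R mu _ (mA n)).
    apply: (@ge0_le_integral _ _ R mu (A n) (mA n)) => //.
    - by move=> *; rewrite lee_fin.
    - by apply: measurable_funTS.
    - move=> x; rewrite /A /= in_itv /= => /andP[nx xn].
      by rewrite lee_fin antiF // (le_trans _ nx) //= ltW.
  rewrite -ge0_integral_bigcup //; first last.
  - by move=> x _; rewrite lee_fin.
  - exact: (measurable_funS measurableT (@subsetT _ _) mFE).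
  apply: ge0_subset_integral => //.
  - exact: bigcupT_measurable.
  - exact: (measurable_funS measurableT (@subsetT _ _) mFE).
  - by move=> x _; rewrite lee_fin.
  - move=> x [n _]; rewrite /A /= !in_itv /= andbT => /andP[nx _].
    by apply: le_trans nx; rewrite ler0n.
have -> : \sum_(n <oo) (F (Negz n)%:~R)%:E = \sum_(n <oo) (F n.+1%:R)%:E.
  by apply: eq_eseriesr => n _; rewrite NegzE mulrNz evenF.
rewrite nneseries_recl //; last by move=> n _; rewrite lee_fin.
rewrite -[X in _ + X + _](nneseries_addn 1%N (f := fun n => (F n%:R)%:E)); last by move=> n; rewrite lee_fin.
under eq_eseriesr do rewrite addn1.
rewrite -addeA; apply: leeD; first by [].
rewrite (_ : 2%:E = 1 + 1) // ge0_muleDl // mul1e; apply: leeD => //.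
Qed.

Definition sobolev_weight (r k : R) : R := ((1 + k ^+ 2) `^ r)%R.

Lemma sobolev_weight_gt0 (r k : R) : (0 < sobolev_weight r k)%R.
Proof. by rewrite powR_gt0 // ltr_pwDl ?sqr_ge0. Qed.

Lemma measurable_sobolev_weight (r : R) :
  measurable_fun setT (sobolev_weight r).
Proof.
apply: (measurableT_comp (measurable_powR r)).
by apply: measurable_funD => //; exact: measurable_funX.
Qed.

Lemma continuous_sobolev_weight (r : R) : continuous (sobolev_weight r).
Proof.
move=> k; apply: (@continuous_comp _ _ _ (fun k : R => 1 + k ^+ 2)%R (fun x : R => x `^ r)%R).
  apply: cvgD; first exact: cvg_cst.
  exact: exprn_continuous.
have k0 : (0 < 1 + k ^+ 2)%R by rewrite ltr_pwDl ?sqr_ge0.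
by apply: differentiable_continuous; apply/derivable1_diffP; apply: derivable_powR; rewrite in_itv /= andbT.
Qed.

Lemma cvg_powRN_pinfty (b : R) : (0 < b)%R ->
  ((x : R) `^ (- b))%R @[x --> +oo%R] --> (0 : R)%R.
Proof.
move=> b0; apply/cvgr0Pnorm_lt => e e0; near=> x.
have xe : ((e^-1 `^ b^-1) < x)%R by near: x; exact: nbhs_pinfty_gt.
have x0 : (0 < x)%R by apply: le_lt_trans xe; exact: powR_ge0.
rewrite ger0_norm ?powR_ge0 // powRN invf_plt ?posrE ?powR_gt0 //.
rewrite -[ltLHS](@powRr1 _ e^-1%R) ?invr_ge0 ?ltW //.
rewrite -(@mulVf _ b) ?gt_eqF // powRrM.
by apply: gt0_ltr_powR => //; rewrite nnegrE ?powR_ge0 ?ltW.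
Unshelve. all: by end_near. Qed.

(** From (1 + k)^2 <= 2 (1 + k^2) the weight is at most 2^r (1 + k)^{-2 r}, whose explicit primitive
    tends to 0 at infinity when 2 r > 1. *)
Lemma integral_sobolev_weight (r : R) : (1 / 2 < r)%R ->
  \int[mu]_(k in `[0%R, +oo[) (sobolev_weight (- r) k)%:E < +oo.
Proof.
move=> r2.
pose g (k : R) := ((1 + k) `^ (- (2 * r)))%R.
pose G (k : R) := ((1 - 2 * r)^-1 * (1 + k) `^ (1 - 2 * r))%R.
have r0 : (0 < r)%R by lra.
have s1 : (1 - 2 * r != 0)%R by lra.
have dpow (b k : R) : (-1 < k)%R -> is_derive k 1%R
    (fun k : R => (1 + k) `^ b)%R (b * (1 + k) `^ (b - 1))%R.
  move=> k1; have k0 : (0 < 1 + k)%R by lra.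
  have h1 : is_derive (1 + k : R)%R 1%R (fun x : R => x `^ b)%R
      (b * (1 + k) `^ (b - 1))%R by exact: is_derive1_powR.
  have h2 : is_derive k 1%R (fun k : R => 1 + k)%R (0 + 1 : R)%R by exact: is_deriveD.
  rewrite add0r in h2.
  have h3 := is_derive1_comp h1 h2.
  by rewrite mulr1 in h3.
have dG (k : R) : (-1 < k)%R -> is_derive k 1%R G (g k).
  move=> k1; have h3 := dpow (1 - 2 * r)%R _ k1.
  rewrite /G; apply: is_derive_eq.
  rewrite /GRing.scale /= /g.
  rewrite (_ : (1 - 2 * r - 1 = - (2 * r))%R); last ring.
  by rewrite mulrA mulVf // mul1r.
have cvg1 (f : R -> R) (k l : R) : is_derive k 1%R f l -> {for k, continuous f}.
  by move=> [df _]; apply: differentiable_continuous; apply/derivable1_diffP.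
have gle (k : R) : (0 <= k)%R -> (sobolev_weight (- r) k <= 2 `^ r * g k)%R.
  move=> k0; rewrite /sobolev_weight /g !powRN powRrM powR_mulrn; last lra.
  have k1 : (0 < (1 + k) ^+ 2)%R by rewrite exprn_gt0 //; lra.
  have k2 : (0 < 1 + k ^+ 2)%R by rewrite ltr_pwDl ?sqr_ge0.
  rewrite -[leLHS]mul1r ler_pdivrMr ?powR_gt0 // mulrAC ler_pdivlMr ?powR_gt0 //.
  rewrite mul1r -(powRM _ (ler0n _ 2) (ltW k2)).
  apply: ge0_ler_powR; [exact: ltW|exact: ltW| |].
    by rewrite nnegrE mulr_ge0 // ltW.
  have := sqr_ge0 (1 - k)%R; rewrite !expr2; lra.
have intg : \int[mu]_(k in `[0%R, +oo[) (g k)%:E < +oo.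
  rewrite (@ge0_continuous_FTC2y _ g G 0%R 0%R) ?ltry //.
  - by move=> k _; rewrite powR_ge0.
  - apply: continuous_in_subspaceT => k; rewrite inE /= in_itv /= andbT => k0.
    by apply: cvg1; apply: dpow; lra.
  - rewrite -(mulr0 (1 - 2 * r)^-1%R); apply: cvgM; first exact: cvg_cst.
    have -> : (1 - 2 * r = - (2 * r - 1))%R by ring.
    apply: (cvg_comp _ (fun x : R => x `^ - (2 * r - 1))%R (G := pinfty_nbhs R)).
      apply/cvgryPge => M; near=> x.
      by apply: (@le_trans _ _ x); [near: x; exact: nbhs_pinfty_ge (num_real M)|lra].
    by apply: cvg_powRN_pinfty; lra.
  - by move=> k k0; have [] := dG k ltac:(lra).
  - have d0 := dG 0%R ltac:(lra); have := cvg1 _ _ _ d0.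
    by move=> /cvg_at_right_filter.
  - move=> k; rewrite in_itv /= andbT => k0; rewrite derive1E.
    by have [] := dG k ltac:(lra).
have mg : measurable_fun setT g.
  apply: (measurableT_comp (measurable_powR _)).
  exact: measurable_funD.
apply: (@le_lt_trans _ _ (\int[mu]_(k in `[0%R, +oo[) ((2 `^ r)%:E * (g k)%:E))).
  apply: ge0_le_integral => //.
  - by move=> k _; rewrite lee_fin ltW // sobolev_weight_gt0.
  - apply/measurable_EFinP; apply: measurable_funTS.
    exact: measurable_sobolev_weight.
  - apply: measurable_funTS; apply/measurable_EFinP.
    by apply: measurable_funM.
  - move=> k /=; rewrite in_itv /= andbT => k0.
    by rewrite -EFinM lee_fin gle.
rewrite ge0_integralZl //.
- by rewrite lte_mul_pinfty // lee_fin powR_ge0.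
- by apply: measurable_funTS; exact/measurable_EFinP.
- by move=> k _; rewrite lee_fin powR_ge0.
Unshelve. all: by end_near. Qed.

Lemma frequency_sum_sobolev_weight X (r : R) : (1 / 2 < r)%R ->
  frequency_sum X (sobolev_weight (- r)) < +oo.
Proof.
move=> r2; have r0 : (0 < r)%R by lra.
have even (k : R) : sobolev_weight (- r) (- k)%R = sobolev_weight (- r) k.
  by rewrite /sobolev_weight sqrrN.
have fin := integral_sobolev_weight r2.
case: X.
  rewrite /frequency_sum ge0_symfun_integralT.
  - rewrite -set_itvcy; apply: lte_mul_pinfty => //.
  - by move=> k; rewrite ltW // sobolev_weight_gt0.
  - exact: continuous_sobolev_weight.
  - by move=> k /=; rewrite even.
apply: le_lt_trans (frequency_sum_Circle_le _ even _ _) _.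
- by move=> k; rewrite ltW // sobolev_weight_gt0.
- move=> k l /andP[k0 kl]; rewrite /sobolev_weight !powRN.
  have k2 : (0 < 1 + k ^+ 2)%R by rewrite ltr_pwDl ?sqr_ge0.
  have l2 : (0 < 1 + l ^+ 2)%R by rewrite ltr_pwDl ?sqr_ge0.
  rewrite ler_pV2 ?inE ?unitf_gt0 ?powR_gt0 //.
  apply: ge0_ler_powR; [exact: ltW|exact: ltW|exact: ltW|].
  by rewrite lerD2l lerXn2r ?nnegrE // (le_trans k0).
- exact: measurable_sobolev_weight.
- by rewrite lte_add_pinfty ?ltry // lte_mul_pinfty.
Qed.

(** The octave [1 / h, 2 / h] has length 1 / h and contains at least 1 / (2 h) integers, so both
    domains give a lower bound of the same order. *)
Lemma frequency_sum_octave X (h : R) F : (0 < h <= 1)%R ->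
  (forall k : R, (0 <= F k)%R) -> measurable_fun setT F ->
  (forall k : R, (1 <= h * k <= 2)%R -> (1 <= F k)%R) ->
  ((2 * h)^-1)%:E <= frequency_sum X F.
Proof.
move=> /andP[h0 h1] F0 mF F1; case: X => /=.
  apply: (@le_trans _ _ (\int[mu]_(k in `[h^-1%R, (2 / h)%R]) (F k)%:E)); last first.
    apply: ge0_subset_integral => //; first exact/measurable_EFinP.
    by move=> k _; rewrite lee_fin.
  apply: (@le_trans _ _ (\int[mu]_(k in `[h^-1%R, (2 / h)%R]) (cst 1 k))).
    rewrite integral_cst //= mul1e lebesgue_measure_itv /= lte_fin ltr_pMl ?invr_gt0 //.
    rewrite ltr1n -EFinB lee_fin invfM.
    have := ltW h0; rewrite -invr_ge0; set x := h^-1%R; lra.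
  apply: ge0_le_integral => //.
    by apply: measurable_funTS; exact/measurable_EFinP.
  move=> k /=; rewrite in_itv /= => /andP[k1 k2]; rewrite lee_fin F1 //.
  by rewrite mulrC -ler_pdivrMr // div1r k1 -ler_pdivlMr.
rewrite esum_int; last by move=> n; rewrite lee_fin.
apply: (@le_trans _ _ (\sum_(n <oo) (F n%:R)%:E)); last first.
  by rewrite leeDl //; apply: nneseries_ge0 => *; rewrite lee_fin.
(* The integers N + 1, ..., 2 N lie in the octave, and N >= 1 / (2 h) because 1 / h < N + 1 <= 2
   N. *)
pose N := Num.truncn (h^-1)%R.
have hV1 : (1 <= h^-1)%R by rewrite invf_ge1.
have /andP[N1 N2] : (N%:R <= h^-1 < N.+1%:R)%R by apply: truncn_itv; rewrite invr_ge0 ltW.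
have N0 : (0 < N)%N by rewrite truncn_gt0.
apply: (@le_trans _ _ (\sum_(N.+1 <= n < N.+1 + N) (F n%:R)%:E)); last first.
  apply: (@le_trans _ _ (\sum_(0 <= n < N.+1 + N) (F n%:R)%:E)).
    rewrite [leRHS](@big_cat_nat _ _ _ N.+1) //= ?leq_addr //.
    by rewrite leeDr // sume_ge0 // => *; rewrite lee_fin.
  by apply: nneseries_lim_ge => *; rewrite lee_fin.
apply: (@le_trans _ _ (\sum_(N.+1 <= n < N.+1 + N) 1%:E)).
  rewrite sumEFin lee_fin big_const_nat addKn iter_addr_0.
  rewrite invfM ler_pdivrMl // -mulr_natr mul1r.
  have : (N.+1 <= 2 * N)%N by lia.
  rewrite -(ler_nat R) natrM => N3; apply: le_trans N3; exact: ltW.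
rewrite [leLHS]big_nat_cond [leRHS]big_nat_cond; apply: lee_sum => n.
rewrite andbT => /andP[n1 n2]; rewrite lee_fin F1 //.
rewrite mulrC -ler_pdivrMr // div1r -ler_pdivlMr //; apply/andP; split.
  by rewrite (le_trans (ltW N2)) // ler_nat.
have n3 : (n <= 2 * N)%N by lia.
rewrite -(ler_nat R) natrM in n3.
by apply: le_trans n3 _; rewrite ler_pM2l.
Qed.
End FrequencySum.

(** * Fourier transforms of finite combinations of profiles *)

Section Combs.
Context {R : realType}.
Implicit Types (X : spatial_domain) (l : seq (R * R)) (b k s : R).
Local Notation mu := (@lebesgue_measure R).

Definition comb X l (x : R) := \sum_(ab <- l) ab.1 * profile X (x - ab.2).

Definition comb_cos l k := \sum_(ab <- l) ab.1 * cos (k * ab.2).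

Definition comb_sin l k := \sum_(ab <- l) ab.1 * sin (k * ab.2).

(** The squared modulus of the exponential sum with terms a e^{-i k b}. *)
Definition comb_sq l k := comb_cos l k ^+ 2 + comb_sin l k ^+ 2.

(** The squared H^s norm without its factor (2 A)^2: the squared transform of the profile, (2 A)^2 /
    (1 + k^2)^2, lowers the exponent s of the weight to s - 2. *)
Definition comb_energy X s l : \bar R :=
  frequency_sum X (fun k => sobolev_weight (s - 2) k * comb_sq l k).

(** The k for which cos (k x) and sin (k x) are functions on the domain. *)
Definition frequency X k := if X is Circle then exists n : int, k = n%:~R else True.

Lemma measurable_comb X l : measurable_fun setT (comb X l).
Proof.
apply: measurable_sum => ab; apply: measurable_funM => //.
apply: (measurableT_comp (@measurable_profile R X)).
exact: measurable_funB.
Qed.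

Lemma comb_bound X l : exists M, forall x, `|comb X l x| <= M * profile X x.
Proof.
elim: l => [|[a b] l [M IH]].
  by exists 0 => x; rewrite /comb big_nil normr0 mul0r.
exists (`|a| * (cosh pi * expR `|- b|) + M) => x.
rewrite /comb big_cons mulrDl; apply: le_trans (ler_normD _ _) _.
apply: lerD; last exact: IH.
rewrite normrM -mulrA ler_wpM2l // ger0_norm; last exact: ltW (profile_gt0 _ _).
exact: profile_shift.
Qed.

Lemma integrable_comb X l : mu.-integrable (dom X) (EFin \o comb X l).
Proof.
have [M bM] := comb_bound X l.
apply: (@integrable_dominated R X _ _ M) => //; first exact: measurable_dom.
exact: measurable_comb.
Qed.

Lemma integrable_combM X l (f : R -> R) (B : R) : measurable_fun setT f ->
  (forall x, `|f x| <= B) ->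
  mu.-integrable (dom X) (EFin \o (fun x => comb X l x * f x)).
Proof.
move=> mf bf; have [M bM] := comb_bound X l.
apply: (@integrable_dominated R X _ _ (M * B)) => //.
- exact: measurable_dom.
- by apply: measurable_funM => //; exact: measurable_comb.
- by move=> x _; rewrite normrM mulrAC ler_pM.
Qed.

Lemma on_domain_comb X l : on_domain X (comb X l).
Proof.
case: X => //= x; rewrite /comb; apply: eq_bigr => ab _.
by rewrite (_ : x + 2 * pi - ab.2 = x - ab.2 + 2 * pi) ?periodic_profile //; ring.
Qed.

Lemma test1_cos X k : frequency X k ->
  test1 X (fun x : R => cos (k * x)) (fun x => - (k * sin (k * x))) /\
  test1 X (fun x : R => sin (k * x)) (fun x => k * cos (k * x)).
Proof.
move=> fk.
have dk (x : R) : is_derive x 1 ( *%R k) k.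
  by apply: is_derive_eq; rewrite /GRing.scale /= mulr1.
have dc (x : R) : is_derive x 1 (fun x : R => cos (k * x)) (- (k * sin (k * x))).
  have h := is_derive1_comp (is_derive_cos (k * x)) (dk x).
  by rewrite mulNr mulrC in h.
have ds (x : R) : is_derive x 1 (fun x : R => sin (k * x)) (k * cos (k * x)).
  have h := is_derive1_comp (is_derive_sin (k * x)) (dk x).
  by rewrite mulrC in h.
have pc : on_domain X (fun x : R => cos (k * x)) /\
          on_domain X (fun x : R => sin (k * x)).
  case: X fk => //= -[n ->].
  have c2 : Defs.periodic (@cos R) by move=> x; rewrite mulr_natl cosD2pi.
  have s2 : Defs.periodic (@sin R) by move=> x; rewrite mulr_natl sinD2pi.
  split=> x; rewrite mulrDr [X in _ + X]mulrC.
    by rewrite (periodicz _ _ c2).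
  by rewrite (periodicz _ _ s2).
have cc : continuous (fun x : R => cos (k * x)) by move=> x; exact: is_derive1_continuous (dc x).
have cs : continuous (fun x : R => sin (k * x)) by move=> x; exact: is_derive1_continuous (ds x).
have bk (u : R) : `|u| <= 1 -> `|k * u| <= 1 + `|k|.
  by move=> u1; rewrite normrM ler_wpDl // ler_piMr.
have b1 (u : R) : `|u| <= 1 -> `|u| <= 1 + `|k|.
  by move=> u1; rewrite (le_trans u1) // lerDl.
split; split => //.
- move=> x; apply: cvgN; apply: cvgM; [exact: cvg_cst|exact: cs].
- by case: pc.
- by exists (1 + `|k|) => x; rewrite normrN; split; [apply: b1; exact: cos_max|apply: bk; exact: sin_max].
- move=> x; apply: cvgM; [exact: cvg_cst|exact: cc].
- by case: pc.
- by exists (1 + `|k|) => x; split; [apply: b1; exact: sin_max|apply: bk; exact: cos_max].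
Qed.

(** The Green identity applied to an eigenfunction: f - f'' = (1 + k^2) f. No explicit integral of
    the profile is computed. *)
Lemma fourier_profile X b k (f f1 : R -> R) : test1 X f f1 ->
  test1 X f1 (fun x => - (k ^+ 2 * f x)) ->
  \int[mu]_(x in dom X) (profile X (x - b) * f x) =
  2 * peakA X / (1 + k ^+ 2) * f b.
Proof.
move=> t t'; have := green_profile b t t'.
have k2 : 1 + k ^+ 2 != 0 by rewrite gt_eqF // ltr_pwDl ?sqr_ge0.
have [_ _ pf [B bB]] := t.
have mf := test1_measurable t.
rewrite (profile_shift_prod b mf pf (fun x => (bB x).1)) => e.
apply: (mulfI k2); rewrite -RintegralZl.
- rewrite mulrA (mulrC (1 + _)) divfK // -e.
  by apply: eq_Rintegral => x _; rewrite opprK; ring.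
- exact: measurable_dom.
- apply: (@integrable_profileM R X (fun x => f (x + b)) B).
    by apply: (measurableT_comp mf); exact: measurable_funD.
  by move=> x; case: (bB (x + b)).
Qed.

Lemma fourier_comb X l k (f f1 : R -> R) : test1 X f f1 ->
  test1 X f1 (fun x => - (k ^+ 2 * f x)) ->
  \int[mu]_(x in dom X) (comb X l x * f x) =
  2 * peakA X / (1 + k ^+ 2) * \sum_(ab <- l) ab.1 * f ab.2.
Proof.
move=> t t'; have [_ _ pf [B bB]] := t; have mf := test1_measurable t.
have bf x : `|f x| <= B by case: (bB x).
elim: l => [|[a b] l IH].
  rewrite big_nil mulr0; under eq_Rintegral do rewrite /comb big_nil mul0r.
  by rewrite Rintegral_cst ?mul0r //; exact: measurable_dom.
rewrite big_cons mulrDr -IH.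
have i1 : mu.-integrable (dom X) (EFin \o (fun x => profile X (x - b) * f x)).
  have := integrable_combM X [:: (1, b)] mf bf.
  by under eq_fun do rewrite /= /comb big_seq1 mul1r.
transitivity (\int[mu]_(x in dom X) (a * (profile X (x - b) * f x) + comb X l x * f x)).
  by apply: eq_Rintegral => x _; rewrite /comb big_cons mulrDl -mulrA.
rewrite RintegralD.
- by rewrite RintegralZl // ?(fourier_profile _ t t') /=; [ring|exact: measurable_dom].
- exact: measurable_dom.
- have := integrableZl (measurable_dom X) a i1.
  by apply: eq_integrable => //; exact: measurable_dom.
- exact: integrable_combM mf bf.
Qed.

Lemma fourier_sq_comb X l k : frequency X k ->
  fourier_sq X (comb X l) k = (2 * peakA X / (1 + k ^+ 2)) ^+ 2 * comb_sq l k.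
Proof.
move=> /test1_cos[tc ts].
have tc' : test1 X (fun x => - (k * sin (k * x))) (fun x => - (k ^+ 2 * cos (k * x))).
  have [d c p [B bB]] := ts; split.
  - move=> x; have d1 := d x; apply: is_derive_eq; rewrite /GRing.scale /= expr2.
    by move: (cos _) => c'; ring.
  - move=> x; apply: cvgN; apply: cvgM; first exact: cvg_cst.
    by have [d' _ _ _] := tc; exact: is_derive1_continuous (d' x).
  - by case: X {ts tc} p => //= p x; rewrite p.
  - exists (`|k| * B + B * `|k|) => x; have [b1 b2] := bB x.
    have B0 : 0 <= B by apply: le_trans b1.
    rewrite !normrN !normrM; split.
      by rewrite ler_wpDr ?mulr_ge0 // ler_wpM2l.
    by rewrite ler_wpDr ?mulr_ge0 // -mulrA ler_wpM2l // -normrM.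
have ts' : test1 X (fun x => k * cos (k * x)) (fun x => - (k ^+ 2 * sin (k * x))).
  have [d c p [B bB]] := tc; split.
  - move=> x; have d1 := d x; apply: is_derive_eq; rewrite /GRing.scale /= expr2.
    by move: (sin _) => c'; ring.
  - move=> x; apply: cvgN; apply: cvgM; first exact: cvg_cst.
    by have [d' _ _ _] := ts; exact: is_derive1_continuous (d' x).
  - by case: X {ts tc tc'} p => //= p x; rewrite p.
  - exists (`|k| * B + B * `|k|) => x; have [b1 b2] := bB x.
    have B0 : 0 <= B by apply: le_trans b1.
    rewrite !normrN !normrM; split.
      by rewrite ler_wpDr ?mulr_ge0 // ler_wpM2l.
    by rewrite ler_wpDr ?mulr_ge0 // -mulrA ler_wpM2l // -normrM -(normrN (_ * _)).
rewrite /fourier_sq (fourier_comb l tc tc') (fourier_comb l ts ts').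
by rewrite !exprMn -mulrDr.
Qed.

Lemma comb_sq_ge0 l k : 0 <= comb_sq l k.
Proof. by rewrite addr_ge0 ?sqr_ge0. Qed.

Lemma spectrum_ge0 s l k : 0 <= sobolev_weight (s - 2) k * comb_sq l k.
Proof. by rewrite mulr_ge0 ?comb_sq_ge0 // ltW // sobolev_weight_gt0. Qed.

Lemma measurable_spectrum s l :
  measurable_fun setT (fun k => sobolev_weight (s - 2) k * comb_sq l k).
Proof.
apply: measurable_funM; first exact: measurable_sobolev_weight.
have mk (c : R) : measurable_fun setT (fun k : R => k * c) by exact: measurable_funM.
apply: measurable_funD; apply: measurable_funX; apply: measurable_sum => ab;
  apply: measurable_funM => //.
- exact: (measurableT_comp (continuous_measurable_fun (@continuous_cos R))).
- exact: (measurableT_comp (continuous_measurable_fun (@continuous_sin R))).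
Qed.

Lemma Hs_sq_comb X s l :
  Hs_sq X s (comb X l) = (((2 * peakA X) ^+ 2)%:E * comb_energy X s l)%E.
Proof.
have e k : frequency X k ->
    (1 + k ^+ 2) `^ s * fourier_sq X (comb X l) k =
    (2 * peakA X) ^+ 2 * (sobolev_weight (s - 2) k * comb_sq l k).
  move=> fk; rewrite fourier_sq_comb // /sobolev_weight.
  have k2 : 0 < 1 + k ^+ 2 by rewrite ltr_pwDl ?sqr_ge0.
  rewrite powRB; last by rewrite (gt_eqF k2) implybT.
  rewrite (powR_mulrn 2 (ltW k2)).
  by move: (comb_sq l k) (_ `^ s) => c p; field; rewrite gt_eqF.
rewrite -frequency_sumZ ?sqr_ge0 //; last 2 first.
- exact: spectrum_ge0.
- exact: measurable_spectrum.
case: X e => e /=.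
  by apply: eq_integral => k _; rewrite e.
by apply: eq_esum => n _; rewrite e //=; exists n.
Qed.

(** The exponential sum is bounded, and the weight (1 + k^2)^{s - 2} is summable exactly because 2 -
    s > 1 / 2; this is the origin of the threshold 3 / 2. *)
Lemma comb_energy_fin X s l : s < 3 / 2 -> (comb_energy X s l < +oo)%E.
Proof.
move=> s32; pose M := \sum_(ab <- l) `|ab.1|.
have M0 : 0 <= M by exact: sumr_ge0.
have bsum (f : R -> R) : (forall u, `|f u| <= 1) -> forall k,
    (\sum_(ab <- l) ab.1 * f (k * ab.2)) ^+ 2 <= M ^+ 2.
  move=> f1 k; rewrite -[leLHS]real_normK ?num_real // lerXn2r ?nnegrE //.
  apply: le_trans (ler_norm_sum _ _ _) _; apply: ler_sum => ab _.
  by rewrite normrM ler_piMr.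
have bc := bsum _ (@cos_max R); have bs := bsum _ (@sin_max R).
apply: (@le_lt_trans _ _ (frequency_sum X
    (fun k => (2 * M ^+ 2) * sobolev_weight (- (2 - s)) k))).
  apply: le_frequency_sum.
  - move=> k; rewrite spectrum_ge0 /= opprB mulrC.
    rewrite ler_wpM2r //; first exact: ltW (sobolev_weight_gt0 _ _).
    rewrite (_ : 2 * M ^+ 2 = M ^+ 2 + M ^+ 2); last by ring.
    exact: lerD (bc k) (bs k).
  - exact: measurable_spectrum.
  - by apply: measurable_funM => //; exact: measurable_sobolev_weight.
rewrite frequency_sumZ ?mulr_ge0 ?sqr_ge0 //.
- by rewrite lte_mul_pinfty ?lee_fin ?mulr_ge0 ?sqr_ge0 // frequency_sum_sobolev_weight //; lra.
- by move=> k; rewrite ltW // sobolev_weight_gt0.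
- exact: measurable_sobolev_weight.
Qed.

Lemma comb_energy_ge0 X s l : (0 <= comb_energy X s l)%E.
Proof. by apply: frequency_sum_ge0 => k; exact: spectrum_ge0. Qed.

Lemma in_Hs_comb X s l : s < 3 / 2 -> in_Hs X s (comb X l).
Proof.
move=> s32; split; [exact: on_domain_comb|exact: integrable_comb|].
by rewrite Hs_sq_comb lte_mul_pinfty ?lee_fin ?sqr_ge0 // comb_energy_fin.
Qed.

Lemma Hs_norm_comb X s l : s < 3 / 2 ->
  Hs_norm X s (comb X l) = 2 * peakA X * Num.sqrt (fine (comb_energy X s l)).
Proof.
move=> s32; rewrite /Hs_norm Hs_sq_comb fineM //.
  rewrite /= sqrtrM ?sqr_ge0 // sqrtr_sqr ger0_norm // mulr_ge0 //.
  by rewrite ltW // peakA_gt0.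
by rewrite ge0_fin_numE ?comb_energy_ge0 // comb_energy_fin.
Qed.

End Combs.

(** * The norm on combinations of profiles and the size of translation differences *)

Section CombNorm.
Context {R : realType}.
Implicit Types (X : spatial_domain) (l : seq (R * R)) (b k s : R) (f g : R -> R).
Local Notation mu := (@lebesgue_measure R).

(** The vector space on which the norm calculus is developed: it contains all 2-peakons, antipeakons
    and their differences, and its elements have explicit Fourier transforms. *)
Definition is_comb X f := exists l, f = comb X l.

Lemma is_combD X f g : is_comb X f -> is_comb X g ->
  is_comb X (fun x => f x + g x).
Proof.
move=> [l ->] [m ->]; exists (l ++ m); apply/funext => x.
by rewrite /comb big_cat.
Qed.

Lemma is_combZ X (c : R) f : is_comb X f -> is_comb X (fun x => c * f x).
Proof.
move=> [l ->]; exists [seq (c * ab.1, ab.2) | ab <- l]; apply/funext => x.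
by rewrite /comb big_map mulr_sumr; apply: eq_bigr => ab _; rewrite mulrA.
Qed.

Lemma is_comb_profile X b : is_comb X (fun x => profile X (x - b)).
Proof.
by exists [:: (1, b)]; apply/funext => x; rewrite /comb big_seq1 mul1r.
Qed.

Lemma in_Hs_is_comb X s f : s < 3 / 2 -> is_comb X f -> in_Hs X s f.
Proof. by move=> s32 [l ->]; exact: in_Hs_comb. Qed.

Lemma Hs_normZ X s (c : R) f : s < 3 / 2 -> is_comb X f ->
  Hs_norm X s (fun x => c * f x) = `|c| * Hs_norm X s f.
Proof.
move=> s32 [l ->].
have -> : (fun x => c * comb X l x) = comb X [seq (c * ab.1, ab.2) | ab <- l].
  apply/funext => x; rewrite /comb big_map mulr_sumr.
  by apply: eq_bigr => ab _; rewrite mulrA.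
rewrite !Hs_norm_comb // mulrCA; congr (_ * _).
rewrite /comb_energy.
have -> : (fun k => sobolev_weight (s - 2) k *
      comb_sq [seq (c * ab.1, ab.2) | ab <- l] k) =
    (fun k => c ^+ 2 * (sobolev_weight (s - 2) k * comb_sq l k)).
  apply/funext => k; rewrite mulrCA; congr (_ * _).
  rewrite /comb_sq mulrDr -!exprMn /comb_cos /comb_sin !big_map !mulr_sumr.
  by congr (_ ^+ 2 + _ ^+ 2); apply: eq_bigr => ab _; rewrite mulrA.
rewrite frequency_sumZ ?sqr_ge0 //.
- rewrite fineM //; last first.
    by rewrite ge0_fin_numE ?comb_energy_ge0 // comb_energy_fin.
  by rewrite /= sqrtrM ?sqr_ge0 // sqrtr_sqr.
- exact: spectrum_ge0.
- exact: measurable_spectrum.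
Qed.

(** The triangle inequality in a form linear in the squared norms, which passes through frequency
    sums term by term and replaces an appeal to Cauchy-Schwarz. *)
Lemma sqrtr_young (A B C : R) : 0 <= A -> 0 <= B ->
  (forall eta, 0 < eta -> C <= (1 + eta) * A + (1 + eta^-1) * B) ->
  Num.sqrt C <= Num.sqrt A + Num.sqrt B.
Proof.
move=> A0 B0 H.
have := sqrtr_ge0 A; have := sqrtr_ge0 B.
have := sqr_sqrtr A0; have := sqr_sqrtr B0.
set x := Num.sqrt A; set y := Num.sqrt B => yB xA y0 x0.
rewrite -[leRHS]ger0_norm ?addr_ge0 // -sqrtr_sqr ler_sqrt ?sqr_ge0 //.
suff H' (d : R) : 0 < d -> C <= (x + y) ^+ 2 + d * (x + y).
  apply/ler_addgt0Pr => e e0.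
  have xy : 0 < x + y + 1 by rewrite ltr_wpDl ?addr_ge0.
  apply: le_trans (H' (e / (x + y + 1)) _) _; first exact: divr_gt0.
  rewrite lerD2l mulrAC ler_pdivrMr // ler_pM2l //; lra.
move=> d0.
have xd : 0 < x + d by rewrite ltr_wpDl.
have yd : 0 < y + d by rewrite ltr_wpDl.
(* The optimal eta is y / x; the positive d keeps it defined and positive when x or y vanishes. *)
apply: le_trans (H ((y + d) / (x + d)) _) _; first exact: divr_gt0.
rewrite invf_div -xA -yB.
have h1 : (y + d) / (x + d) * x ^+ 2 <= (y + d) * x.
  rewrite mulrAC ler_pdivrMr // -mulrA ler_pM2l // expr2 ler_wpM2l //; lra.
have h2 : (x + d) / (y + d) * y ^+ 2 <= (x + d) * y.
  rewrite mulrAC ler_pdivrMr // -mulrA ler_pM2l // expr2 ler_wpM2l //; lra.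
move: h1 h2; set u := _ / _; set v := _ / _; rewrite !mulrDl !mul1r !expr2.
move: (u * _) (v * _) => p q; clear; lra.
Qed.

(** The pointwise Young inequality for the exponential sums is summed over the frequencies, and
    [sqrtr_young] optimises eta afterwards. *)
Lemma Hs_normD X s f g : s < 3 / 2 -> is_comb X f -> is_comb X g ->
  Hs_norm X s (fun x => f x + g x) <= Hs_norm X s f + Hs_norm X s g.
Proof.
move=> s32 [l ->] [m ->].
have -> : (fun x => comb X l x + comb X m x) = comb X (l ++ m).
  by apply/funext => x; rewrite /comb big_cat.
rewrite !Hs_norm_comb // -mulrDr ler_wpM2l ?mulr_ge0 //.
  exact: ltW (peakA_gt0 _).
have fin l' : (comb_energy X s l' \is a fin_num)%E.
  by rewrite ge0_fin_numE ?comb_energy_ge0 // comb_energy_fin.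
apply: sqrtr_young; do ?by rewrite fine_ge0 // comb_energy_ge0.
move=> eta e0; have eV0 : 0 < eta^-1 by rewrite invr_gt0.
have e1 : 0 <= 1 + eta by rewrite addr_ge0 // ltW.
have e2 : 0 <= 1 + eta^-1 by rewrite addr_ge0 // ltW.
rewrite -lee_fin fineK // EFinD !EFinM !fineK // -!frequency_sumZ //;
  do ?[exact: spectrum_ge0|exact: measurable_spectrum].
have m1 c l' : measurable_fun setT
    (fun k => c * (sobolev_weight (s - 2) k * comb_sq l' k)).
  by apply: measurable_funM => //; exact: measurable_spectrum.
rewrite -frequency_sumD; do ?by [move=> k; rewrite mulr_ge0 // spectrum_ge0|exact: m1].
apply: le_frequency_sum; last by apply: measurable_funD; exact: m1.
  2: exact: measurable_spectrum.
move=> k; rewrite spectrum_ge0 /= mulrCA (mulrCA (1 + eta^-1)) -mulrDr.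
rewrite ler_wpM2l //; first exact: ltW (sobolev_weight_gt0 _ _).
rewrite /comb_sq /comb_cos /comb_sin !big_cat /=.
have young (a b : R) : (a + b) ^+ 2 <= (1 + eta) * a ^+ 2 + (1 + eta^-1) * b ^+ 2.
  have e : (1 + eta) * a ^+ 2 + (1 + eta^-1) * b ^+ 2 - (a + b) ^+ 2 =
      eta^-1 * (eta * a - b) ^+ 2 by field; rewrite gt_eqF.
  by rewrite -subr_ge0 e mulr_ge0 ?sqr_ge0 // ltW.
move: (\sum_(_ <- l) _) (\sum_(_ <- l) _) (\sum_(_ <- m) _) (\sum_(_ <- m) _) => a1 a2 b1 b2.
apply: le_trans (lerD (young _ _) (young _ _)) _.
by rewrite le_eqVlt; apply/orP; left; apply/eqP; ring.
Qed.

Lemma Hs_norm_dist X s f g : s < 3 / 2 -> is_comb X f -> is_comb X g ->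
  `|Hs_norm X s f - Hs_norm X s g| <= Hs_norm X s (fun x => f x - g x).
Proof.
move=> s32 cf cg.
have cN h : is_comb X h -> is_comb X (fun x => - h x).
  move=> ch; rewrite (_ : (fun x => _) = (fun x => -1 * h x)).
    exact: is_combZ.
  by apply/funext => x; rewrite mulN1r.
have nN h : is_comb X h -> Hs_norm X s (fun x => - h x) = Hs_norm X s h.
  move=> ch; rewrite -[RHS]mul1r -(normr1 R) -normrN -Hs_normZ //.
  by congr Hs_norm; apply/funext => x; rewrite mulN1r.
have cfg := is_combD cf (cN _ cg).
rewrite ler_norml; apply/andP; split.
  rewrite lerNl opprB lerBlDr -(nN _ cfg).
  have := Hs_normD s32 (cN _ cfg) cf.
  by under eq_fun do rewrite opprB subrK.
rewrite lerBlDr; have := Hs_normD s32 cfg cg.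
by under eq_fun do rewrite subrK.
Qed.

Definition profile_norm X s : R := Hs_norm X s (profile X).

(** A translation changes only the phase of the Fourier transform. *)
Lemma Hs_norm_profile X s b : s < 3 / 2 ->
  Hs_norm X s (fun x => profile X (x - b)) = profile_norm X s.
Proof.
move=> s32; rewrite /profile_norm.
have e c : (fun x => profile X (x - c)) = comb X [:: (1, c)].
  by apply/funext => x; rewrite /comb big_seq1 mul1r.
have e0 : (profile X : R -> R) = comb X [:: (1, 0)].
  by apply/funext => x; rewrite /comb big_seq1 mul1r subr0.
rewrite e e0 !Hs_norm_comb // /comb_energy.
suff h c : (comb_sq [:: (1, c)] : R -> R) = (fun=> 1) by rewrite !h.
apply/funext => k; rewrite /comb_sq /comb_cos /comb_sin !big_seq1 !mul1r.
exact: cos2Dsin2.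
Qed.

(** On the octave 1 <= h k <= 2 with h <= 1 one has h^2 (1 + k^2) <= 5, so the weight is at least
    5^{s - 2} h^{4 - 2 s}; at least 1 / (2 h) frequencies contribute, which leaves the exponent 3 -
    2 s. *)
Lemma comb_energy_octave X s l (h c : R) : s < 3 / 2 -> 0 < h <= 1 -> 0 < c ->
  (forall k, 1 <= h * k <= 2 -> c <= comb_sq l k) ->
  ((c * 5 `^ (s - 2) / 2 * h `^ (3 - 2 * s))%:E <= comb_energy X s l)%E.
Proof.
move=> s32 /andP[h0 h1] c0 Hc; pose m := c * 5 `^ (s - 2) * h `^ (4 - 2 * s).
have m0 : 0 < m by rewrite !mulr_gt0 ?powR_gt0.
have -> : comb_energy X s l = (m%:E * frequency_sum X
    (fun k => m^-1 * (sobolev_weight (s - 2) k * comb_sq l k))%R)%E.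
  rewrite -frequency_sumZ ?(ltW m0) //.
  - by congr frequency_sum; apply/funext => k; rewrite mulrA divff ?gt_eqF // mul1r.
  - by move=> k; rewrite mulr_ge0 ?spectrum_ge0 // invr_ge0 ltW.
  - by apply: measurable_funM => //; exact: measurable_spectrum.
have -> : c * 5 `^ (s - 2) / 2 * h `^ (3 - 2 * s) = m * (2 * h)^-1.
  rewrite /m (_ : 4 - 2 * s = (3 - 2 * s) + 1); last by ring.
  rewrite (@powRD _ h (3 - 2 * s) 1); last by rewrite (gt_eqF h0) implybT.
  rewrite powRr1; last exact: ltW.
  by move: (_ `^ _) (_ `^ _) => p q; field; rewrite gt_eqF.
rewrite EFinM lee_pmul2l ?lte_fin //.
apply: frequency_sum_octave; first by rewrite h0.
- by move=> k; rewrite mulr_ge0 ?spectrum_ge0 // invr_ge0 ltW.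
- by apply: measurable_funM => //; exact: measurable_spectrum.
move=> k hk; rewrite ler_pdivlMl // mulr1 /m -mulrA mulrC.
have hk2 : 0 < 1 + k ^+ 2 by rewrite ltr_pwDl ?sqr_ge0.
apply: ler_pM; [by rewrite mulr_ge0 ?powR_ge0|exact: ltW| |exact: Hc].
rewrite /sobolev_weight -opprB !powRN (_ : 4 - 2 * s = 2 * (2 - s)); last by ring.
rewrite powRrM powR_mulrn; last exact: ltW.
rewrite mulrC ler_pdivrMr ?powR_gt0 // ler_pdivlMl ?powR_gt0 // -powRM; last 2 first.
- exact: ltW.
- by rewrite exprn_ge0 // ltW.
apply: ge0_ler_powR; rewrite ?nnegrE.
- lra.
- by rewrite mulr_ge0 ?sqr_ge0 // ltW.
- by [].
case/andP: hk => k1 k2; rewrite mulrDl mul1r -exprMn (mulrC k).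
have : h ^+ 2 <= 1 by rewrite expr_le1 // ltW.
have : (h * k) ^+ 2 <= 2 ^+ 2 by rewrite lerXn2r ?nnegrE //; lra.
move: (h * k) => z; rewrite !expr2; lra.
Qed.

Lemma profile_norm_gt0 X s : s < 3 / 2 -> 0 < profile_norm X s.
Proof.
move=> s32; rewrite -(Hs_norm_profile X 0 s32).
have -> : ((fun x => profile X (x - 0)) : R -> R) = comb X [:: (1, 0)].
  by apply/funext => x; rewrite /comb big_seq1 mul1r.
rewrite Hs_norm_comb // !mulr_gt0 ?peakA_gt0 // sqrtr_gt0.
rewrite -lte_fin fineK; last first.
  by rewrite ge0_fin_numE ?comb_energy_ge0 // comb_energy_fin.
apply: lt_le_trans (@comb_energy_octave X s _ 1 1 s32 _ _ _) => //.
- by rewrite lte_fin !mulr_gt0 ?powR_gt0.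
- by rewrite ltr01 lexx.
- move=> k _; rewrite /comb_sq /comb_cos /comb_sin !big_seq1 !mul1r.
  by rewrite cos2Dsin2.
Qed.

Definition profile_dist X s (b b' : R) : R :=
  Hs_norm X s (fun x => profile X (x - b) - profile X (x - b')).

Let dist_comb X (b b' : R) :
  (fun x => profile X (x - b) - profile X (x - b')) = comb X [:: (1, b); (-1, b')].
Proof.
by apply/funext => x; rewrite /comb big_cons big_seq1 /= mul1r mulN1r.
Qed.

Lemma is_comb_dist X b b' : is_comb X (fun x => profile X (x - b) - profile X (x - b')).
Proof. by rewrite dist_comb; exists [:: (1, b); (-1, b')]. Qed.

Lemma comb_sq_dist (b b' k : R) :
  comb_sq [:: (1, b); (-1, b')] k = 2 * (1 - cos (k * (b - b'))).
Proof.
rewrite /comb_sq /comb_cos /comb_sin !big_cons !big_nil /= !addr0 !mul1r !mulN1r.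
rewrite (mulrBr k) cosB.
have := cos2Dsin2 (k * b); have := cos2Dsin2 (k * b').
move: (cos (k * b)) (cos (k * b')) (sin (k * b)) (sin (k * b')) => c1 c2 s1 s2.
by rewrite !expr2 => h1 h2; lra.
Qed.

Lemma ler_sin_norm (x : R) : `|sin x| <= `|x|.
Proof.
wlog x0 : x / 0 <= x => [hw|].
  have [/hw//|/ltW x0] := leP 0 x.
  by have := hw (- x); rewrite sinN !normrN oppr_ge0; exact.
have [c _] := @MVT_segment R sin cos 0 x x0 (fun y _ => is_derive_sin y)
  (continuous_subspaceT (@continuous_sin R)).
rewrite sin0 !subr0 => ->.
by rewrite normrM ler_piMl ?cos_max.
Qed.

(** Interpolation between the bounds 4 and x^2: the first is used for x^2 >= 1, the second for x^2 <
    1, where x^2 <= (x^2)^theta. *)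
Lemma versine_le (theta x : R) : 0 < theta <= 1 ->
  2 * (1 - cos x) <= 4 * (x ^+ 2) `^ theta.
Proof.
move=> /andP[t0 t1].
have [x1|x1] := leP 1 (x ^+ 2).
  have : 1 <= (x ^+ 2) `^ theta.
    by rewrite -[leLHS](powRr0 (x ^+ 2)) ler_powR // ltW.
  have := cos_geN1 x; lra.
have x2 : 2 * (1 - cos x) <= x ^+ 2.
  have -> : cos x = 1 - 2 * sin (x / 2) ^+ 2.
    have -> : x = (x / 2) *+ 2 by rewrite mulr2n; field.
    rewrite cos_mulr2n cos2sin2 mulr2n.
    have -> : (x / 2) *+ 2 / 2 = x / 2 by rewrite mulr2n; field.
    by rewrite !expr2; ring.
  have := ler_sin_norm (x / 2); rewrite -(@ler_pXn2r _ 2) ?nnegrE //.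
  by rewrite !real_normK ?num_real // !expr2; lra.
have : x ^+ 2 <= (x ^+ 2) `^ theta.
  have [->|xn] := eqVneq (x ^+ 2) 0; first exact: powR_ge0.
  have xp : 0 < x ^+ 2 by rewrite lt_neqAle eq_sym xn sqr_ge0.
  by apply: ger1_powR => //; rewrite xp ltW.
have := powR_ge0 (x ^+ 2) theta; lra.
Qed.

(** Translation is Hoelder continuous of exponent theta in H^s: [versine_le] costs a factor (1 +
    k^2)^theta, and the remaining weight is still summable because theta < 3 / 2 - s. *)
Lemma profile_dist_le X s theta : 0 < theta <= 1 -> theta < 3 / 2 - s ->
  exists2 K, 0 <= K & forall b b', profile_dist X s b b' <= K * `|b - b'| `^ theta.
Proof.
move=> t01 ts; have [t0 t1] := andP t01.
have s32 : s < 3 / 2 by lra.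
pose E := frequency_sum X (sobolev_weight (- (2 - s - theta))).
have Efin : (E < +oo)%E by apply: frequency_sum_sobolev_weight; lra.
have E0 : (0 <= E)%E by apply: frequency_sum_ge0 => k; exact: ltW (sobolev_weight_gt0 _ _).
have Ef : E \is a fin_num by rewrite ge0_fin_numE.
exists (2 * peakA X * (2 * Num.sqrt (fine E))).
  by rewrite !mulr_ge0 ?sqrtr_ge0 //; exact: ltW (peakA_gt0 _).
move=> b b'; rewrite /profile_dist dist_comb Hs_norm_comb // -[leRHS]mulrA.
rewrite ler_wpM2l ?mulr_ge0 //; first exact: ltW (peakA_gt0 _).
set h := b - b'.
have -> : 2 * Num.sqrt (fine E) * `|h| `^ theta =
    Num.sqrt ((4 * (h ^+ 2) `^ theta) * fine E).
  have e4 : Num.sqrt 4 = 2 :> R.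
    by rewrite (_ : 4 = 2 ^+ 2) ?sqrtr_sqr ?ger0_norm // expr2; ring.
  have eh : Num.sqrt ((h ^+ 2) `^ theta) = `|h| `^ theta.
    have -> : h ^+ 2 = `|h| `^ 2.
      by rewrite (powR_mulrn 2 (normr_ge0 h)) real_normK ?num_real.
    rewrite powRAC (powR_mulrn 2 (powR_ge0 _ _)) sqrtr_sqr.
    exact: ger0_norm (powR_ge0 _ _).
  by rewrite sqrtrM ?mulr_ge0 ?powR_ge0 // sqrtrM // e4 eh mulrAC.
rewrite ler_sqrt ?mulr_ge0 ?powR_ge0 ?fine_ge0 //.
rewrite -lee_fin EFinM !fineK //; last first.
  by rewrite ge0_fin_numE ?comb_energy_ge0 // comb_energy_fin.
rewrite -frequency_sumZ ?mulr_ge0 ?powR_ge0 //; first last.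
- exact: measurable_sobolev_weight.
- by move=> k; exact: ltW (sobolev_weight_gt0 _ _).
apply: le_frequency_sum.
- move=> k; rewrite spectrum_ge0 /= comb_sq_dist.
  have k2 : 0 < 1 + k ^+ 2 by rewrite ltr_pwDl ?sqr_ge0.
  apply: (@le_trans _ _ (sobolev_weight (s - 2) k * (4 * ((1 + k ^+ 2) `^ theta * (h ^+ 2) `^ theta)))).
    rewrite ler_wpM2l //; first exact: ltW (sobolev_weight_gt0 _ _).
    apply: le_trans (versine_le _ t01) _; rewrite ler_wpM2l //.
    rewrite -powRM ?sqr_ge0 //; last exact: ltW.
    apply: ge0_ler_powR; rewrite ?nnegrE ?sqr_ge0 //.
    + exact: ltW.
    + by rewrite mulr_ge0 ?sqr_ge0 // ltW.
    + by rewrite exprMn ler_wpM2r ?sqr_ge0 // lerDr.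
  rewrite /sobolev_weight (_ : - (2 - s - theta) = (s - 2) + theta); last by ring.
  rewrite (@powRD _ _ (s - 2) theta); last by rewrite (gt_eqF k2) implybT.
  by rewrite le_eqVlt; apply/orP; left; apply/eqP; ring.
- exact: measurable_spectrum.
- by apply: measurable_funM => //; exact: measurable_sobolev_weight.
Qed.

(** The lower bound has the critical exponent 3 / 2 - s. It uses only the frequencies with 1 <= k
    (b' - b) <= 2, where 1 - cos is at least 1 - cos 1, as cos decreases on [0, pi]. *)
Lemma profile_dist_ge X s : s < 3 / 2 ->
  exists2 c, 0 < c & forall b b', 0 < b' - b <= 1 ->
    c * (b' - b) `^ (3 / 2 - s) <= profile_dist X s b b'.
Proof.
move=> s32; pose m := 2 * (1 - cos 1) * 5 `^ (s - 2) / 2 : R.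
have cos1 : cos 1 < 1 :> R.
  rewrite -[ltRHS]cos0 ltr_cos ?in_itv /= ?lexx ?pi_ge0 //.
  by have := @pi_ge2 R; lra.
have m0 : 0 < m by rewrite /m !mulr_gt0 ?powR_gt0 // subr_gt0.
exists (2 * peakA X * Num.sqrt m).
  by rewrite !mulr_gt0 ?peakA_gt0 // sqrtr_gt0.
move=> b b' h01; have [h0 h1] := andP h01.
rewrite /profile_dist dist_comb Hs_norm_comb // -[leLHS]mulrA.
rewrite ler_wpM2l ?mulr_ge0 //; first exact: ltW (peakA_gt0 _).
have -> : Num.sqrt m * (b' - b) `^ (3 / 2 - s) = Num.sqrt (m * (b' - b) `^ (3 - 2 * s)).
  rewrite (sqrtrM _ (ltW m0)).
  congr (_ * _); rewrite (_ : 3 - 2 * s = (3 / 2 - s) * 2); last by field.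
  by rewrite powRrM powR_mulrn ?powR_ge0 // sqrtr_sqr ger0_norm // powR_ge0.
rewrite ler_sqrt ?fine_ge0 ?comb_energy_ge0 //.
rewrite -lee_fin fineK; last first.
  by rewrite ge0_fin_numE ?comb_energy_ge0 // comb_energy_fin.
apply: comb_energy_octave => //; first by rewrite mulr_gt0 // subr_gt0.
move=> k /andP[hk1 hk2]; rewrite comb_sq_dist ler_pM2l // lerD2l lerN2.
rewrite -cosN -mulrN opprB mulrC; have p2 := @pi_ge2 R.
by rewrite leNgt ltr_cos ?in_itv /= -?leNgt //; lra.
Qed.

End CombNorm.

(** * The collision dynamics *)

Section Jets.
Context {R : realType}.
Implicit Types (X : spatial_domain) (f g : R -> R) (U : set R).

(** Differentiability n times on U with the successive derivatives supplied as functions; sums and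
    products are then handled by induction, without formulas for higher derivatives. *)
Fixpoint jet U n f : Prop :=
  if n is n'.+1 then
    exists f', (forall t : R, U t -> is_derive t 1 f (f' t)) /\ jet U n' f'
  else True.

Lemma jetW U n f : jet U n.+1 f -> jet U n f.
Proof.
by elim: n f => [//|n IH] f [f' [df jf]]; exists f'; split => //; exact: IH.
Qed.

Lemma jetD U n f g : jet U n f -> jet U n g -> jet U n (fun t => f t + g t).
Proof.
elim: n f g => [//|n IH] f g [f' [df jf]] [g' [dg jg]].
exists (fun t => f' t + g' t); split; last exact: IH.
by move=> t Ut; have := df t Ut; have := dg t Ut => ? ?; exact: is_deriveD.
Qed.

Lemma jetM U n f g : jet U n f -> jet U n g -> jet U n (fun t => f t * g t).
Proof.
elim: n f g => [//|n IH] f g jf jg.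
have [f' [df jf']] := jf; have [g' [dg jg']] := jg.
exists (fun t => f t * g' t + g t * f' t); split.
  by move=> t Ut; have := df t Ut; have := dg t Ut => ? ?; exact: is_deriveM.
by apply: jetD; apply: IH => //; exact: jetW.
Qed.

Lemma jet_cst U n (c : R) : jet U n (fun=> c).
Proof.
elim: n c => [//|n IH] c; exists (fun=> 0); split; last exact: IH.
by move=> t _; exact: is_derive_cst.
Qed.

Lemma jetB U n f g : jet U n f -> jet U n g -> jet U n (fun t => f t - g t).
Proof.
move=> jf jg; rewrite (_ : (fun t => _) = fun t => f t + -1 * g t).
  by apply: jetD => //; apply: jetM => //; exact: jet_cst.
by apply/funext => t; rewrite mulN1r.
Qed.

Lemma jet_derivable U n f g t : open U -> (forall t, U t -> f t = g t) ->
  jet U n.+1 g -> U t -> derivable (derive1n n f) t 1.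
Proof.
move=> oU; elim: n f g t => [|n IH] f g t fg [g' [dg jg]] Ut.
  apply: (@near_eq_derivable _ _ _ g); last by have [] := dg t Ut.
  have : \near t, U t by exact: open_nbhs_nbhs.
  by apply: filterS => x Ux; exact/esym/fg.
rewrite derive1Sn; apply: (IH _ g') => // x Ux.
rewrite derive1E (@near_eq_derive _ _ _ f g); first by have [] := dg x Ux.
have : \near x, U x by exact: open_nbhs_nbhs.
by apply: filterS => z Uz; exact: fg.
Qed.

Lemma jet_smooth_on U (A : set R) f : open U -> A `<=` U ->
  (forall n, jet U n f) -> smooth_on A f.
Proof.
move=> oU AU jf; exists U, f; split => // n t Ut.
exact: (jet_derivable oU (fun _ _ => erefl) (jf n.+1) Ut).
Qed.

(** Bootstrap: adding G(q) and G'(q) to the unknowns closes the system, since each of them is the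
    derivative of the other times q'. All six derivatives are polynomials in the six functions, so n
    derivatives of all give n + 1 of all. *)
Lemma smooth_peakon_flow X U (A : set R) (p1 p2 q1 q2 : R -> R) :
  open U -> A `<=` U ->
  (forall t : R, U t -> is_derive t 1 p1 (p1 t *
     peak_value X (p1 t) (p2 t) (q2 t - q1 t) * peak_slope X (p2 t) (q2 t - q1 t))) ->
  (forall t : R, U t -> is_derive t 1 p2 (- (p2 t *
     peak_value X (p2 t) (p1 t) (q2 t - q1 t) * peak_slope X (p1 t) (q2 t - q1 t)))) ->
  (forall t : R, U t -> is_derive t 1 q1
     (peak_value X (p1 t) (p2 t) (q2 t - q1 t) ^+ 2)) ->
  (forall t : R, U t -> is_derive t 1 q2
     (peak_value X (p2 t) (p1 t) (q2 t - q1 t) ^+ 2)) ->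
  [/\ smooth_on A p1, smooth_on A p2, smooth_on A q1 & smooth_on A q2].
Proof.
move=> oU AU d1 d2 d3 d4.
pose G t := peakG X (q2 t - q1 t); pose S t := peakS X (q2 t - q1 t).
pose v1 t := peak_value X (p1 t) (p2 t) (q2 t - q1 t).
pose v2 t := peak_value X (p2 t) (p1 t) (q2 t - q1 t).
have dq (t : R) : U t -> is_derive t 1 (fun t => q2 t - q1 t) (v2 t ^+ 2 - v1 t ^+ 2).
  by move=> Ut; have := d3 t Ut; have := d4 t Ut => ? ?; exact: is_deriveB.
have dG (t : R) : U t -> is_derive t 1 G (S t * (v2 t ^+ 2 - v1 t ^+ 2)).
  by move=> Ut; exact: is_derive1_comp (is_derive_peakG X _) (dq t Ut).
have dS (t : R) : U t -> is_derive t 1 S (G t * (v2 t ^+ 2 - v1 t ^+ 2)).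
  by move=> Ut; exact: is_derive1_comp (is_derive_peakS X _) (dq t Ut).
suff H n : [/\ jet U n p1, jet U n p2, jet U n q1 & jet U n q2] /\
    jet U n G /\ jet U n S.
  by split; apply: jet_smooth_on oU AU _ => n; have [[]] := H n.
elim: n => [//|n [[j1 j2 j3 j4] [jG jS]]].
have jv (a b : R -> R) : jet U n a -> jet U n b ->
    jet U n (fun t => peak_value X (a t) (b t) (q2 t - q1 t)).
  by move=> ja jb; apply: jetD; apply: jetM => //; exact: jet_cst.
have js (a : R -> R) : jet U n a ->
    jet U n (fun t => peak_slope X (a t) (q2 t - q1 t)).
  by move=> ja; exact: jetM.
have jw : jet U n (fun t => v2 t ^+ 2 - v1 t ^+ 2).
  by apply: jetB; apply: jetM; exact: jv.
split; [split|split].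
- by eexists; split; [exact: d1|apply: jetM; [apply: jetM => //; exact: jv|exact: js]].
- eexists; split; first exact: d2.
  rewrite (_ : (fun t => _) = fun t => 0 - p2 t *
     peak_value X (p2 t) (p1 t) (q2 t - q1 t) * peak_slope X (p1 t) (q2 t - q1 t)).
    by apply: jetB; [exact: jet_cst|apply: jetM; [apply: jetM => //; exact: jv|exact: js]].
  by apply/funext => t; rewrite sub0r.
- by eexists; split; [exact: d3|apply: jetM; exact: jv].
- by eexists; split; [exact: d4|apply: jetM; exact: jv].
- by eexists; split; [exact: dG|apply: jetM].
- by eexists; split; [exact: dS|apply: jetM].
Qed.

End Jets.

(** * Scalar autonomous equations by separation of variables *)

Section ScalarFlow.
Context {R : realType}.
Implicit Types (f F phi : R -> R) (Y y z r t : R).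
Local Notation mu := (@lebesgue_measure R).

Lemma antiderivative f Y : 0 < Y ->
  (forall y, `|y| <= Y -> {for y, continuous f}) ->
  exists2 F, F 0 = 0 & forall y, `|y| < Y -> is_derive y 1 F (f y).
Proof.
move=> Y0 cf; pose G x := \int[mu]_(t in [set` `[- Y, x]]) f t.
exists (fun x => G x - G 0); first by rewrite subrr.
move=> y yY; have [yl yr] : - Y < y /\ y < Y by apply/andP; rewrite -ltr_norml.
have intf : mu.-integrable `[- Y, Y] (EFin \o f).
  apply: continuous_compact_integrable; first exact: segment_compact.
  apply: continuous_in_subspaceT => x; rewrite inE /= in_itv /= => xY.
  by apply: cf; rewrite ler_norml.
have [dG eG] := continuous_FTC1_closed yr intf yl (cf y (ltW yY)).
have dGy : is_derive y 1 G (f y) by split => //; rewrite -derive1E.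
by rewrite -[f y]subr0; exact: is_deriveB.
Qed.

Lemma MVT_ball F f Y (a b : R) :
  (forall y, `|y| < Y -> is_derive y 1 F (f y)) -> - Y < a -> a < b -> b < Y ->
  exists2 c, a <= c <= b & F b - F a = f c * (b - a).
Proof.
move=> dF aY ab bY.
have inb x : a <= x <= b -> `|x| < Y.
  move=> /andP[ax xb]; rewrite ltr_norml; apply/andP; split.
    exact: lt_le_trans aY ax.
  exact: le_lt_trans xb bY.
have [|c|c] := @MVT_segment R F f a b (ltW ab).
- by move=> x; rewrite in_itv /= => /andP[ax xb]; apply: dF; apply: inb; rewrite !ltW.
- apply: continuous_in_subspaceT => x; rewrite inE /= in_itv /= => xab.
  by have := dF x (inb x xab) => d; exact: is_derive1_continuous d.
- by rewrite in_itv /= => cab e; exists c.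
Qed.

(** With tau a primitive of 1 / phi vanishing at 0, the solution is y t = tau^{-1}(T - t) with T =
    tau y0. Since phi is positive on both sides of 0, the solution exists past T, and so is
    differentiable at the time when it reaches 0. *)
Lemma reversed_scalar_flow phi Y (y0 : R) : 0 < y0 < Y ->
  (forall y, `|y| <= Y -> {for y, continuous phi}) ->
  (forall y, `|y| <= Y -> 0 < phi y) ->
  exists (T eta : R) (y : R -> R),
  [/\ 0 < T /\ 0 < eta, y 0 = y0 /\ y T = 0,
      forall t, - eta < t < T + eta ->
        `|y t| < Y /\ is_derive t 1 y (- phi (y t)),
      forall t, - eta < t < T -> 0 < y t &
      forall m, 0 < m -> (forall z, 0 <= z <= y0 -> m <= phi z) -> T <= y0 / m].
Proof.
move=> /andP[y00 y0Y] cphi phi0.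
have Y0 : 0 < Y := lt_trans y00 y0Y.
have [|tau tau0 dtau] := @antiderivative (fun y => (phi y)^-1) Y Y0.
  by move=> y yY; apply: cvgV; [rewrite gt_eqF // phi0|exact: cphi].
have mono (a b : R) : - Y < a -> a < b -> b < Y -> tau a < tau b.
  move=> aY ab bY; have [c cab e] := MVT_ball dtau aY ab bY.
  rewrite -subr_gt0 e mulr_gt0 ?subr_gt0 // invr_gt0 phi0 //.
  move: cab => /andP[ac cb]; rewrite ler_norml; apply/andP; split.
    exact: le_trans (ltW aY) ac.
  exact: le_trans cb (ltW bY).
have inj (a b : R) : `|a| < Y -> `|b| < Y -> tau a = tau b -> a = b.
  rewrite !ltr_norml => /andP[a1 a2] /andP[b1 b2] e.
  have [ab|ba|//] := ltgtP a b.
    by have := mono _ _ a1 ab b2; rewrite e ltxx.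
  by have := mono _ _ b1 ba a2; rewrite e ltxx.
(* The slack between y0 and Y1, and between - Y1 and 0, provides the time margin eta before 0 and
   after T. *)
pose Y1 := (y0 + Y) / 2.
have [Y1a Y1b] : y0 < Y1 /\ Y1 < Y by split; rewrite /Y1; lra.
(* The inverse of tau by choice; the default 0 is returned only outside the range of tau on (- Y,
   Y). *)
pose g (r : R) : R := xget (0 : R) [set z | `|z| < Y /\ tau z = r].
have gK z : `|z| < Y -> g (tau z) = z.
  move=> zY; rewrite /g; case: xgetP => [w _ [wY /inj]|/(_ z)]; first exact.
  by move=> h; exfalso; apply: h.
have ctau y : `|y| < Y -> {for y, continuous tau}.
  by move=> yY; have d := dtau y yY; exact: is_derive1_continuous d.
have Kg r : tau (- Y1) < r < tau Y1 -> `|g r| < Y /\ tau (g r) = r.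
  move=> /andP[r1 r2].
  have [| | |z] := @IVT R tau (- Y1) Y1 r.
  - by rewrite ge0_cp // ltW // (lt_trans y00).
  - apply: continuous_in_subspaceT => x; rewrite inE /= in_itv /= => /andP[x1 x2].
    by apply: ctau; rewrite ltr_norml; apply/andP; split; lra.
  - have r12 := lt_trans r1 r2.
    by rewrite (min_idPl _) ?(max_idPr _) ?ltW // r1 ltW.
  rewrite in_itv /= => /andP[z1 z2] <-.
  have zY : `|z| < Y by rewrite ltr_norml; apply/andP; split; lra.
  by rewrite gK.
pose T : R := tau y0.
have T0 : 0 < T by rewrite -tau0; apply: mono => //; lra.
pose eta : R := Num.min (tau Y1 - T) (- tau (- Y1)).
have eta0 : 0 < eta.
  rewrite lt_min subr_gt0 oppr_gt0 -[X in _ && (_ < X)]tau0.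
  by apply/andP; split; apply: mono => //; lra.
have eta1 : eta <= tau Y1 - T by rewrite ge_min lexx.
have eta2 : eta <= - tau (- Y1) by rewrite ge_min lexx orbT.
have dom_g t : - eta < t < T + eta -> `|g (T - t)| < Y /\ tau (g (T - t)) = T - t.
  by move=> /andP[t1 t2]; apply: Kg; apply/andP; split; lra.
exists T, eta, (fun t => g (T - t)); split => //.
- split; first by rewrite subr0 gK // gtr0_norm.
  by have := gK 0; rewrite tau0 normr0 subrr; exact.
- move=> t te; have [gY tg] := dom_g t te; split => //.
  have phig := phi0 _ (ltW gY).
  have nearY : \forall z \near g (T - t), `|z| < Y.
    have : nbhs (g (T - t)) `]- Y, Y[%classic.
      by apply: near_in_itvoo; rewrite in_itv /= -ltr_norml.
    by apply: filterS => z /=; rewrite in_itv /= ltr_norml.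
  have dg : is_derive (tau (g (T - t))) 1 g ((phi (g (T - t)))^-1)^-1.
    apply: (@is_derive_inverse R tau g _ (g (T - t))).
    + by near=> z; apply: gK; near: z.
    + by near=> z; apply: ctau; near: z.
    + exact: dtau.
    + by rewrite invr_eq0 gt_eqF.
  rewrite tg invrK in dg.
  have dT : is_derive t 1 (fun t => T - t) (0 - 1 : R) by exact: is_deriveB.
  have := @is_derive1_comp R g (fun t => T - t) t _ _ dg dT.
  by rewrite sub0r mulrN1.
- move=> t /andP[t1 t2]; have [|gY tg] := dom_g t.
    by rewrite t1 /=; lra.
  have [//|gn|g0] := ltgtP 0 (g (T - t)); exfalso.
    have : tau (g (T - t)) < tau 0.
      by apply: mono => //; move: gY; rewrite ltr_norml => /andP[].
    by rewrite tg tau0; lra.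
  by move: tg; rewrite -g0 tau0; lra.
- move=> m m0 mphi.
  have [| | |c cy e] := @MVT_ball _ _ _ 0 y0 dtau; [lra|by []|by []|].
  rewrite /T -[tau y0]subr0 -tau0 e subr0 mulrC ler_pM2l // lef_pV2 ?posrE //.
    exact: mphi.
  exact: lt_le_trans (mphi c cy).
Unshelve. all: by end_near. Qed.

End ScalarFlow.

(** * The peakon system along the explicit curve in y *)

Section CollisionCurve.
Context {R : realType}.
Implicit Types (X : spatial_domain) (H k y z : R).

Local Notation C X := (peakG X 0 : R).
Local Notation A X := (peakA X : R).

(* [gap_value], [- gap_slope] are G(q), G'(q) at y^4 = (C - G(q)) / (C + G(q)), and
   [gap] is q. The constants H and k are the first integrals of the flow:
   C (p1 + p2)^2 + 2 k y^2 = H and C (p2 - p1)^2 = H + 2 k / y^2. *)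
Definition gap_value X y : R := 2 * C X * (1 + y ^+ 4)^-1 - C X.

Definition gap_slope X y : R := Num.sqrt (gap_value X y ^+ 2 - peak_kappa X).

Definition gap X y : R := ln (C X + A X) - ln (gap_value X y + gap_slope X y).

Definition amplitude_sum H k y : R := Num.sqrt (H - 2 * k * y ^+ 2).

(** This is y sqrt C (p2 - p1). The factor y removes the singularity: for k > 0 the expression is
    positive and smooth at y = 0. *)
Definition amplitude_gap H k y : R := Num.sqrt (H * y ^+ 2 + 2 * k).

Let y4 y : 0 <= y ^+ 4. Proof. by rewrite (exprM y 2 2) sqr_ge0. Qed.

Let y41 y : 0 < 1 + y ^+ 4. Proof. by rewrite ltr_pwDl. Qed.

Lemma peakCA X : C X ^+ 2 - A X ^+ 2 = peak_kappa X.
Proof. by have := peakGS X (0 : R); rewrite peakS0 sqrrN. Qed.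

Lemma ler_of_sqr (a c : R) : 0 <= c -> a ^+ 2 <= c ^+ 2 -> a <= c.
Proof.
move=> c0 /ler_wsqrtr; rewrite !sqrtr_sqr (ger0_norm c0).
exact: le_trans (ler_norm a).
Qed.

Lemma peakA_le X : A X <= C X.
Proof.
apply: ler_of_sqr; first exact: ltW (peakG_gt0 _ _).
rewrite -subr_ge0 peakCA; case: X; rewrite /peak_kappa; [exact: lexx|exact: ler01].
Qed.

Lemma gap_valueE X y : C X - gap_value X y = 2 * C X * (y ^+ 4 / (1 + y ^+ 4)).
Proof.
rewrite /gap_value; move: (C X) => c; have := y41 y; move: (y ^+ 4) => u u1.
by field; rewrite gt_eqF.
Qed.

Lemma gap_value_ub X y : C X - gap_value X y <= 2 * C X * y ^+ 4.
Proof.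
rewrite gap_valueE; apply: ler_wpM2l.
  by rewrite mulr_ge0 // (ltW (peakG_gt0 _ _)).
by rewrite ler_pdivrMr // ler_peMr // lerDl.
Qed.

Lemma gap_value_lb X y : y ^+ 4 <= 1 -> C X * y ^+ 4 <= C X - gap_value X y.
Proof.
move=> u1; rewrite gap_valueE (mulrC 2) -mulrA; apply: ler_wpM2l.
  exact: ltW (peakG_gt0 _ _).
have := y4 y; have := y41 y; move: (y ^+ 4) u1 => u u1 up u0.
rewrite mulrA ler_pdivlMr // mulrC; apply: ler_wpM2r => //; lra.
Qed.

(** A range of y, symmetric about the collision, on which G(q) stays above C / 2 and - G'(q) above A
    / 2, so that the square root and the logarithm in the gap are differentiable. *)
Definition small_parameter X y := `|y| <= A X / (4 * C X).

Section Small.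
Variables (X : spatial_domain) (y : R).
Hypothesis ys : small_parameter X y.

Let c0 : 0 < C X. Proof. exact: peakG_gt0. Qed.
Let a0 : 0 < A X. Proof. exact: peakA_gt0. Qed.

Lemma small_parameter_sq : 16 * (C X ^+ 2 * y ^+ 4) <= A X ^+ 2 / 16 /\ y ^+ 4 <= 1 / 256.
Proof.
have y14 : `|y| <= 1 / 4.
  apply: le_trans ys _; rewrite ler_pdivrMr ?mulr_gt0 //.
  by have := peakA_le X; lra.
have y2 : y ^+ 2 <= 1 / 16.
  rewrite -real_normK ?num_real // (_ : 1 / 16 = (1 / 4) ^+ 2); last by field.
  by rewrite lerXn2r // nnegrE.
have y2' : C X ^+ 2 * y ^+ 2 <= A X ^+ 2 / 16.
  have : `|y| * (4 * C X) <= A X by rewrite -ler_pdivlMr ?mulr_gt0.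
  move=> yc; have : (`|y| * (4 * C X)) ^+ 2 <= A X ^+ 2.
    by rewrite lerXn2r ?nnegrE ?(ltW a0) // mulr_ge0 // mulr_ge0 // (ltW c0).
  rewrite exprMn real_normK ?num_real // exprMn.
  by move: (y ^+ 2) (C X ^+ 2) (A X ^+ 2) => u v w; rewrite expr2; lra.
have e4 : y ^+ 4 = y ^+ 2 * y ^+ 2 by rewrite -exprD.
have u0 := sqr_ge0 y.
split; last first.
  rewrite e4; apply: le_trans (ler_pM u0 u0 y2 y2) _.
  by rewrite (_ : 1 / 16 * (1 / 16) = 1 / 256) //; field.
rewrite e4 mulrA; have v0 : 0 <= C X ^+ 2 * y ^+ 2 by rewrite mulr_ge0 ?sqr_ge0.
by have := ler_pM v0 u0 y2' y2; lra.
Qed.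

Lemma gap_value_gt0 : C X / 2 <= gap_value X y.
Proof.
have [_ y1] := small_parameter_sq; have := gap_value_ub X y.
have : C X * y ^+ 4 <= C X * (1 / 256) by rewrite ler_pM2l.
by have := c0; rewrite -mulrA; move: (C X * y ^+ 4) => u c1 h1 h2; lra.
Qed.

Lemma gap_value_le : gap_value X y <= C X.
Proof.
by rewrite -subr_ge0 gap_valueE mulr_ge0 ?divr_ge0 ?(ltW (y41 _)) // mulr_ge0 // ltW.
Qed.

Lemma gap_slope_sq_ge : A X ^+ 2 / 4 <= gap_value X y ^+ 2 - peak_kappa X.
Proof.
have [y1 _] := small_parameter_sq; have h := gap_value_ub X y.
have g1 := gap_value_gt0; have g2 := gap_value_le.
rewrite -peakCA.
have : (C X - gap_value X y) * (C X + gap_value X y) <= 2 * C X * y ^+ 4 * (2 * C X).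
  by apply: ler_pM => //; lra.
have -> : (C X - gap_value X y) * (C X + gap_value X y) = C X ^+ 2 - gap_value X y ^+ 2.
  by ring.
have -> : 2 * C X * y ^+ 4 * (2 * C X) = 4 * (C X ^+ 2 * y ^+ 4) by ring.
move: y1; move: (C X ^+ 2 * y ^+ 4) (C X ^+ 2) (gap_value X y ^+ 2) (sqr_ge0 (A X)).
by move: (A X ^+ 2); clear => *; lra.
Qed.

Lemma gap_slope_sq : gap_slope X y ^+ 2 = gap_value X y ^+ 2 - peak_kappa X.
Proof.
by rewrite /gap_slope sqr_sqrtr // (le_trans _ gap_slope_sq_ge) // divr_ge0 ?sqr_ge0.
Qed.

Lemma gap_slope_ge : A X / 2 <= gap_slope X y.
Proof.
rewrite -[A X / 2]ger0_norm ?divr_ge0 ?(ltW a0) // -sqrtr_sqr ler_wsqrtr //.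
rewrite exprMn (_ : (2^-1) ^+ 2 = 4^-1 :> R); first exact: gap_slope_sq_ge.
by rewrite expr2; field.
Qed.

Lemma gap_slope_gt0 : 0 < gap_slope X y.
Proof. by apply: lt_le_trans gap_slope_ge; rewrite divr_gt0. Qed.

Lemma gap_slope_le : gap_slope X y <= A X.
Proof.
apply: ler_of_sqr; first exact: ltW.
rewrite gap_slope_sq -peakCA opprB addrCA gerDl subr_le0.
apply: lerXn2r; rewrite ?nnegrE; [|exact: ltW|exact: gap_value_le].
by apply: le_trans gap_value_gt0; rewrite divr_ge0 // ltW.
Qed.

Let v0 : 0 < gap_value X y.
Proof. by apply: lt_le_trans gap_value_gt0; rewrite divr_gt0. Qed.

Let vs0 : 0 < gap_value X y + gap_slope X y.
Proof. by rewrite addr_gt0 // gap_slope_gt0. Qed.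

(** On both domains G(q) - G'(q) = (C + A) e^{-q}; solving this for q is the origin of the formula
    for [gap]. *)
Lemma expR_gap : expR (gap X y) = (C X + A X) / (gap_value X y + gap_slope X y).
Proof.
by rewrite /gap expRD expRN !lnK ?posrE // addr_gt0.
Qed.

(** With v = [gap_value] and r = [gap_slope], the relation (v + r)(v - r) = kappa supplies the
    exponential of opposite sign: it gives r = v on the line and 1 / (v + r) = v - r on the
    circle. *)
Lemma peak_at_gap : peakG X (gap X y) = gap_value X y /\
  peakS X (gap X y) = - gap_slope X y.
Proof.
have e1 := expR_gap; have e2 : expR (- gap X y) = (gap_value X y + gap_slope X y) / (C X + A X).
  by rewrite expRN e1 invf_div.
have sq := gap_slope_sq; have vs := vs0; have s0 := gap_slope_gt0; have vp := v0.
move: e1 e2 sq vs s0 vp c0 a0; rewrite {1 2}/peakG {1}/peakS.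
move: (gap_slope X y) (gap_value X y) (gap X y) => r v g.
case: X => /= e1 e2 sq vs r0 v0' _ _.
  have rv : r = v.
    by apply/eqP; rewrite -(@eqrXn2 _ 2) ?(ltW r0) ?(ltW v0') //; apply/eqP; lra.
  move: e2; rewrite oppr0 expR0 rv => ->.
  by split; field.
have epi : (cosh (0 - pi) + sinh pi : R) = expR pi.
  by rewrite sub0r coshN /cosh /sinh; field.
rewrite epi in e1 e2.
have epi0 := expR_gt0 (pi : R).
have e3 : expR (g - pi) = (v + r)^-1.
  by rewrite expRD expRN e1; field; rewrite !gt_eqF.
have e4 : expR (- (g - pi)) = v + r by rewrite expRN e3 invrK.
have e5 : (v + r)^-1 = v - r.
  apply: (mulfI (lt0r_neq0 vs)); rewrite mulfV ?gt_eqF //.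
  have -> : (v + r) * (v - r) = v ^+ 2 - r ^+ 2 by ring.
  by rewrite sq; ring.
by rewrite /cosh /sinh e4 e3 e5; split; field.
Qed.

(** The exponential is linearised: q >= 1 - e^{-q} here, q <= e^q - 1 in [gap_le]. *)
Lemma gap_ge : C X / (C X + A X) * y ^+ 4 <= gap X y.
Proof.
have := expR_ge1Dx (- gap X y); rewrite expRN expR_gap invf_div.
have [_ y1] := small_parameter_sq.
have := @gap_value_lb X y (le_trans y1 _); have := gap_slope_le.
have ca : 0 < C X + A X by rewrite addr_gt0.
move: (gap X y) (gap_value X y) (gap_slope X y) => g v r rA h1 h2.
suff : C X / (C X + A X) * y ^+ 4 <= 1 - (v + r) / (C X + A X) by move: h2; lra.
have -> : 1 - (v + r) / (C X + A X) = ((C X + A X) - (v + r)) / (C X + A X).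
  by rewrite mulrBl mulfV // gt_eqF.
rewrite mulrAC; apply: ler_wpM2r; first by rewrite invr_ge0 ltW.
have {}h1 : C X * y ^+ 4 <= C X - v by apply: h1; lra.
lra.
Qed.

Lemma gap_le : gap X y <= 4 * (1 + 2 * C X / A X) * y ^+ 4.
Proof.
have := expR_ge1Dx (gap X y); rewrite expR_gap.
have ub := gap_value_ub X y; have sle := gap_slope_le; have vle := gap_value_le.
have vge := gap_value_gt0; have sq := gap_slope_sq; have s0 := gap_slope_gt0.
have vs := vs0; move: c0 a0 (peakCA X) ub sle vle vge sq s0 vs.
move: (peak_kappa X) (C X) (A X) (gap X y) (gap_value X y) (gap_slope X y) (y ^+ 4).
move=> kap c a g v r u c0' a0' ca ub sle vle vge sq s0 vs h.
have h1 : (a - r) * a <= (c - v) * (2 * c).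
  have e : (a - r) * (a + r) = (c - v) * (c + v).
    have -> : (a - r) * (a + r) = a ^+ 2 - r ^+ 2 by ring.
    have -> : (c - v) * (c + v) = c ^+ 2 - v ^+ 2 by ring.
    lra.
  apply: (@le_trans _ _ ((a - r) * (a + r))).
    by apply: ler_wpM2l; lra.
  by rewrite e; apply: ler_wpM2l; lra.
have h2 : a - r <= (c - v) * (2 * c / a).
  by rewrite mulrA ler_pdivlMr.
suff : (c + a) / (v + r) <= 1 + 4 * (1 + 2 * c / a) * u by move: h; lra.
rewrite ler_pdivrMr //; set m := 2 * c / a.
have m0 : 0 <= m by rewrite /m divr_ge0 // ?mulr_ge0 // ltW.
have h3 : (c - v) * (1 + m) <= 2 * c * u * (1 + m) by apply: ler_wpM2r; lra.
have u0 : 0 <= u by rewrite -(pmulr_rge0 _ c0'); lra.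
have h4 : 4 * (1 + m) * u * (c / 2) <= 4 * (1 + m) * u * (v + r).
  by apply: ler_wpM2l; [rewrite !mulr_ge0 //; lra|lra].
rewrite mulrDl mul1r; move: h2 h3 h4; rewrite -/m.
have -> : 4 * (1 + m) * u * (c / 2) = 2 * c * u * (1 + m) by field.
by rewrite !mulrDr !mulr1; lra.
Qed.

Lemma is_derive_gap_value (z : R) :
  is_derive z 1 (gap_value X) (- (8 * C X * z ^+ 3 / (1 + z ^+ 4) ^+ 2)).
Proof.
have z1 : 1 + z ^+ 4 != 0 by rewrite gt_eqF.
have d1 : is_derive z 1 (fun z : R => 1 + z ^+ 4) (4 * z ^+ 3).
  by apply: is_derive_eq; rewrite /GRing.scale /=; ring.
have d2 := @is_deriveV R (fun z : R => 1 + z ^+ 4) z _ 1 z1 d1.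
rewrite /gap_value; apply: is_derive_eq; rewrite /GRing.scale /=.
by move: z1; move: (z ^+ 4) => w w1; rewrite !expr2; field.
Qed.

Lemma is_derive_gap_slope : is_derive y 1 (gap_slope X)
  (- (8 * C X * y ^+ 3 / (1 + y ^+ 4) ^+ 2) * gap_value X y / gap_slope X y).
Proof.
have dv := is_derive_gap_value y; have s0 := gap_slope_gt0.
have d1 : is_derive y 1 (fun z => gap_value X z ^+ 2 - peak_kappa X)
    (2 * gap_value X y * - (8 * C X * y ^+ 3 / (1 + y ^+ 4) ^+ 2)).
  apply: is_derive_eq; rewrite /GRing.scale /= subr0.
  by move: (8 * _ * _ / _); rewrite -/(gap_value X y) => u; ring.
have p0 : 0 < gap_value X y ^+ 2 - peak_kappa X.
  by rewrite -gap_slope_sq exprn_gt0.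
have d2 := @is_derive1_comp R Num.sqrt _ y _ _ (is_derive1_sqrt p0) d1.
apply: (is_derive_eq d2); rewrite -/(gap_slope X y).
move: (8 * _ * _ / _) s0; move: (gap_slope X y) => r g r0.
by field; rewrite gt_eqF.
Qed.

Lemma is_derive_gap : is_derive y 1 (gap X)
  (8 * C X * y ^+ 3 / (1 + y ^+ 4) ^+ 2 / gap_slope X y).
Proof.
have dv := is_derive_gap_value y; have ds := is_derive_gap_slope.
have d1 : is_derive y 1 (fun z => gap_value X z + gap_slope X z) _ := is_deriveD dv ds.
have d2 := @is_derive1_comp R (@ln R) _ y _ _ (is_derive1_ln vs0) d1.
have d3 : is_derive y 1 (fun z => ln (C X + A X) - ln (gap_value X z + gap_slope X z)) _ :=
  is_deriveB (is_derive_cst _ _ _) d2.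
apply: (is_derive_eq d3).
have vs := vs0; have s0 := gap_slope_gt0; move: vs s0; move: (8 * _ * _ / _).
move: (gap_slope X y) (gap_value X y) => r v g vr r0.
by field; rewrite !gt_eqF.
Qed.

End Small.


(** Together with [curve_p2] this solves p1 + p2 = - a / sqrt C and p2 - p1 = b / (sqrt C y), where
    a and b are the two amplitudes. The negative sign of the sum makes the limit an antipeakon; it
    also gives |u(q1)| > |u(q2)| for y > 0, so the left peak catches up. *)
Definition curve_p1 X H k y : R :=
  (- (amplitude_sum H k y / Num.sqrt (C X)) -
   amplitude_gap H k y / (Num.sqrt (C X) * y)) / 2.

Definition curve_p2 X H k y : R :=
  (- (amplitude_sum H k y / Num.sqrt (C X)) +
   amplitude_gap H k y / (Num.sqrt (C X) * y)) / 2.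

(** The value of - y' along the flow. It contains no negative power of y and is positive at y = 0,
    hence the collision is reached in finite time. *)
Definition curve_speed X H k y : R :=
  gap_slope X y * amplitude_sum H k y * amplitude_gap H k y / 2.

(** The value of u at the left peak. The 1 / y in the momenta has been absorbed by C - G(q), which
    is of order y^4. *)
Definition curve_u1 X H k y : R :=
  - (Num.sqrt (C X) * (amplitude_sum H k y + amplitude_gap H k y * y ^+ 3) /
     (1 + y ^+ 4)).

Definition curve_u2 X H k y : R :=
  Num.sqrt (C X) * (amplitude_gap H k y * y ^+ 3 - amplitude_sum H k y) /
     (1 + y ^+ 4).

Section Admissible.
Variables (X : spatial_domain) (H k y : R).
Hypotheses (ys : small_parameter X y) (Ha : 0 < H - 2 * k * y ^+ 2)
  (Hb : 0 < H * y ^+ 2 + 2 * k).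

Let a := amplitude_sum H k y.
Let b := amplitude_gap H k y.
Let c := Num.sqrt (C X).

Let a0 : 0 < a. Proof. by rewrite sqrtr_gt0. Qed.
Let b0 : 0 < b. Proof. by rewrite sqrtr_gt0. Qed.
Let c0 : 0 < c. Proof. by rewrite sqrtr_gt0 peakG_gt0. Qed.
Let aE : a ^+ 2 = H - 2 * k * y ^+ 2. Proof. by rewrite sqr_sqrtr // ltW. Qed.
Let bE : b ^+ 2 = H * y ^+ 2 + 2 * k. Proof. by rewrite sqr_sqrtr // ltW. Qed.
Let cE : C X = c ^+ 2. Proof. by rewrite sqr_sqrtr // ltW // peakG_gt0. Qed.

Lemma is_derive_amplitude_sum : is_derive y 1 (amplitude_sum H k) (- (2 * k * y / a)).
Proof.
have d1 : is_derive y 1 (fun y : R => H - 2 * k * y ^+ 2) (- (4 * k * y)).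
  by apply: is_derive_eq; rewrite /GRing.scale /=; ring.
have d2 := @is_derive1_comp R Num.sqrt _ y _ _ (is_derive1_sqrt Ha) d1.
apply: (is_derive_eq d2); rewrite -/(amplitude_sum H k y) -/a.
have alg (u v : R) : u != 0 -> (2 * u)^-1 * - (4 * k * v) = - (2 * k * v / u).
  by move=> u0; field.
exact: alg (lt0r_neq0 a0).
Qed.

Lemma is_derive_amplitude_gap : is_derive y 1 (amplitude_gap H k) (H * y / b).
Proof.
have d1 : is_derive y 1 (fun y : R => H * y ^+ 2 + 2 * k) (2 * H * y).
  by apply: is_derive_eq; rewrite /GRing.scale /=; ring.
have d2 := @is_derive1_comp R Num.sqrt _ y _ _ (is_derive1_sqrt Hb) d1.
apply: (is_derive_eq d2); rewrite -/(amplitude_gap H k y) -/b.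
have alg (u v : R) : u != 0 -> (2 * u)^-1 * (2 * H * v) = H * v / u.
  by move=> u0; field.
exact: alg (lt0r_neq0 b0).
Qed.

Hypothesis y0 : y != 0.

Lemma curve_values :
  [/\ curve_p1 X H k y * curve_p2 X H k y = - (k * (1 + y ^+ 4) / (2 * c ^+ 2 * y ^+ 2)),
      peak_value X (curve_p1 X H k y) (curve_p2 X H k y) (gap X y) = curve_u1 X H k y &
      peak_value X (curve_p2 X H k y) (curve_p1 X H k y) (gap X y) = curve_u2 X H k y].
Proof.
rewrite /peak_value (peak_at_gap ys).1 /gap_value /curve_p1 /curve_p2.
rewrite /curve_u1 /curve_u2 -/a -/b -/c cE.
have y1 : 1 + y ^+ 4 != 0 by rewrite gt_eqF.
have alg1 (a' b' c' z : R) : c' != 0 -> z != 0 ->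
    (- (a' / c') - b' / (c' * z)) / 2 * ((- (a' / c') + b' / (c' * z)) / 2) =
    (a' ^+ 2 * z ^+ 2 - b' ^+ 2) / (4 * c' ^+ 2 * z ^+ 2).
  by move=> ? ?; field; apply/andP.
have alg2 (c' z : R) : c' != 0 -> z != 0 ->
    ((H - 2 * k * z ^+ 2) * z ^+ 2 - (H * z ^+ 2 + 2 * k)) / (4 * c' ^+ 2 * z ^+ 2) =
    - (k * (1 + z ^+ 4) / (2 * c' ^+ 2 * z ^+ 2)).
  by move=> ? ?; field; apply/andP.
have alg3 (a' b' c' z : R) : c' != 0 -> z != 0 -> 1 + z ^+ 4 != 0 ->
    (- (a' / c') - b' / (c' * z)) / 2 * c' ^+ 2 +
    (- (a' / c') + b' / (c' * z)) / 2 * (2 * c' ^+ 2 * (1 + z ^+ 4)^-1 - c' ^+ 2) =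
    - (c' * (a' + b' * z ^+ 3) / (1 + z ^+ 4)).
  by move=> e1 e2 e3; field; rewrite ?e1 ?e2 ?e3.
have alg4 (a' b' c' z : R) : c' != 0 -> z != 0 -> 1 + z ^+ 4 != 0 ->
    (- (a' / c') + b' / (c' * z)) / 2 * c' ^+ 2 +
    (- (a' / c') - b' / (c' * z)) / 2 * (2 * c' ^+ 2 * (1 + z ^+ 4)^-1 - c' ^+ 2) =
    c' * (b' * z ^+ 3 - a') / (1 + z ^+ 4).
  by move=> e1 e2 e3; field; rewrite ?e1 ?e2 ?e3.
have c1 := lt0r_neq0 c0.
by split; [rewrite alg1 // aE bE alg2|exact: alg3|exact: alg4].
Qed.

Lemma is_derive_curve_terms :
  is_derive y 1 (fun y => amplitude_sum H k y / c) (- (2 * k * y / (a * c))) /\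
  is_derive y 1 (fun y => amplitude_gap H k y / (c * y)) (- (2 * k / (b * c * y ^+ 2))).
Proof.
have da := is_derive_amplitude_sum; have db := is_derive_amplitude_gap.
have cy : c * y != 0 by rewrite mulf_neq0 // gt_eqF.
have d1 : is_derive y 1 (fun y : R => c * y) c.
  by apply: is_derive_eq; rewrite /GRing.scale /=; ring.
have d2 := @is_deriveV R (fun y : R => c * y) y _ 1 cy d1.
split.
  have d3 : is_derive y 1 (fun y => amplitude_sum H k y / c) _ :=
    is_deriveM da (is_derive_cst _ _ _).
  apply: (is_derive_eq d3); rewrite /GRing.scale /=.
  have alg (a' c' : R) : a' != 0 -> c' != 0 ->
      amplitude_sum H k y * 0 + c'^-1 * - (2 * k * y / a') = - (2 * k * y / (a' * c')).
    by move=> e1 e2; field; rewrite e1 e2.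
  exact: alg (lt0r_neq0 a0) (lt0r_neq0 c0).
have d3 : is_derive y 1 (fun y => amplitude_gap H k y / (c * y)) _ := is_deriveM db d2.
apply: (is_derive_eq d3); rewrite /GRing.scale /= -/b.
have HE : H * y ^+ 2 = b ^+ 2 - 2 * k by rewrite bE addrK.
have alg (b' c' z : R) : b' != 0 -> c' != 0 -> z != 0 ->
    H * z ^+ 2 = b' ^+ 2 - 2 * k ->
    b' * (- (c' * z) ^- 2 * c') + (c' * z)^-1 * (H * z / b') =
    - (2 * k / (b' * c' * z ^+ 2)).
  move=> e1 e2 e3 e.
  have -> : (c' * z)^-1 * (H * z / b') = H * z ^+ 2 / (b' * c' * z ^+ 2).
    by field; rewrite e1 e2 e3.
  by rewrite e; field; rewrite e1 e2 e3.
exact: alg (lt0r_neq0 b0) (lt0r_neq0 c0) y0 HE.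
Qed.

Lemma is_derive_curve_p1 : is_derive y 1 (curve_p1 X H k)
  (k * y / (a * c) + k / (b * c * y ^+ 2)).
Proof.
have [dA dB] := is_derive_curve_terms.
have d := is_deriveM (is_deriveB (is_deriveN dA) dB) (is_derive_cst (2^-1 : R) y 1).
apply: (is_derive_eq d); rewrite /GRing.scale /=.
have alg (u v w m : R) :
    u * 0 + 2^-1 * (- - (2 * k * v * w) - - (2 * k * m)) = k * v * w + k * m.
  by field.
exact: alg.
Qed.

Lemma is_derive_curve_p2 : is_derive y 1 (curve_p2 X H k)
  (k * y / (a * c) - k / (b * c * y ^+ 2)).
Proof.
have [dA dB] := is_derive_curve_terms.
have d := is_deriveM (is_deriveD (is_deriveN dA) dB) (is_derive_cst (2^-1 : R) y 1).
apply: (is_derive_eq d); rewrite /GRing.scale /=.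
have alg (u v w m : R) :
    u * 0 + 2^-1 * (- - (2 * k * v * w) + - (2 * k * m)) = k * v * w - k * m.
  by field.
exact: alg.
Qed.

(* The y-derivatives of p1, p2 and the gap, times y' = - curve_speed, are the
   right-hand sides of the peakon equations. *)
Lemma curve_equations :
  let p1 := curve_p1 X H k y in let p2 := curve_p2 X H k y in
  let Q := gap X y in
  [/\ (k * y / (a * c) + k / (b * c * y ^+ 2)) * - curve_speed X H k y =
        p1 * peak_value X p1 p2 Q * peak_slope X p2 Q,
      (k * y / (a * c) - k / (b * c * y ^+ 2)) * - curve_speed X H k y =
        - (p2 * peak_value X p2 p1 Q * peak_slope X p1 Q) &
      8 * C X * y ^+ 3 / (1 + y ^+ 4) ^+ 2 / gap_slope X y * - curve_speed X H k y =
        peak_value X p2 p1 Q ^+ 2 - peak_value X p1 p2 Q ^+ 2].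
Proof.
have [pp v1 v2] := curve_values.
have y1 : 1 + y ^+ 4 != 0 by rewrite gt_eqF.
have r0 := lt0r_neq0 (gap_slope_gt0 ys).
rewrite /= v1 v2 /peak_slope (peak_at_gap ys).2.
have alg (p1 p2 u r : R) : p1 * u * (p2 * - r) = - (p1 * p2 * u * r) by ring.
rewrite !alg (mulrC (curve_p2 X H k y)) pp.
rewrite /curve_speed /curve_u1 /curve_u2 -/a -/b -/c cE.
have alg1 (a' b' c' r z : R) : a' != 0 -> b' != 0 -> c' != 0 -> z != 0 ->
    1 + z ^+ 4 != 0 ->
    (k * z / (a' * c') + k / (b' * c' * z ^+ 2)) * - (r * a' * b' / 2) =
    - (- (k * (1 + z ^+ 4) / (2 * c' ^+ 2 * z ^+ 2)) *
      - (c' * (a' + b' * z ^+ 3) / (1 + z ^+ 4)) * r).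
  by move=> e1 e2 e3 e4 e5; field; rewrite ?e1 ?e2 ?e3 ?e4 ?e5.
have alg2 (a' b' c' r z : R) : a' != 0 -> b' != 0 -> c' != 0 -> z != 0 ->
    1 + z ^+ 4 != 0 ->
    (k * z / (a' * c') - k / (b' * c' * z ^+ 2)) * - (r * a' * b' / 2) =
    - - (- (k * (1 + z ^+ 4) / (2 * c' ^+ 2 * z ^+ 2)) *
      (c' * (b' * z ^+ 3 - a') / (1 + z ^+ 4)) * r).
  by move=> e1 e2 e3 e4 e5; field; rewrite ?e1 ?e2 ?e3 ?e4 ?e5.
have alg3 (a' b' c' r z : R) : r != 0 -> 1 + z ^+ 4 != 0 ->
    8 * c' ^+ 2 * z ^+ 3 / (1 + z ^+ 4) ^+ 2 / r * - (r * a' * b' / 2) =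
    (c' * (b' * z ^+ 3 - a') / (1 + z ^+ 4)) ^+ 2 -
    (- (c' * (a' + b' * z ^+ 3) / (1 + z ^+ 4))) ^+ 2.
  by move=> e1 e2; field; rewrite ?e1 ?e2.
have a1 := lt0r_neq0 a0; have b1 := lt0r_neq0 b0; have c1 := lt0r_neq0 c0.
by split; [exact: alg1|exact: alg2|exact: alg3].
Qed.

End Admissible.

End CollisionCurve.

(** * Construction of the colliding pair *)

Section Collision.
Context {R : realType}.
Implicit Types (X : spatial_domain) (D : set R) (f df : R -> R).

Local Notation C X := (peakG X 0 : R).
Local Notation A X := (peakA X : R).

(** Extension by zero outside D makes f measurable on R, as [peakon_flow] asks, and keeps its
    derivatives, because D is open. *)
Lemma restrict_derive D f df : open D ->
  (forall t : R, D t -> is_derive t 1 f (df t)) ->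
  measurable_fun setT (f \_ D) /\ forall t : R, D t -> is_derive t 1 (f \_ D) (df t).
Proof.
move=> oD d; split.
  apply/(measurable_restrictT _ _).1; first exact: open_measurable.
  apply: open_continuous_measurable_fun => // t; rewrite inE => Dt.
  by have := d t Dt => d'; exact: is_derive1_continuous d'.
move=> t Dt; have [d1 d2] := d t Dt.
have nD : \near t, D t by exact: open_nbhs_nbhs.
have e : \near t, f t = (f \_ D) t.
  by apply: filterS nD => x Dx; rewrite patchT // inE.
split; first exact: near_eq_derivable e d1.
by rewrite -d2; apply/esym; exact: near_eq_derive.
Qed.

(** The bound 1 keeps the gap below 2 pi on the circle and within the range of [profile_dist_ge]. *)
Lemma gap_le1 X (y : R) : small_parameter X y -> gap X y <= 1.
Proof.
move=> ys; apply: le_trans (gap_le ys) _.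
have [h1 h2] := small_parameter_sq ys; have ac := @peakA_le R X.
have a0 := @peakA_gt0 R X; have c0 := @peakG_gt0 R X 0.
have h3 : C X * y ^+ 4 <= A X / 256.
  have : C X * (C X * y ^+ 4) <= C X * (A X / 256).
    apply: (@le_trans _ _ (A X * (A X / 256))).
      have -> : C X * (C X * y ^+ 4) = C X ^+ 2 * y ^+ 4 by ring.
      have -> : A X * (A X / 256) = A X ^+ 2 / 256 by field.
      by move: h1; move: (C X ^+ 2 * _) (A X ^+ 2) => u v; clear; lra.
    by apply: ler_wpM2r ac; rewrite divr_ge0 ?(ltW a0).
  by rewrite ler_pM2l.
have -> : 4 * (1 + 2 * C X / A X) * y ^+ 4 = 4 * y ^+ 4 + 8 * (C X * y ^+ 4 / A X).
  by move: (y ^+ 4) => u; field; rewrite gt_eqF.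
have : C X * y ^+ 4 / A X <= 1 / 256 by rewrite ler_pdivrMr //; move: h3; clear; lra.
by move: h2; clear; lra.
Qed.

Variables (X : spatial_domain) (P delta y0 : R).
Hypotheses (P0 : 0 < P) (delta0 : 0 < delta) (y00 : 0 < y0)
  (y0s : 8 * C X * y0 <= A X) (y0d : 6 * P ^+ 2 * y0 ^+ 4 < C X * delta ^+ 2).

(** With these first integrals the curve starts at y0 with p1 + p2 = - delta and p2 - p1 >= sqrt 2 P
    / sqrt C, since H - 2 k y0^2 = C delta^2 and (H y0^2 + 2 k) / y0^2 >= 2 P^2. The factor y0^2 in
    k makes the lower bound for the speed proportional to y0, so that y0 cancels from the bound on
    T. *)
Let k : R := P ^+ 2 * y0 ^+ 2.
Let H : R := 2 * k * y0 ^+ 2 + C X * delta ^+ 2.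

Let c0 : 0 < C X. Proof. exact: peakG_gt0. Qed.
Let a0 : 0 < A X. Proof. exact: peakA_gt0. Qed.
Let k0 : 0 < k. Proof. by rewrite mulr_gt0 // exprn_gt0. Qed.
Let H0 : 0 < H.
Proof. by rewrite addr_gt0 // mulr_gt0 ?exprn_gt0 // mulr_gt0. Qed.

(** The range 2 y0 leaves room around the initial point. It accounts for the constants in the
    hypotheses: 8 C y0 <= A is 2 y0 <= A / (4 C), and H - 2 k z^2 >= C delta^2 - 6 P^2 y0^4 on this
    range. *)
Lemma collision_admissible (z : R) : `|z| <= 2 * y0 ->
  [/\ small_parameter X z, 0 < H - 2 * k * z ^+ 2 & 0 < H * z ^+ 2 + 2 * k].
Proof.
move=> zY; split.
- apply: le_trans zY _; rewrite ler_pdivlMr ?mulr_gt0 //.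
  by rewrite (_ : 2 * y0 * (4 * C X) = 8 * C X * y0) //; ring.
- have z2 : z ^+ 2 <= 4 * y0 ^+ 2.
    rewrite -real_normK ?num_real // (_ : 4 * y0 ^+ 2 = (2 * y0) ^+ 2); last by ring.
    by rewrite lerXn2r // nnegrE mulr_ge0 // ltW.
  have kz : k * z ^+ 2 <= 4 * (k * y0 ^+ 2) by rewrite (mulrCA 4) ler_pM2l.
  have e : k * y0 ^+ 2 = P ^+ 2 * y0 ^+ 4 by rewrite /k -mulrA -exprD.
  have y0d' : 6 * (P ^+ 2 * y0 ^+ 4) < C X * delta ^+ 2 by rewrite mulrA.
  have -> : H - 2 * k * z ^+ 2 =
      2 * (P ^+ 2 * y0 ^+ 4) + C X * delta ^+ 2 - 2 * (k * z ^+ 2).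
    by rewrite /H -!(mulrA 2) e.
  move: kz y0d'; rewrite e.
  by move: (k * z ^+ 2) (P ^+ 2 * y0 ^+ 4) (C X * delta ^+ 2) => u v w; lra.
- by rewrite ltr_wpDl ?mulr_gt0 // mulr_ge0 ?sqr_ge0 // ltW.
Qed.

Lemma collision_speed_ge (z : R) : 0 <= z <= y0 ->
  A X * (Num.sqrt (C X) * delta) * (P * y0) / 4 <= curve_speed X H k z.
Proof.
move=> /andP[z0 zy].
have [|zs Ha Hb] := @collision_admissible z.
  by rewrite ger0_norm //; apply: le_trans zy _; have := y00; lra.
have h1 := gap_slope_ge zs.
have z2 : z ^+ 2 <= y0 ^+ 2 by apply: lerXn2r => //; rewrite nnegrE // ltW.
have h2 : Num.sqrt (C X) * delta <= amplitude_sum H k z.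
  rewrite -{1}[delta](ger0_norm (ltW delta0)) -sqrtr_sqr -(sqrtrM _ (ltW c0)); apply: ler_wsqrtr.
  have : k * z ^+ 2 <= k * y0 ^+ 2 by rewrite ler_pM2l.
  have alg (u v w : R) : u <= v -> w <= 2 * v + w - 2 * u by lra.
  by rewrite /H -!(mulrA 2); exact: alg.
have h3 : P * y0 <= amplitude_gap H k z.
  rewrite -[P * y0](ger0_norm (ltW (mulr_gt0 P0 y00))) -sqrtr_sqr; apply: ler_wsqrtr.
  have : 0 <= H * z ^+ 2 by rewrite mulr_ge0 ?sqr_ge0 // ltW.
  have alg (u v : R) : 0 < v -> 0 <= u -> v <= u + 2 * v by lra.
  by rewrite exprMn; exact: alg.
have s0 : 0 <= Num.sqrt (C X) * delta by rewrite mulr_ge0 ?sqrtr_ge0 // ltW.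
have p0 : 0 <= P * y0 by rewrite mulr_ge0 // ltW.
have a20 : 0 <= A X / 2 by rewrite divr_ge0 // ltW.
have h := ler_pM (mulr_ge0 a20 s0) p0 (ler_pM a20 s0 h1 h2) h3.
rewrite /curve_speed ler_pdivlMr //; apply: le_trans h.
by rewrite le_eqVlt; apply/orP; left; apply/eqP; field.
Qed.

Lemma collision_speed (z : R) : `|z| <= 2 * y0 ->
  0 < curve_speed X H k z /\ {for z, continuous (curve_speed X H k)} /\
  {for z, continuous (fun z => - (curve_u1 X H k z ^+ 2 / curve_speed X H k z))}.
Proof.
move=> zY; have [zs Ha Hb] := collision_admissible zY.
have s0 : 0 < curve_speed X H k z.
  apply: divr_gt0 => //; apply: mulr_gt0; last by rewrite sqrtr_gt0.
  by apply: mulr_gt0; [exact: gap_slope_gt0|rewrite sqrtr_gt0].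
have cs := is_derive1_continuous (is_derive_gap_slope zs).
have ca := is_derive1_continuous (is_derive_amplitude_sum Ha).
have cb := is_derive1_continuous (is_derive_amplitude_gap Hb).
have cv : {for z, continuous (curve_speed X H k)}.
  by apply: cvgM; [apply: cvgM; [apply: cvgM|]|exact: cvg_cst].
split; first exact: s0.
split; first exact: cv.
have cu : {for z, continuous (curve_u1 X H k)}.
  apply: cvgN; apply: cvgM.
    apply: cvgM; first exact: cvg_cst.
    apply: cvgD; first exact: ca.
    by apply: cvgM; [exact: cb|exact: exprn_continuous].
  apply: cvgV; first by rewrite gt_eqF // ltr_pwDl // (exprM z 2 2) sqr_ge0.
  by apply: cvgD; [exact: cvg_cst|exact: exprn_continuous].
apply: cvgN; apply: cvgM; first by apply: cvgM; exact: cu.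
by apply: cvgV; [rewrite gt_eqF|exact: cv].
Qed.

(** Only y comes from a differential equation. The momenta and the gap are the curve evaluated at y,
    q1 is a primitive in y, and the peakon equations follow from [curve_equations] by the chain
    rule. *)
Theorem peakon_collision : exists (T : R) (y p1 p2 q1 q2 : R -> R) (qT : R),
  [/\ 0 < T /\ T <= 4 / (A X * (Num.sqrt (C X) * delta) * P),
      peakon_flow X T p1 p2 q1 q2,
      [/\ smooth_on `[0, T[ p1, smooth_on `[0, T[ p2,
          smooth_on `[0, T[ q1 & smooth_on `[0, T[ q2],
      forall t : R, 0 <= t < T ->
        [/\ 0 < y t <= 2 * y0, p1 t = curve_p1 X H k (y t),
            p2 t = curve_p2 X H k (y t), q2 t - q1 t = gap X (y t) &
            [/\ {for t, continuous p1}, {for t, continuous p2},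
                {for t, continuous q1} & {for t, continuous q2}]] &
      [/\ y 0 = y0, y t @[t --> T^'-] --> (0 : R), 0 < qT &
          q1 t @[t --> T^'-] --> qT]].
Proof.
have Y0 : 0 < 2 * y0 by rewrite mulr_gt0.
have [||z zY|] := @reversed_scalar_flow R (curve_speed X H k) (2 * y0) y0.
- by rewrite y00 /= ltr_pMl // ltr1n.
- by move=> z zY; case: (collision_speed zY) => _ [].
- by case: (collision_speed zY).
move=> T [eta [y [[T0 eta0] [y0E yT] yd ypos Tle]]].
(* Dividing q1' = u(q1)^2 by y' gives dq1/dy, so q1 = 1 + W(y). As W(0) = 0, q1 tends to the
   additive constant 1 at the collision; this makes qT positive. *)
have [|W W0 dW] := antiderivative Y0
    (f := fun z => - (curve_u1 X H k z ^+ 2 / curve_speed X H k z)).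
  by move=> z zY; case: (collision_speed zY) => _ [].
(* The interval reaches to the left of 0, so that smoothness on [0, T) has an open neighbourhood,
   and stops at T, where the momenta blow up. *)
pose D : set R := `]- eta, T[%classic.
have oD : open D by exact: interval_open.
have inD t : D t <-> - eta < t < T by rewrite /D /= in_itv.
pose r1 t := curve_p1 X H k (y t); pose r2 t := curve_p2 X H k (y t).
pose s1 t := 1 + W (y t); pose s2 t := 1 + W (y t) + gap X (y t).
have facts t : D t -> [/\ `|y t| < 2 * y0, 0 < y t & is_derive t 1 y (- curve_speed X H k (y t))].
  move=> /inD tD; have [|yY dy] := yd t; last by rewrite ypos.
  by case/andP: tD => -> /= tT; rewrite (lt_trans tT) // ltrDl.
have ds1 t : D t -> is_derive t 1 s1 (curve_u1 X H k (y t) ^+ 2).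
  move=> Dt; have [yY y_gt0 dy] := facts t Dt.
  have [zs Ha Hb] := collision_admissible (ltW yY).
  have [sp _] := collision_speed (ltW yY).
  have d1 := @is_derive1_comp R W y t _ _ (dW _ yY) dy.
  have d2 : is_derive t 1 s1 _ := is_deriveD (is_derive_cst (1 : R) t 1) d1.
  apply: (is_derive_eq d2); rewrite add0r.
  have alg (u v : R) : v != 0 -> - (u / v) * - v = u by move=> v0; field.
  exact: alg (lt0r_neq0 sp).
have gapE t : s2 t - s1 t = gap X (y t) by rewrite /s2 addrAC subrr add0r.
have eqs t : D t -> [/\
    is_derive t 1 r1 (r1 t * peak_value X (r1 t) (r2 t) (s2 t - s1 t) *
      peak_slope X (r2 t) (s2 t - s1 t)),
    is_derive t 1 r2 (- (r2 t * peak_value X (r2 t) (r1 t) (s2 t - s1 t) *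
      peak_slope X (r1 t) (s2 t - s1 t))),
    is_derive t 1 s1 (peak_value X (r1 t) (r2 t) (s2 t - s1 t) ^+ 2) &
    is_derive t 1 s2 (peak_value X (r2 t) (r1 t) (s2 t - s1 t) ^+ 2)].
  move=> Dt; have [yY y_gt0 dy] := facts t Dt; rewrite gapE.
  have [zs Ha Hb] := collision_admissible (ltW yY).
  have y_neq0 := lt0r_neq0 y_gt0.
  have [e1 e2 e3] := curve_equations zs Ha Hb y_neq0.
  have [_ v1 v2] := curve_values zs Ha Hb y_neq0.
  have d1 := @is_derive1_comp R _ y t _ _ (is_derive_curve_p1 X Ha Hb y_neq0) dy.
  have d2 := @is_derive1_comp R _ y t _ _ (is_derive_curve_p2 X Ha Hb y_neq0) dy.
  have d3 := @is_derive1_comp R _ y t _ _ (is_derive_gap zs) dy.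
  rewrite /r1 /r2; split.
  - exact: (is_derive_eq d1 e1).
  - exact: (is_derive_eq d2 e2).
  - by rewrite v1; exact: ds1.
  - have d4 : is_derive t 1 s2 _ := is_deriveD (ds1 t Dt) d3.
    by apply: (is_derive_eq d4); rewrite e3 v1 addrC subrK.
have E1 t (Dt : D t) := let: And4 h _ _ _ := eqs t Dt in h.
have [m1 d1] := restrict_derive oD E1.
have E2 t (Dt : D t) := let: And4 _ h _ _ := eqs t Dt in h.
have [m2 d2] := restrict_derive oD E2.
have E3 t (Dt : D t) := let: And4 _ _ h _ := eqs t Dt in h.
have [m3 d3] := restrict_derive oD E3.
have E4 t (Dt : D t) := let: And4 _ _ _ h := eqs t Dt in h.
have [m4 d4] := restrict_derive oD E4.
have rD f t : D t -> (f \_ D) t = f t by move=> Dt; rewrite patchT // inE.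
have subD : `[0, T[ `<=` D.
  by move=> t /=; rewrite in_itv /= => /andP[t0 tT]; apply/inD; rewrite tT andbT; lra.
have posD t : 0 < t < T -> D t.
  by move=> /andP[t0 tT]; apply/inD; rewrite tT andbT; lra.
have gap_pos t : D t -> 0 < gap X (y t) <= 1.
  move=> Dt; have [yY y_gt0 _] := facts t Dt.
  have [zs _ _] := collision_admissible (ltW yY).
  rewrite gap_le1 // andbT; apply: lt_le_trans (gap_ge zs).
  by rewrite mulr_gt0 ?exprn_gt0 // divr_gt0 // addr_gt0.
(* The scalar solution continues past the collision, so left limits at T of continuous functions of
   y are their values at y = 0. *)
have dyT : is_derive T 1 y (- curve_speed X H k (y T)).
  by have [|_ //] := yd T; apply/andP; split; lra.
have cyT := is_derive1_continuous dyT.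
exists T, y, (r1 \_ D), (r2 \_ D), (s1 \_ D), (s2 \_ D), 1.
have nD : \forall t \near T^'-, D t.
  near=> t; apply/inD; apply/andP; split => //.
  by near: t; apply: nbhs_left_gt; lra.
split.
- split => //; have m0 : 0 < A X * (Num.sqrt (C X) * delta) * (P * y0) / 4.
    by rewrite divr_gt0 // !mulr_gt0 // sqrtr_gt0.
  apply: le_trans (Tle _ m0 collision_speed_ge) _.
  have alg (u p z : R) : u != 0 -> p != 0 -> z != 0 ->
      z / (u * (p * z) / 4) = 4 / (u * p).
    by move=> u0 p0 z0; field; rewrite u0 p0 z0.
  rewrite alg ?gt_eqF // mulr_gt0 // mulr_gt0 // sqrtr_gt0 //.
- split => //.
  + move=> t tT; have Dt := posD t tT.
    rewrite !rD // gapE; have /andP[g0 g1] := gap_pos t Dt; split => // _.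
    by apply: le_lt_trans g1 _; have := @pi_ge2 R; lra.
  + by move=> t tT; rewrite !(rD _ _ (posD t tT)); exact: d1 (posD t tT).
  + by move=> t tT; rewrite !(rD _ _ (posD t tT)); exact: d2 (posD t tT).
  + by move=> t tT; rewrite !(rD _ _ (posD t tT)); exact: d3 (posD t tT).
  + by move=> t tT; rewrite !(rD _ _ (posD t tT)); exact: d4 (posD t tT).
- apply: (@smooth_peakon_flow R X D) => // t Dt; rewrite !(rD _ _ Dt).
  + exact: d1.
  + exact: d2.
  + exact: d3.
  + exact: d4.
- move=> t t0T; have Dt : D t by apply: subD; rewrite /= in_itv.
  have [yY y_gt0 _] := facts t Dt.
  rewrite !rD // gapE; split => //.
    by rewrite y_gt0 /=; move: yY; rewrite gtr0_norm // => /ltW.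
  split.
  + exact: is_derive1_continuous (d1 t Dt).
  + exact: is_derive1_continuous (d2 t Dt).
  + exact: is_derive1_continuous (d3 t Dt).
  + exact: is_derive1_continuous (d4 t Dt).
- split => //; first by rewrite -yT; exact: cvg_at_left_filter.
  have cs1 : s1 t @[t --> T^'-] --> s1 T.
    apply: cvg_at_left_filter; apply: cvgD; first exact: cvg_cst.
    apply: (@continuous_comp _ _ _ y W) => //; rewrite yT.
    have [|d0 _] := dW 0; first by rewrite normr0.
    by apply: differentiable_continuous; apply/derivable1_diffP.
  rewrite (_ : 1 = s1 T); last by rewrite /s1 yT W0 addr0.
  apply: cvg_trans cs1; apply: near_eq_cvg.
  by apply: filterS nD => t Dt; rewrite rD.
Unshelve. all: by end_near. Qed.

End Collision.

(** * Norms along a collision *)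

Section TwoPeakonNorms.
Context {R : realType}.
Implicit Types (X : spatial_domain) (s a b c q theta : R).

Local Notation pk X a1 a2 b1 b2 :=
  (fun x : R => a1 * profile X (x - b1) + a2 * profile X (x - b2)).

Lemma is_comb_pk X (a1 a2 b1 b2 : R) : is_comb X (pk X a1 a2 b1 b2).
Proof. by apply: is_combD; apply: is_combZ; exact: is_comb_profile. Qed.

Lemma Hs_norm0 X s : s < 3 / 2 -> Hs_norm X s (fun=> 0) = 0.
Proof.
move=> s32; have := Hs_normZ 0 s32 (is_comb_profile X 0).
by under eq_fun do rewrite mul0r; rewrite normr0 mul0r.
Qed.

Lemma pk_norm_le X s (a1 a2 b1 b2 : R) : s < 3 / 2 ->
  Hs_norm X s (pk X a1 a2 b1 b2) <=
  `|a1 + a2| * profile_norm X s + `|a2| * profile_dist X s b1 b2.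
Proof.
move=> s32; have cp := is_comb_profile X b1; have cd := is_comb_dist X b1 b2.
have -> : pk X a1 a2 b1 b2 = (fun x => (a1 + a2) * profile X (x - b1) +
    - a2 * (profile X (x - b1) - profile X (x - b2))).
  by apply/funext => x; ring.
apply: le_trans (Hs_normD s32 (is_combZ _ cp) (is_combZ _ cd)) _.
by rewrite !Hs_normZ // normrN Hs_norm_profile.
Qed.

Lemma pk_norm_ge X s (a1 a2 b1 b2 : R) : s < 3 / 2 ->
  `|a2| * profile_dist X s b1 b2 - `|a1 + a2| * profile_norm X s <=
  Hs_norm X s (pk X a1 a2 b1 b2).
Proof.
move=> s32; have cp := is_comb_profile X b1.
have cu := is_comb_pk X a1 a2 b1 b2.
have := Hs_normD s32 (is_combZ (a1 + a2) cp) (is_combZ (-1) cu).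
have -> : (fun x => (a1 + a2) * profile X (x - b1) +
    -1 * (a1 * profile X (x - b1) + a2 * profile X (x - b2))) =
    (fun x => a2 * (profile X (x - b1) - profile X (x - b2))).
  by apply/funext => x; ring.
rewrite !Hs_normZ ?normrN1 ?mul1r ?Hs_norm_profile //; last exact: is_comb_dist.
by rewrite lerBlDl.
Qed.

(** The change of amplitude and the change of position are separated: (a - a') g(. - b) + a' (g(. -
    b) - g(. - b')). *)
Lemma profile_term_dist X s (a a' b b' : R) : s < 3 / 2 ->
  is_comb X (fun x => a * profile X (x - b) - a' * profile X (x - b')) /\
  Hs_norm X s (fun x => a * profile X (x - b) - a' * profile X (x - b')) <=
  `|a - a'| * profile_norm X s + `|a'| * profile_dist X s b b'.
Proof.
move=> s32; have cp := is_comb_profile X b; have cd := is_comb_dist X b b'.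
have -> : (fun x => a * profile X (x - b) - a' * profile X (x - b')) =
    (fun x => (a - a') * profile X (x - b) +
       a' * (profile X (x - b) - profile X (x - b'))).
  by apply/funext => x; ring.
split; first by apply: is_combD; exact: is_combZ.
apply: le_trans (Hs_normD s32 (is_combZ _ cp) (is_combZ _ cd)) _.
by rewrite (Hs_normZ _ s32 cp) (Hs_normZ _ s32 cd) (Hs_norm_profile X b s32) lexx.
Qed.

Lemma pk_norm_dist X s (a1 a2 b1 b2 c1 c2 d1 d2 : R) : s < 3 / 2 ->
  Hs_norm X s (fun x => pk X a1 a2 b1 b2 x - pk X c1 c2 d1 d2 x) <=
  (`|a1 - c1| * profile_norm X s + `|c1| * profile_dist X s b1 d1) +
  (`|a2 - c2| * profile_norm X s + `|c2| * profile_dist X s b2 d2).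
Proof.
move=> s32.
have [e1 h1] := profile_term_dist X a1 c1 b1 d1 s32.
have [e2 h2] := profile_term_dist X a2 c2 b2 d2 s32.
apply: le_trans (lerD h1 h2).
have -> : (fun x => pk X a1 a2 b1 b2 x - pk X c1 c2 d1 d2 x) =
    (fun x => (a1 * profile X (x - b1) - c1 * profile X (x - d1)) +
       (a2 * profile X (x - b2) - c2 * profile X (x - d2))).
  by apply/funext => x; rewrite opprD addrACA.
exact: Hs_normD s32 e1 e2.
Qed.

(** Both peaks are merged at b1 before the comparison with c g(. - d), so that a2 appears only
    together with the distance of the peaks. *)
Lemma pk_norm_dist1 X s (a1 a2 b1 b2 c d : R) : s < 3 / 2 ->
  Hs_norm X s (fun x => pk X a1 a2 b1 b2 x - c * profile X (x - d)) <=
  (`|a1 + a2 - c| * profile_norm X s + `|c| * profile_dist X s b1 d) +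
  `|a2| * profile_dist X s b1 b2.
Proof.
move=> s32.
have [e1 h1] := profile_term_dist X (a1 + a2) c b1 d s32.
have e2 := is_combZ (- a2) (is_comb_dist X b1 b2).
apply: le_trans (lerD h1 (lexx _)).
have := Hs_normD s32 e1 e2; rewrite (Hs_normZ (- a2) s32 (is_comb_dist X b1 b2)) normrN.
have alg (u v w m n l : R) :
    (u + v) * m - w * l + - v * (m - n) = u * m + v * n - w * l by ring.
have -> : (fun x => (a1 + a2) * profile X (x - b1) - c * profile X (x - d) +
    - a2 * (profile X (x - b1) - profile X (x - b2))) =
    (fun x => pk X a1 a2 b1 b2 x - c * profile X (x - d)).
  by apply/funext => x; exact: alg.
exact.
Qed.

Lemma antipeakonE X c q :
  antipeakon X c q = (fun x : R => - (Num.sqrt c / peakG X 0) * profile X (x - q)).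
Proof.
case: X => /=; apply/funext => x; first by rewrite oppr0 expR0 divr1.
by rewrite sub0r coshN.
Qed.

Lemma cvg_powR0 (T : Type) (F : set_system T) {FF : Filter F} (g : T -> R) theta :
  0 < theta -> (forall t, 0 <= g t) ->
  g t @[t --> F] --> (0 : R) -> g t `^ theta @[t --> F] --> (0 : R).
Proof.
move=> t0 g0 /cvgr0Pnorm_lt cg; apply/cvgr0Pnorm_lt => e e0.
have e' : 0 < e `^ theta^-1 by exact: powR_gt0.
have := cg _ e'; apply: filterS => t; rewrite ger0_norm // => gt.
rewrite ger0_norm ?powR_ge0 // -[ltRHS](powRr1 (ltW e0)) -(mulVf (lt0r_neq0 t0)).
by rewrite powRrM; apply: gt0_ltr_powR => //; rewrite nnegrE ?powR_ge0.
Qed.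

Lemma cvg_dist_powR (T : Type) (F : set_system T) {FF : Filter F} (f : T -> R)
    (l theta : R) : 0 < theta ->
  f t @[t --> F] --> l -> `|f t - l| `^ theta @[t --> F] --> (0 : R).
Proof.
move=> t0 cf; apply: cvg_powR0 => //; apply: norm_cvg0.
under eq_fun do rewrite normr_id.
by rewrite -(normr0 R) -(subrr l); apply: cvg_norm; apply: cvgB => //; exact: cvg_cst.
Qed.

Lemma small_parameter_exists (a b M e theta : R) : 0 < a -> 0 < b -> 0 < e ->
  0 < theta ->
  exists y, [/\ 0 < y, y <= 1, y <= a, y < b & M * y `^ theta < e].
Proof.
move=> a0 b0 e0 t0.
have cM : M * y `^ theta @[y --> 0^'+] --> (0 : R).
  by rewrite -[X in _ --> X](mulr0 M); apply: cvgM; [exact: cvg_cst|exact: powR_cvg0].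
have nM : \forall y \near (0 : R)^'+, `|M * y `^ theta| < e.
  by move/cvgr0Pnorm_lt : cM => /(_ _ e0).
near (0 : R)^'+ => y; exists y; split.
- by near: y; exact: nbhs_right_gt.
- by near: y; exact: nbhs_right_le.
- by near: y; exact: nbhs_right_le.
- by near: y; exact: nbhs_right_lt.
- apply: le_lt_trans (ler_norm _) _; near: y.
  exact: nM.
Unshelve. all: by end_near. Qed.

Lemma powRN_large (M b : R) : 0 < b -> exists2 r, 0 < r &
  forall y, 0 < y -> y <= r -> M <= y `^ (- b).
Proof.
move=> b0; exists ((`|M| + 1) `^ (- b^-1)).
  by rewrite powR_gt0 // ltr_wpDl.
move=> y y0 yr; have M1 : 0 < `|M| + 1 by rewrite ltr_wpDl.
apply: (@le_trans _ _ (`|M| + 1)).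
  by rewrite (le_trans (ler_norm M)) // lerDl.
have -> : `|M| + 1 = ((`|M| + 1) `^ (- b^-1)) `^ (- b).
  by rewrite -powRrM mulrNN mulVf ?gt_eqF // powRr1 // ltW.
rewrite !powRN lef_pV2 ?posrE ?powR_gt0 ?invr_gt0 ?powR_gt0 //.
by apply: ge0_ler_powR; rewrite ?nnegrE -?powRN ?powR_ge0 //; exact: ltW.
Qed.

End TwoPeakonNorms.

(** * Continuity, blow-up and limit of the norm *)

Section CollisionNorms.
Context {R : realType}.
Implicit Types (X : spatial_domain) (s T : R) (p q y : R -> R).

Lemma is_comb_two_peakon X p1 p2 q1 q2 t : is_comb X ((two_peakon X p1 p2 q1 q2) ^~ t).
Proof. exact: is_comb_pk. Qed.

(** Hoelder exponents theta < 3 / 2 - s are available for translations. The product of |p2| ~ 1 / y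
    and (y^4)^theta tends to 0 once theta > 1 / 4, and such a theta exists below 3 / 2 - s when s <
    5 / 4. *)
Lemma theta_exists s : s < 3 / 2 ->
  exists theta : R, [/\ 0 < theta <= 1, theta < 3 / 2 - s & s < 5 / 4 -> 1 / 4 < theta].
Proof.
move=> s32; have [s54|s54] := ltP s (5 / 4); last first.
  by exists ((3 / 2 - s) / 2); split; [apply/andP; split; lra|lra|lra].
have [s0|s0] := ltP s (1 / 4).
  by exists 1; split; [rewrite ltr01 lexx|lra|lra].
exists ((1 / 4 + (3 / 2 - s)) / 2); split; [apply/andP; split; lra|lra|].
by move=> _; lra.
Qed.

Lemma C_Hs_two_peakon X s (I : set R) p1 p2 q1 q2 : s < 3 / 2 ->
  (forall t, I t -> [/\ {for t, continuous p1}, {for t, continuous p2},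
                        {for t, continuous q1} & {for t, continuous q2}]) ->
  C_Hs X s I (two_peakon X p1 p2 q1 q2).
Proof.
move=> s32 cont; split => [t _|t0 It0].
  by apply: in_Hs_is_comb => //; exact: is_comb_two_peakon.
have [theta [th01 ths _]] := theta_exists s32; have [th0 _] := andP th01.
have [K K0 dK] := profile_dist_le X th01 ths.
have [c1 c2 c3 c4] := cont _ It0.
pose bound t := (`|p1 t - p1 t0| * profile_norm X s +
    `|p1 t0| * (K * `|q1 t - q1 t0| `^ theta)) +
  (`|p2 t - p2 t0| * profile_norm X s + `|p2 t0| * (K * `|q2 t - q2 t0| `^ theta)).
have FF : Filter (within I (nbhs t0)) by exact: within_filter.
have cb : bound t @[t --> within I (nbhs t0)] --> (0 : R).
  have term (p q : R -> R) : {for t0, continuous p} -> {for t0, continuous q} ->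
      `|p t - p t0| * profile_norm X s + `|p t0| * (K * `|q t - q t0| `^ theta)
      @[t --> within I (nbhs t0)] --> (0 : R).
    move=> cp cq.
    rewrite [X in _ --> X](_ : 0 = 0 * profile_norm X s + `|p t0| * (K * 0)); last first.
      by rewrite !mulr0 mul0r addr0.
    apply: cvgD.
      apply: cvgM; last exact: cvg_cst.
      rewrite -(normr0 R) -(subrr (p t0)); apply: cvg_norm; apply: cvgB; last exact: cvg_cst.
      by apply: cvg_within_filter; exact: cp.
    apply: cvgM; first exact: cvg_cst.
    apply: cvgM; first exact: cvg_cst.
    by apply: cvg_dist_powR => //; apply: cvg_within_filter; exact: cq.
  by rewrite -(addr0 0); apply: cvgD; exact: term.
apply: (squeeze_cvgr _ (cvg_cst (0 : R)) cb); near=> t.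
rewrite sqrtr_ge0 /=; apply: le_trans (pk_norm_dist X _ _ _ _ _ _ _ _ s32) _.
by apply: lerD; apply: lerD => //; apply: ler_wpM2l => //; exact: dK.
Unshelve. all: by end_near. Qed.

(** At an earlier time the extension coincides with u nearby; at T only the left limit is at stake,
    as the extension is constant from T on. *)
Lemma C_Hs_extend X s T (u : R -> R -> R) (U : R -> R) : s < 3 / 2 ->
  C_Hs X s `[0, T[ u -> is_comb X U ->
  Hs_norm X s (fun x => u x t - U x) @[t --> T^'-] --> (0 : R) ->
  C_Hs X s `[0, T] (extend_at T u U).
Proof.
move=> s32 [inu cu] cU limu; split => t0 /=; rewrite in_itv /= => /andP[t00 t0T].
  have [tT|tT] := ltP t0 T.
    have -> : (extend_at T u U) ^~ t0 = u ^~ t0.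
      by apply/funext => x; rewrite /extend_at tT.
    by apply: inu; rewrite /= in_itv /= t00.
  have -> : (extend_at T u U) ^~ t0 = U.
    by apply/funext => x; rewrite /extend_at ltNge tT.
  exact: in_Hs_is_comb.
have [tT|tT] := ltP t0 T.
  have It0 : `[0, T[%classic t0 by rewrite /= in_itv /= t00.
  have /cvgr0Pnorm_lt h := cu _ It0.
  apply/cvgr0Pnorm_lt => e e0.
  have h1 : nbhs t0 (fun t => `[0, T[%classic t ->
    `|Hs_norm X s (fun x : R => u x t - u x t0)| < e) := h e e0.
  have h2 : nbhs t0 (fun t => t < T) by exact: lt_nbhsl.
  change (nbhs t0 (fun t => `[0, T]%classic t ->
    `|Hs_norm X s (fun x => extend_at T u U x t - extend_at T u U x t0)| < e)).
  apply: filterS2 h1 h2 => t h1 t3; rewrite /= in_itv /= => /andP[t1 _].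
  by rewrite /extend_at t3 tT; apply: h1; rewrite /= in_itv /= t1.
have e0T : t0 = T by apply/eqP; rewrite eq_le t0T tT.
move/cvgr0Pnorm_lt : limu => h; apply/cvgr0Pnorm_lt => e e0.
have h1 : nbhs T (fun t => t < T -> `|Hs_norm X s (fun x : R => u x t - U x)| < e) := h e e0.
rewrite e0T; change (nbhs T (fun t => `[0, T]%classic t ->
  `|Hs_norm X s (fun x => extend_at T u U x t - extend_at T u U x T)| < e)).
apply: filterS h1 => t h1 _.
rewrite /extend_at ltxx; have [t3|t3] := ltP t T; first exact: h1.
have -> : (fun x : R => U x - U x) = (fun=> 0) by apply/funext => x; rewrite subrr.
by rewrite Hs_norm0 // normr0.
Qed.

(** The distance of the two profiles is at least c1 y^{6 - 4 s}, and |p2| is about B / (2 y). Their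
    product has the negative exponent 5 - 4 s, while p1 + p2 contributes a bounded amount. *)
Lemma collision_blowup X s T p1 p2 q1 q2 y (w0 B cq : R) :
  5 / 4 < s < 3 / 2 -> 0 < B -> 0 < cq -> 0 <= w0 ->
  (\forall t \near T^'-, [/\ 0 < y t, `|p1 t + p2 t| <= w0,
     (B / y t - w0) / 2 <= `|p2 t|, 0 < q2 t - q1 t <= 1 &
     cq * y t ^+ 4 <= q2 t - q1 t]) ->
  y t @[t --> T^'-] --> (0 : R) ->
  Hs_norm X s ((two_peakon X p1 p2 q1 q2) ^~ t) @[t --> T^'-] --> +oo.
Proof.
move=> /andP[s54 s32] B0 cq0 w00 facts y0.
have [c c0 dc] := profile_dist_ge X s32.
pose r := 3 / 2 - s; have r0 : 0 < r by rewrite /r; lra.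
pose c1 := c * cq `^ r; have c10 : 0 < c1 by rewrite mulr_gt0 ?powR_gt0.
pose n0 := profile_norm X s; have n00 : 0 < n0 by exact: profile_norm_gt0.
apply/cvgryPge => M.
(* For y <= rho the main term (c1 B / 2) y^{5 - 4 s} exceeds M plus the two errors: w0 c1 / 2 from
   the lower bound of |p2|, and w0 n0 from the part carried by p1 + p2. *)
have [rho rho0 large] := @powRN_large R
  ((M + w0 * c1 / 2 + w0 * n0) / (c1 * B / 2)) (4 * s - 5) ltac:(lra).
have y1 : \forall t \near T^'-, `|y t| < Num.min rho 1.
  by move/cvgr0Pnorm_lt : y0; apply; rewrite lt_min rho0 ltr01.
apply: filterS2 facts y1 => t [yt w1 p2t /andP[Q0 Q1] Qt].
rewrite gtr0_norm // lt_min => /andP[yr y1].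
apply: le_trans (pk_norm_ge X _ _ _ _ s32).
set d := profile_dist X s (q1 t) (q2 t).
have d1 : c1 * y t `^ (6 - 4 * s) <= d.
  apply: le_trans (dc (q1 t) (q2 t) _); last by rewrite Q0.
  rewrite -mulrA ler_pM2l // (_ : 6 - 4 * s = 4%:R * r); last by rewrite /r; field.
  rewrite powRrM (powR_mulrn 4 (ltW yt)) -powRM ?(ltW cq0) ?exprn_ge0 ?(ltW yt) //.
  by apply: ge0_ler_powR; rewrite ?nnegrE ?(ltW r0) ?(ltW Q0) // mulr_ge0 ?exprn_ge0 ?(ltW yt) ?(ltW cq0).
pose z := y t `^ (- (4 * s - 5)).
have zE : y t `^ (6 - 4 * s) = y t * z.
  rewrite (_ : 6 - 4 * s = 1 + - (4 * s - 5)); last by ring.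
  by rewrite (@powRD _ _ 1) ?(gt_eqF yt) ?implybT // powRr1 // ltW.
have z0 : 0 < z by exact: powR_gt0.
have yz1 : y t * z <= 1.
  rewrite -zE; apply: (@le_trans _ _ (1 `^ (6 - 4 * s))); last by rewrite powR1.
  by apply: ge0_ler_powR; rewrite ?nnegrE ?(ltW yt) ?(ltW y1) //; lra.
have := large (y t) yt (ltW yr); rewrite -/z ler_pdivrMr; last first.
  by rewrite divr_gt0 // mulr_gt0.
move=> Mz.
have h1 : (B / y t - w0) / 2 * d <= `|p2 t| * d by apply: ler_wpM2r => //; exact: sqrtr_ge0.
have h2 : `|p1 t + p2 t| * n0 <= w0 * n0 by apply: ler_wpM2r => //; exact: ltW.
suff h3 : M + w0 * n0 <= `|p2 t| * d by rewrite lerBrDr; apply: le_trans h3; rewrite lerD2l.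
(* Here the lower bound for |p2| is void. But B z <= w0, as y z <= 1, and then the choice of rho
   forces M + w0 n0 <= 0, so nothing is left to bound. *)
have [neg|pos] := ltP (B / y t - w0) 0.
  have h4 : B / y t * (y t * z) <= w0 * 1.
    apply: ler_pM yz1; [exact: divr_ge0 (ltW B0) (ltW yt)|exact: mulr_ge0 (ltW yt) (ltW z0)|].
    by rewrite -subr_le0 ltW.
  have h5 : B * z <= w0 by rewrite -[w0]mulr1; apply: le_trans h4; rewrite mulrA divfK ?gt_eqF.
  have h6 : c1 * (B * z) <= c1 * w0 by rewrite ler_pM2l.
  have p2d : 0 <= `|p2 t| * d by rewrite mulr_ge0 // sqrtr_ge0.
  apply: le_trans p2d; move: Mz h6.
  have -> : z * (c1 * B / 2) = c1 * (B * z) / 2 by field.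
  by rewrite (mulrC w0 c1); move: (c1 * (B * z)) (c1 * w0) (w0 * n0) => u v w; lra.
have h4 : (B / y t - w0) / 2 * (c1 * (y t * z)) <= (B / y t - w0) / 2 * d.
  by rewrite -zE; apply: ler_wpM2l => //; rewrite divr_ge0.
apply: le_trans h1; apply: le_trans h4.
have -> : (B / y t - w0) / 2 * (c1 * (y t * z)) = z * (c1 * B / 2) - w0 * c1 / 2 * (y t * z).
  by field; rewrite gt_eqF.
have : w0 * c1 / 2 * (y t * z) <= w0 * c1 / 2 * 1.
  by apply: ler_wpM2l => //; rewrite divr_ge0 // mulr_ge0 // ltW.
by move: Mz; rewrite mulr1; move: (w0 * c1 / 2) (_ * (y t * z)) (w0 * n0) (z * _) => u v w x; lra.
Qed.

(** The difference of the two profiles, weighted by |p2| <= M / y, is at most a constant times y^{4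
    theta - 1} with 4 theta > 1; what remains is one moving profile with convergent amplitude and
    position. *)
Lemma collision_limit X s T p1 p2 q1 q2 y (M Kq c qT : R) : s < 5 / 4 ->
  0 <= M -> 0 <= Kq ->
  (\forall t \near T^'-, [/\ 0 < y t, `|p2 t| <= M / y t &
     0 < q2 t - q1 t <= Kq * y t ^+ 4]) ->
  y t @[t --> T^'-] --> (0 : R) -> p1 t + p2 t @[t --> T^'-] --> c ->
  q1 t @[t --> T^'-] --> qT ->
  Hs_norm X s (fun x => two_peakon X p1 p2 q1 q2 x t - c * profile X (x - qT))
    @[t --> T^'-] --> (0 : R).
Proof.
move=> s54 M0 Kq0 facts y0 cw cq; have s32 : s < 3 / 2 by lra.
have [theta [th01 ths th4]] := theta_exists s32; have [th0 _] := andP th01.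
have {}th4 := th4 s54.
have [K K0 dK] := profile_dist_le X th01 ths.
pose n0 := profile_norm X s.
pose g t := `|p1 t + p2 t - c| * n0 + `|c| * (K * `|q1 t - qT| `^ theta) +
  M * K * Kq `^ theta * `|y t - 0| `^ (4 * theta - 1).
have cg : g t @[t --> T^'-] --> (0 : R).
  rewrite [X in _ --> X](_ : 0 = 0 * n0 + `|c| * (K * 0) + M * K * Kq `^ theta * 0); last first.
    by rewrite !mulr0 mul0r !addr0.
  apply: cvgD; [apply: cvgD|].
  - apply: cvgM; last exact: cvg_cst.
    by rewrite -(normr0 R) -(subrr c); apply: cvg_norm; apply: cvgB => //; exact: cvg_cst.
  - apply: cvgM; first exact: cvg_cst.
    apply: cvgM; first exact: cvg_cst.
    exact: cvg_dist_powR.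
  - apply: cvgM; first exact: cvg_cst.
    by apply: cvg_dist_powR => //; lra.
apply: (squeeze_cvgr _ (cvg_cst (0 : R)) cg).
apply: filterS facts => t [yt p2t /andP[Q0 Qt]]; rewrite sqrtr_ge0 /=.
apply: le_trans (pk_norm_dist1 X _ _ _ _ _ _ s32) _; apply: lerD.
  by apply: lerD => //; apply: ler_wpM2l => //; exact: dK.
rewrite subr0 (gtr0_norm yt).
have -> : M * K * Kq `^ theta * y t `^ (4 * theta - 1) =
    M / y t * (K * (Kq `^ theta * y t `^ (4 * theta))).
  rewrite (@powRB _ _ (4 * theta) 1); last by rewrite (gt_eqF yt) implybT.
  rewrite powRr1; last exact: ltW.
  by move: (_ `^ _) (_ `^ _) => u v; field; rewrite gt_eqF.
apply: ler_pM => //; first exact: sqrtr_ge0.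
apply: le_trans (dK _ _) _; apply: ler_wpM2l => //.
rewrite distrC (gtr0_norm Q0) (powRrM _ 4%:R) (powR_mulrn 4 (ltW yt)).
rewrite -powRM ?exprn_ge0 ?(ltW yt) //.
by apply: ge0_ler_powR; rewrite ?nnegrE ?(ltW th0) ?(ltW Q0) // mulr_ge0 ?exprn_ge0 ?(ltW yt).
Qed.

Lemma curve_momenta_bounds X (H k z : R) : 0 < z ->
  let a := amplitude_sum H k z / Num.sqrt (peakG X 0) in
  let b := amplitude_gap H k z / Num.sqrt (peakG X 0) / z in
  [/\ curve_p1 X H k z + curve_p2 X H k z = - a, `|curve_p1 X H k z + curve_p2 X H k z| = a,
      (b - a) / 2 <= `|curve_p2 X H k z| & `|curve_p2 X H k z| <= a + b].
Proof.
move=> z0 a b.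
have a0 : 0 <= a by rewrite divr_ge0 // sqrtr_ge0.
have b0 : 0 <= b by rewrite divr_ge0 ?(ltW z0) // divr_ge0 // sqrtr_ge0.
have e2 : curve_p2 X H k z = (- a + b) / 2 by rewrite /curve_p2 invfM mulrA.
have e1 : curve_p1 X H k z = (- a - b) / 2 by rewrite /curve_p1 invfM mulrA.
have e12 : curve_p1 X H k z + curve_p2 X H k z = - a by rewrite e1 e2; field.
rewrite e12 normrN ger0_norm // e2; split => //.
  by apply: le_trans (ler_norm _); rewrite addrC.
by rewrite ler_norml; apply/andP; split; lra.
Qed.

End CollisionNorms.

(** * Choice of the constants and conclusion *)

Unset Implicit Arguments.

Theorem theorem1 (R : realType) (X : spatial_domain) (s : R) (hs : s < 3 / 2)
    (eps : R) (heps : 0 < eps) :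
  exists (T : R) (p1 p2 q1 q2 : R -> R),
    let u := two_peakon X p1 p2 q1 q2 in
    [/\ [/\ 0 < T, two_peakon_solution X T p1 p2 q1 q2, lifespan T q1 q2 &
            C_Hs X s `[0, T[ u],
        T < eps,
        Hs_norm X s (u ^~ 0) < eps,
        5 / 4 < s -> Hs_norm X s (u ^~ t) @[t --> T^'-] --> +oo &
        s < 5 / 4 ->
          exists C : R,
            [/\ 0 < C,
                Hs_norm X s (u ^~ t) @[t --> T^'-] --> C &
                exists cT qT : R,
                  let uT := antipeakon X cT qT in
                  [/\ 0 < cT, 0 < qT,
                      Hs_norm X s (fun x => u x t - uT x) @[t --> T^'-] --> 0,
                      Hs_norm X s uT = C &
                      C_Hs X s `[0, T] (extend_at T u uT)]]].
Proof.
pose G : R := peakG X 0; have G0 : 0 < G by exact: peakG_gt0.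
pose A : R := peakA X; have A0 : 0 < A by exact: peakA_gt0.
pose c : R := Num.sqrt G; have c0 : 0 < c by rewrite sqrtr_gt0.
have cE : G = c ^+ 2 by rewrite sqr_sqrtr // ltW.
have [theta [th01 ths th4]] := theta_exists hs; have [th0 _] := andP th01.
have [K K0 dK] := profile_dist_le X th01 ths.
pose n0 := profile_norm X s; have n00 : 0 < n0 by exact: profile_norm_gt0.
(* Initially p1 + p2 = - delta, so the part (p1 + p2) g(. - q1) has norm delta n0; the 1 makes this
   strictly less than eps / 2. *)
pose delta := eps / (2 * (n0 + 1)).
have delta0 : 0 < delta by rewrite divr_gt0 // mulr_gt0 // addr_gt0.
(* Makes the bound 4 / (A c delta P) on the lifespan equal to eps / 2. *)
pose P := 8 / (A * (c * delta) * eps).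
have P0 : 0 < P by rewrite divr_gt0 // mulr_gt0 // mulr_gt0 // mulr_gt0.
pose Kq := 4 * (1 + 2 * G / A).
have Kq0 : 0 <= Kq by rewrite mulr_ge0 // addr_ge0 // divr_ge0 ?(ltW A0) // mulr_ge0 // ltW.
(* A bound for the initial p2 - p1 that holds for every y0 <= 1; it is available before y0 is
   chosen. *)
pose D0 := Num.sqrt (4 * P ^+ 2 + G * delta ^+ 2) / c.
have D00 : 0 <= D0 by rewrite divr_ge0 ?sqrtr_ge0 // ltW.
(* The requirements are stated with y0 in place of y0^4, which is enough as y0 <= 1: the two
   smallness hypotheses of the collision, and a contribution of the difference of profiles below eps
   / 2. *)
have [y0 [y00 y01 y0a y0b y0e]] := @small_parameter_exists R (A / (8 * G))
  (G * delta ^+ 2 / (6 * P ^+ 2)) ((delta + D0) * (K * Kq `^ theta)) (eps / 2) theta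
  ltac:(by rewrite divr_gt0 // mulr_gt0)
  ltac:(by rewrite divr_gt0 // mulr_gt0 // exprn_gt0)
  ltac:(by rewrite divr_gt0) th0.
have y0s : 8 * G * y0 <= A by rewrite mulrC -ler_pdivlMr // mulr_gt0.
have y04 : y0 ^+ 4 <= y0.
  by rewrite exprS ler_piMr ?(ltW y00) // expr_le1 // ltW.
have y0d : 6 * P ^+ 2 * y0 ^+ 4 < G * delta ^+ 2.
  have P6 : 0 < 6 * P ^+ 2 by rewrite mulr_gt0 // exprn_gt0.
  apply: (@le_lt_trans _ _ (6 * P ^+ 2 * y0)); first by rewrite ler_pM2l.
  by rewrite mulrC -ltr_pdivlMr.
have [T [y [p1 [p2 [q1 [q2 [qT [[T0 TP] flow smooth facts [yE y_cvg qT0 q_cvg]]]]]]]]] :=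
  @peakon_collision R X P delta y0 P0 delta0 y00 y0s y0d.
move: facts; set k := P ^+ 2 * y0 ^+ 2; set H := 2 * k * y0 ^+ 2 + G * delta ^+ 2 => facts.
have k0 : 0 < k by rewrite mulr_gt0 // exprn_gt0.
have H0 : 0 < H.
  apply: addr_gt0; apply: mulr_gt0; [exact: mulr_gt0|exact: exprn_gt0|exact: G0|].
  exact: exprn_gt0.
exists T, p1, p2, q1, q2 => u.
pose w0 := Num.sqrt H / c; pose B := Num.sqrt k / c.
(* From |p2| <= a / c + b / (c y): the bounded first term is also at most 2 y0 w0 / y, since y <= 2
   y0. *)
pose M := 2 * y0 * w0 + Num.sqrt (H * (2 * y0) ^+ 2 + 2 * k) / c.
have w00 : 0 <= w0 by rewrite divr_ge0 ?sqrtr_ge0 // ltW.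
have B0 : 0 < B by rewrite divr_gt0 // sqrtr_gt0.
pose cq := G / (G + A); have cq0 : 0 < cq by rewrite divr_gt0 // addr_gt0.
have M0 : 0 <= M.
  apply: addr_ge0; last exact: divr_ge0 (sqrtr_ge0 _) (ltW c0).
  by apply: mulr_ge0 w00; exact: mulr_ge0 (ler0n _ 2) (ltW y00).
have bounds t : 0 <= t < T ->
  [/\ 0 < y t, p1 t + p2 t = - (amplitude_sum H k (y t) / c),
      `|p1 t + p2 t| <= w0, (B / y t - w0) / 2 <= `|p2 t| & `|p2 t| <= M / y t] /\
  [/\ 0 < q2 t - q1 t <= 1, cq * y t ^+ 4 <= q2 t - q1 t &
      q2 t - q1 t <= Kq * y t ^+ 4].
  move=> tT; have [/andP[yt yY] e1 e2 eQ _] := facts t tT.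
  have ys : small_parameter X (y t).
    rewrite /small_parameter gtr0_norm //; apply: le_trans yY _.
    rewrite ler_pdivlMr ?mulr_gt0 //.
    by rewrite (_ : 2 * y0 * (4 * peakG X 0) = 8 * G * y0) // /G; ring.
  have Q4 := gap_ge ys; rewrite eQ; split; last first.
    split; [|exact: Q4|exact: gap_le].
    by rewrite gap_le1 // andbT; apply: lt_le_trans Q4; rewrite mulr_gt0 // exprn_gt0.
  have [h1 h2 h3 h4] := curve_momenta_bounds X H k yt; rewrite -!e1 -!e2 in h1 h2 h3 h4.
  have a1 : amplitude_sum H k (y t) / c <= w0.
    apply: ler_wpM2r; first by rewrite invr_ge0 ltW.
    apply: ler_wsqrtr; rewrite gerBl; apply: mulr_ge0 (sqr_ge0 _).
    exact: mulr_ge0 (ler0n _ 2) (ltW k0).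
  have b1 : B / y t <= amplitude_gap H k (y t) / c / y t.
    apply: ler_wpM2r; first by rewrite invr_ge0 ltW.
    apply: ler_wpM2r; first by rewrite invr_ge0 ltW.
    apply: ler_wsqrtr; have : 0 <= H * y t ^+ 2 by rewrite mulr_ge0 ?sqr_ge0 // ltW.
    by move: k0; clear; move: (H * _) => v k0 v0; lra.
  have b2 : amplitude_gap H k (y t) / c / y t <=
      Num.sqrt (H * (2 * y0) ^+ 2 + 2 * k) / c / y t.
    apply: ler_wpM2r; first by rewrite invr_ge0 ltW.
    apply: ler_wpM2r; first by rewrite invr_ge0 ltW.
    apply: ler_wsqrtr; rewrite lerD2r ler_pM2l //.
    by apply: lerXn2r => //; rewrite nnegrE ?mulr_ge0 // ltW.
  have w1 : w0 <= 2 * y0 * w0 / y t.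
    by rewrite ler_pdivlMr // mulrC; apply: ler_wpM2r.
  split => //.
  - by rewrite h2.
  - apply: le_trans h3; apply: ler_wpM2r; first by rewrite invr_ge0.
    exact: lerB b1 a1.
  - apply: le_trans h4 _; rewrite /M mulrDl; apply: lerD b2.
    exact: le_trans a1 w1.
have nT : \forall t \near T^'-, 0 <= t < T.
  near=> t; apply/andP; split => //.
  by apply: ltW; near: t; exact: nbhs_left_gt.
have uC : C_Hs X s `[0, T[ u.
  apply: C_Hs_two_peakon => // t; rewrite /= in_itv /= => tT.
  by have [_ _ _ _] := facts t tT.
split.
- split => //.
  + split => //; last exact: novikov_peakon_flow.
    by move=> t tT; have [_ [/andP[]]] := bounds t tT.
  + have cz : Kq * y t ^+ 4 @[t --> T^'-] --> (0 : R).
      rewrite [X in _ --> X](_ : 0 = Kq * 0 ^+ 4); last by rewrite expr0n mulr0.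
      apply: cvgM; first exact: cvg_cst.
      exact: (cvg_comp y (fun z : R => z ^+ 4) y_cvg (@exprn_continuous R 4 0)).
    apply: (squeeze_cvgr _ (cvg_cst (0 : R)) cz).
    by apply: filterS nT => t tT; have [_ [/andP[/ltW -> _] _ ->]] := bounds t tT.
- apply: le_lt_trans TP _; rewrite -/G -/c -/A.
  have -> : 4 / (A * (c * delta) * P) = eps / 2.
    by rewrite /P; field; rewrite !gt_eqF.
  by rewrite ltr_pdivrMr // ltr_pMr // ltr1n.
- have t00 : 0 <= (0 : R) < T by rewrite lexx.
  have [_ [Q01 _ QK]] := bounds 0 t00; have [_ e1 e2 _ _] := facts 0 t00.
  rewrite yE in e1 e2 QK.
  have [_ h2 _ h4] := curve_momenta_bounds X H k y00; rewrite -e1 -e2 -/G -/c in h2 h4.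
  have aE : amplitude_sum H k y0 / c = delta.
    rewrite /amplitude_sum /H addrAC subrr add0r sqrtrM ?(ltW G0) // sqrtr_sqr.
    by rewrite gtr0_norm // -/c mulrAC mulfV ?mul1r // gt_eqF.
  have bE : amplitude_gap H k y0 / c / y0 <= D0.
    rewrite mulrAC; apply: ler_wpM2r; first by rewrite invr_ge0 ltW.
    rewrite ler_pdivrMr // -[y0 in leRHS](gtr0_norm y00) -sqrtr_sqr -sqrtrM; last first.
      by rewrite addr_ge0 // mulr_ge0 ?sqr_ge0 // ltW.
    apply: ler_wsqrtr; rewrite /H /k.
    have y02 : y0 ^+ 4 <= 1 by rewrite (le_trans y04).
    have e : P ^+ 2 * y0 ^+ 2 * y0 ^+ 4 <= P ^+ 2 * y0 ^+ 2 * 1.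
      by apply: ler_wpM2l => //; rewrite mulr_ge0 ?sqr_ge0.
    have -> : (2 * (P ^+ 2 * y0 ^+ 2) * y0 ^+ 2 + G * delta ^+ 2) * y0 ^+ 2 +
        2 * (P ^+ 2 * y0 ^+ 2) = 2 * (P ^+ 2 * y0 ^+ 2 * y0 ^+ 4) +
        G * delta ^+ 2 * y0 ^+ 2 + 2 * (P ^+ 2 * y0 ^+ 2) by ring.
    have -> : (4 * P ^+ 2 + G * delta ^+ 2) * y0 ^+ 2 =
        4 * (P ^+ 2 * y0 ^+ 2) + G * delta ^+ 2 * y0 ^+ 2 by ring.
    move: e; rewrite mulr1; have alg (a b d : R) : a <= b ->
      2 * a + d + 2 * b <= 4 * b + d by lra.
    exact: alg.
  apply: le_lt_trans (pk_norm_le X _ _ _ _ hs) _; rewrite h2 aE.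
  have n1 : delta * n0 < eps / 2.
    have -> : eps / 2 = delta * (n0 + 1).
      by rewrite /delta; field; rewrite gt_eqF // addr_gt0.
    by rewrite ltr_pM2l // ltrDl.
  have d1 : profile_dist X s (q1 0) (q2 0) <= K * (Kq `^ theta * y0 `^ theta).
    apply: le_trans (dK _ _) _; apply: ler_wpM2l => //.
    have /andP[Q0 _] := Q01; rewrite distrC (gtr0_norm Q0) -powRM ?(ltW y00) //.
    apply: ge0_ler_powR; rewrite ?nnegrE ?(ltW th0) ?(ltW Q0) //.
      by rewrite mulr_ge0 // ltW.
    by apply: le_trans QK _; apply: ler_wpM2l.
  have p2d : `|p2 0| * profile_dist X s (q1 0) (q2 0) <=
      (delta + D0) * (K * (Kq `^ theta * y0 `^ theta)).
    apply: ler_pM => //; first exact: sqrtr_ge0.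
    by apply: le_trans h4 _; rewrite aE lerD2l.
  have -> : eps = eps / 2 + eps / 2 by field.
  apply: ltr_leD n1 _; apply: le_trans p2d _.
  by rewrite !mulrA -(mulrA (delta + D0)) ltW.
- move=> s54; apply: (@collision_blowup R X s T p1 p2 q1 q2 y w0 B cq) => //.
    by rewrite s54.
  by apply: filterS nT => t tT; have [[? ? ? ? ?] [? ? ?]] := bounds t tT.
(* The sum p1 + p2 tends to - sqrt H / sqrt C, while the antipeakon has amplitude sqrt cT / C in
   units of the profile; equating the two gives cT = C H. *)
- move=> s54; pose cT := G * H; have cT0 : 0 < cT by rewrite mulr_gt0.
  pose kT := - (Num.sqrt cT / G).
  have kTE : kT = - (Num.sqrt H / c).
    rewrite /kT /cT sqrtrM ?(ltW G0) // -/c cE; congr (- _).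
    by move: (Num.sqrt H) => h; field; rewrite gt_eqF.
  have w_cvg : p1 t + p2 t @[t --> T^'-] --> kT.
    have ca : amplitude_sum H k (y t) @[t --> T^'-] --> Num.sqrt H.
      have Ha : 0 < H - 2 * k * 0 ^+ 2 by rewrite expr0n mulr0 subr0.
      have ca0 := is_derive1_continuous (is_derive_amplitude_sum Ha).
      have a0E : amplitude_sum H k 0 = Num.sqrt H.
        by rewrite /amplitude_sum expr0n mulr0 subr0.
      have ca : amplitude_sum H k z @[z --> (0 : R)] --> Num.sqrt H.
        by rewrite -a0E; exact: ca0.
      exact: (cvg_comp y (amplitude_sum H k) y_cvg ca).
    have cw : - (amplitude_sum H k (y t) / c) @[t --> T^'-] --> kT.
      by rewrite kTE; apply: cvgN; apply: cvgM => //; exact: cvg_cst.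
    apply: cvg_trans cw; apply: near_eq_cvg.
    by apply: filterS nT => t tT; have [[_ -> _ _ _] _] := bounds t tT.
  have lim : Hs_norm X s (fun x => u x t - antipeakon X cT qT x) @[t --> T^'-] --> (0 : R).
    rewrite antipeakonE.
    apply: (@collision_limit R X s T p1 p2 q1 q2 y M Kq kT qT) => //.
    by apply: filterS nT => t tT; have [[? ? ? ? ?] [/andP[? ?] ? ?]] := bounds t tT;
      split => //; apply/andP.
  have cuT : is_comb X (antipeakon X cT qT).
    by rewrite antipeakonE; apply: is_combZ; exact: is_comb_profile.
  exists (Hs_norm X s (antipeakon X cT qT)); split.
  + rewrite antipeakonE Hs_normZ // ?Hs_norm_profile //; last exact: is_comb_profile.
    by rewrite mulr_gt0 // normr_gt0 oppr_eq0 gt_eqF // divr_gt0 // sqrtr_gt0.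
  + apply/subr_cvg0; apply: norm_cvg0.
    apply: (squeeze_cvgr _ (cvg_cst (0 : R)) lim); near=> t.
    rewrite normr_ge0 /=; apply: Hs_norm_dist => //.
    exact: is_comb_two_peakon.
  + by exists cT, qT; split => //; exact: C_Hs_extend.
Unshelve. all: by end_near. Qed.
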